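(* Let $\mathcal R$ be an operator system, let $\mathrm I(\mathcal R)$ be its injective envelope with canonical unital complete order embedding $\iota_{\rm ie}:\mathcal R\rightarrow \mathrm I(\mathcal R)$, and let $\mathrm C^*_{\rm e}(\mathcal R)$ be its C$^*$-envelope. The following statements are equivalent: (1) $\iota_{\rm ie}$ is pure in the cone $\mathcal{CP}(\mathcal R,\mathrm I(\mathcal R))$; (2) the C$^*$-algebra $\mathrm C^*_{\rm e}(\mathcal R)$ is prime.
   Context: An operator system is a matrix-ordered complex $*$-vector space with a distinguished Archimedean (matrix) order unit; equivalently (Choi--Effros), up to unital complete order isomorphism, a unital selfadjoint linear subspace of $\mathcal B(\mathcal H)$ for some Hilbert space $\mathcal H$. A complete order embedding is an injective completely positive linear map that is a complete order isomorphism (the map and its inverse are completely positive) onto its range, the range being an operator subsystem of the codomain. For operator systems $\mathcal R,\mathcal T$, $\mathcal{CP}(\mathcal R,\mathcal T)$ is the convex cone of completely positive linear maps $\mathcal R\to\mathcal T$. An element $\phi$ is pure in $\mathcal{CP}(\mathcal R,\mathcal T)$ if, whenever $\vartheta,\omega\in\mathcal{CP}(\mathcal R,\mathcal T)$ satisfy $\vartheta+\omega=\phi$, there is $s\in[0,1]$ with $\vartheta=s\phi$ and $\omega=(1-s)\phi$. An operator system $\mathcal I$ is injective if for every inclusion $\mathcal R\subseteq\mathcal T$ of operator systems every completely positive linear map $\mathcal R\to\mathcal I$ extends to a completely positive linear map $\mathcal T\to\mathcal I$. An injective envelope of $\mathcal R$ is a pair $(\mathcal I,\iota_{\rm ie})$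 with $\mathcal I$ an injective operator system and $\iota_{\rm ie}:\mathcal R\to\mathcal I$ a unital complete order embedding such that if $\iota_{\rm ie}(\mathcal R)\subseteq\mathcal Q\subseteq\mathcal I$ as operator subsystems with $\mathcal Q$ injective, then $\mathcal Q=\mathcal I$; it exists and is unique up to unital complete order isomorphism compatible with the embeddings (Hamana), and is denoted $\mathrm I(\mathcal R)$. A C$^*$-envelope of $\mathcal R$ is a pair $(\mathcal A,\iota_e)$ with $\mathcal A$ a unital C$^*$-algebra and $\iota_e:\mathcal R\to\mathcal A$ a unital complete order embedding whose range generates $\mathcal A$ as a C$^*$-algebra, such that for every unital complete order embedding $\kappa:\mathcal R\to\mathcal B$ into a unital C$^*$-algebra $\mathcal B$ generated by $\kappa(\mathcal R)$ there is a unital $*$-homomorphism $\pi:\mathcal B\to\mathcal A$ with $\pi\circ\kappa=\iota_e$; it exists and is unique up to compatible $*$-isomorphism (Hamana), and is denoted $\mathrm C^*_{\rm e}(\mathcal R)$. *)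

(* Defs.v *)
From HB Require Import structures.
From mathcomp Require Import all_boot all_order all_algebra.
From mathcomp Require Import complex.
From mathcomp Require Import all_classical all_reals.

Set Implicit Arguments.
Unset Strict Implicit.
Unset Printing Implicit Defensive.

Import Order.TTheory GRing.Theory Num.Theory.

Local Open Scope classical_set_scope.
Local Open Scope complex_scope.
Local Open Scope ring_scope.

(* [compress a X] is a^* X a, for a scalar matrix a and a matrix X over V. *)
Definition compress (R : realType) (V : lmodType R[i]) (n m : nat)
    (a : 'M[R[i]]_(n, m)) (X : 'M[V]_n) : 'M[V]_m :=
  \matrix_(i, j) \sum_(k < n) \sum_(l < n) ((a k i)^*%C * a l j) *: X k l.

(* Matrix-ordered *-vector spaces with an Archimedean matrix order unit.
   Closure of each cone under scaling by r >= 0 is the case a = sqrt(r) 1 of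
   [mxpos_compress]. *)
HB.mixin Record isOperatorSystem (R : realType) V of GRing.Lmodule R[i] V := {
  adj : V -> V;
  mxpos : forall n, 'M[V]_n -> Prop;
  ounit : V;
  adjD : forall x y, adj (x + y) = adj x + adj y;
  adjZ : forall (c : R[i]) x, adj (c *: x) = c^*%C *: adj x;
  adjK : forall x, adj (adj x) = x;
  mxpos_adj : forall n (X : 'M[V]_n), mxpos n X -> (map_mx adj X)^T = X;
  mxpos0 : forall n, mxpos n (0 : 'M[V]_n);
  mxposD : forall n (X Y : 'M[V]_n), mxpos n X -> mxpos n Y -> mxpos n (X + Y);
  mxpos_proper : forall n (X : 'M[V]_n), mxpos n X -> mxpos n (- X) -> X = 0;
  mxpos_compress : forall n m (a : 'M[R[i]]_(n, m)) (X : 'M[V]_n),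
    mxpos n X -> mxpos m (compress a X);
  ounit_adj : adj ounit = ounit;
  ounit_order : forall n (X : 'M[V]_n), (map_mx adj X)^T = X ->
    exists2 r : R, 0 < r & mxpos n ((r%:C *: ounit)%:M + X);
  ounit_archimedean : forall n (X : 'M[V]_n), (map_mx adj X)^T = X ->
    (forall r : R, 0 < r -> mxpos n ((r%:C *: ounit)%:M + X)) -> mxpos n X
}.

#[short(type="opSystemType")]
HB.structure Definition OperatorSystem (R : realType) :=
  {V of isOperatorSystem R V & GRing.Lmodule R[i] V}.

Arguments mxpos {R s n} X.
Arguments ounit {R s}.

(* Unital C*-algebras. The real-valued norm is a field of the mixin, because the
   library hierarchy has no join of rings with normed modules. *)
HB.mixin Record isCStarAlgebra (R : realType) A of GRing.Algebra R[i] A := {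
  star : A -> A;
  cnorm : A -> R;
  starD : forall x y, star (x + y) = star x + star y;
  starZ : forall (c : R[i]) x, star (c *: x) = c^*%C *: star x;
  starM : forall x y, star (x * y) = star y * star x;
  starK : forall x, star (star x) = x;
  cnorm0_eq0 : forall x, cnorm x = 0 -> x = 0;
  cnormD : forall x y, cnorm (x + y) <= cnorm x + cnorm y;
  cnormZ : forall (c : R[i]) x, (cnorm (c *: x))%:C = `|c| * (cnorm x)%:C;
  cnormM : forall x y, cnorm (x * y) <= cnorm x * cnorm y;
  cnorm_complete : forall u : nat -> A,
    (forall e : R, 0 < e -> exists N, forall m n, (N <= m)%N -> (N <= n)%N ->
      cnorm (u m - u n) < e) ->
    exists x, forall e : R, 0 < e -> exists N, forall n, (N <= n)%N ->
      cnorm (u n - x) < e;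
  cnorm_cstar : forall x, cnorm (star x * x) = cnorm x ^+ 2
}.

#[short(type="cstarAlgType")]
HB.structure Definition CStarAlgebra (R : realType) :=
  {A of isCStarAlgebra R A & GRing.Algebra R[i] A}.

(* Positive elements of the C*-algebra M_n(A). *)
Definition cstar_mxpos (R : realType) (A : cstarAlgType R) (n : nat)
    (X : 'M[A]_n) : Prop :=
  exists Y : 'M[A]_n, X = (map_mx star Y)^T *m Y.

(* The matrix cones are parameters below, so that the same notions apply to
   operator systems ([mxpos]) and to C*-algebras ([cstar_mxpos]). *)
Definition mxcones (V : Type) := forall n : nat, 'M[V]_n -> Prop.

Section Maps.
Context {R : realType} {V W : lmodType R[i]}.
Variables (PV : mxcones V) (PW : mxcones W).

Definition completely_positive (f : {linear V -> W}) : Prop :=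
  forall n (X : 'M[V]_n), PV X -> PW (map_mx f X).

Definition complete_order_embedding (f : {linear V -> W}) : Prop :=
  [/\ injective f, completely_positive f &
      forall n (X : 'M[V]_n), PW (map_mx f X) -> PV X].

Definition pure (f : {linear V -> W}) : Prop :=
  completely_positive f /\
  forall g h : {linear V -> W},
    completely_positive g -> completely_positive h ->
    (forall x, g x + h x = f x) ->
    exists s : R, [/\ 0 <= s <= 1,
      forall x, g x = s%:C *: f x & forall x, h x = (1 - s)%:C *: f x].

End Maps.

Section OperatorSystems.
Context {R : realType}.

Definition os_cp (S T : opSystemType R) (f : {linear S -> T}) : Prop :=
  completely_positive (@mxpos R S) (@mxpos R T) f.

Definition os_pure (S T : opSystemType R) (f : {linear S -> T}) : Prop :=
  pure (@mxpos R S) (@mxpos R T) f.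

(* Operator subsystems of T are, up to unital complete order isomorphism, the
   ranges of such maps into T. *)
Definition os_embedding (S T : opSystemType R) (f : {linear S -> T}) : Prop :=
  complete_order_embedding (@mxpos R S) (@mxpos R T) f /\ f ounit = ounit.

Definition cstar_embedding (S : opSystemType R) (A : cstarAlgType R)
    (f : {linear S -> A}) : Prop :=
  complete_order_embedding (@mxpos R S) (@cstar_mxpos R A) f /\ f ounit = 1.

Definition injective_os (I : opSystemType R) : Prop :=
  forall (S T : opSystemType R) (j : {linear S -> T}), os_embedding j ->
  forall f : {linear S -> I}, os_cp f ->
  exists2 g : {linear T -> I}, os_cp g & forall x, g (j x) = f x.

Definition injective_envelope (S I : opSystemType R)
    (iota : {linear S -> I}) : Prop :=
  [/\ injective_os I, os_embedding iota &
      forall (Q : opSystemType R) (j : {linear Q -> I}),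
        os_embedding j -> range iota `<=` range j -> injective_os Q ->
        range j = setT].

Definition norm_closed (A : cstarAlgType R) (B : set A) : Prop :=
  forall x, (forall e : R, 0 < e -> exists2 y, B y & cnorm (x - y) < e) -> B x.

Definition closed_star_subalgebra (A : cstarAlgType R) (B : set A) : Prop :=
  [/\ norm_closed B, B 1,
      forall (c : R[i]) x y, B x -> B y -> B (c *: x + y),
      forall x y, B x -> B y -> B (x * y) &
      forall x, B x -> B (star x)].

Definition cstar_generates (A : cstarAlgType R) (G : set A) : Prop :=
  forall B : set A, closed_star_subalgebra B -> G `<=` B -> B = setT.

(* Morphisms in {lrmorphism B -> A} are unital. *)
Definition cstar_envelope (S : opSystemType R) (A : cstarAlgType R)
    (iota : {linear S -> A}) : Prop :=
  [/\ cstar_embedding iota, cstar_generates (range iota) &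
      forall (B : cstarAlgType R) (kappa : {linear S -> B}),
        cstar_embedding kappa -> cstar_generates (range kappa) ->
        exists2 pi : {lrmorphism B -> A},
          forall b, pi (star b) = star (pi b) &
          forall x, pi (kappa x) = iota x].

Definition closed_ideal (A : cstarAlgType R) (J : set A) : Prop :=
  [/\ norm_closed J, J 0,
      forall x y, J x -> J y -> J (x + y),
      forall a x, J x -> J (a * x) & forall a x, J x -> J (x * a)].

Definition prime_cstar (A : cstarAlgType R) : Prop :=
  forall J K : set A, closed_ideal J -> closed_ideal K ->
    (forall x y, J x -> K y -> x * y = 0) -> J = [set 0] \/ K = [set 0].

End OperatorSystems.

(* Main.v *)
(* The injective envelope I of S is a C*-algebra E by the Choi-Effros theorem, and
   A = C*_e(S) is a C*-subalgebra of E.  Moreover I is essential over S: a matrix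
   ordering of I which is coarser than the given one but induces the given ordering
   of S is the given one.  In particular a completely positive map I -> I fixing S
   is the identity.

   Let J be a closed ideal of A and L its annihilator.  As J + L is essential in A,
   the map x |-> (x, x) embeds S into A/Ann(J) + A/Ann(L).  Extend iota along this
   embedding; the two summands split iota into two completely positive maps, which
   extend to maps on A killing L and J respectively.  If iota is pure, one of the
   two extensions is a multiple of the inclusion of A in E, so that J or L is 0.

   Conversely a decomposition of iota extends to a decomposition G + H = id of I, and
   this forces G to be multiplication by a central c of E with 0 <= c <= 1.  If c is
   not a scalar, functional calculus yields central positive f1, f2 with invertible
   sum and nonzero central positive g1, g2 with f1 g1 = f2 g2 = 0.  The annihilators
   of f1 and f2 in A are ideals with product 0; if A is prime then one of them, say
   that of f1, vanishes.  Hence comparing f1 x with f1 y instead of x with y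
   does not change the ordering of S, so by essentiality it does not change that of
   I, which contradicts f1 g1 = 0. *)

Require Import Defs.
From HB Require Import structures.
From mathcomp Require Import all_boot all_order all_algebra.
From mathcomp Require Import complex lra ring.
From mathcomp Require Import all_classical all_reals.
From Stdlib Require Ncring Ncring_tac.

Set Implicit Arguments.
Unset Strict Implicit.
Unset Printing Implicit Defensive.

Import Order.TTheory GRing.Theory Num.Theory.

Local Open Scope classical_set_scope.
Local Open Scope complex_scope.
Local Open Scope ring_scope.

(** * Positive elements of a C*-algebra *)

(** No spectral theory is invoked. Square roots come from a norm-convergent iteration, and the
    functional calculus of the converse reduces to the positive and negative parts of [c - s] and
    [t - c] for two reals s < t. Several positivity proofs share one shape: a selfadjoint x comes
    with y and v such that [y x y = - v^2], and x is positive as soon as v is shown to vanish.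

    The quotient A/Ann(J) is not formed as an algebra. It acts faithfully on J, so a matrix counts
    as positive there when its form is positive on vectors with entries in J. The resulting cone on
    A need not be proper, which is why operator systems arise as quotients of preorders.

    The obstacle in essentiality is to turn a coarser ordering into a subsystem of I. Only for a
    maximal ordering is the map back to I a section of the quotient map, so that the quotient is
    injective and minimality of I applies.

    The inclusion of A in E is not given either: the universal property yields a map in the other
    direction, from the subalgebra generated by S in E to A, and rigidity makes it an isometry onto
    A. *)

#[global] Instance pz_ring_ops (A : pzRingType) :
  @Ncring.Ring_ops A 0 1 +%R *%R (fun x y : A => x - y) -%R eq := {}.
#[global] Instance pz_ring (A : pzRingType) :
  @Ncring.Ring A _ _ _ _ _ _ _ (pz_ring_ops A).
Proof.
split => //=.
- exact: RelationClasses.eq_equivalence.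
- by move=> ? ? -> ? ? ->.
- by move=> ? ? -> ? ? ->.
- by move=> ? ? -> ? ? ->.
- by move=> ? ? ->.
- exact: add0r.
- exact: addrC.
- exact: addrA.
- exact: mul1r.
- exact: mulr1.
- exact: mulrA.
- exact: mulrDl.
- by move=> *; exact: mulrDr.
- exact: subrr.
Qed.

Ltac ncring := Ncring_tac.non_commutative_ring.

Section RealScalars.
Context {R : realType}.
Implicit Types (r t : R) (c : R[i]).

Lemma conjC_real r : (r%:C)^*%C = r%:C.
Proof. by rewrite /= oppr0. Qed.

Lemma normc_real r : `|r%:C| = `|r|%:C :> R[i].
Proof. by rewrite normc_def /= expr0n addr0 sqrtr_sqr. Qed.

Lemma realCD r t : (r + t)%:C = r%:C + t%:C. Proof. exact: rmorphD. Qed.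
Lemma realCM r t : (r * t)%:C = r%:C * t%:C. Proof. exact: rmorphM. Qed.
Lemma realCN r : (- r)%:C = - r%:C. Proof. exact: rmorphN. Qed.
Lemma realCB r t : (r - t)%:C = r%:C - t%:C. Proof. exact: rmorphB. Qed.
Lemma realCV r : (r^-1)%:C = (r%:C)^-1. Proof. exact: fmorphV. Qed.
Lemma realC_inj r t : r%:C = t%:C -> r = t. Proof. by case. Qed.
Lemma realC_neq0 r : (r%:C != 0) = (r != 0).
Proof. by rewrite eq_complex /= eqxx andbT. Qed.

Section LmoduleScalars.
Variable V : lmodType R[i].

Lemma realZ_inj r (x y : V) : r != 0 -> r%:C *: x = r%:C *: y -> x = y.
Proof. by move=> r0; apply: scalerI; rewrite realC_neq0. Qed.

Lemma addxx_inj (x y : V) : x + x = y + y -> x = y.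
Proof.
move=> h; apply: (@realZ_inj (1 + 1)); first by rewrite lt0r_neq0 ?addr_gt0.
by rewrite !realCD !scalerDl !scale1r.
Qed.

Lemma realZVK r (x : V) : r != 0 -> r%:C *: (r^-1%:C *: x) = x.
Proof. by move=> r0; rewrite scalerA -realCM divff // scale1r. Qed.

Lemma realZKV r (x : V) : r != 0 -> r^-1%:C *: (r%:C *: x) = x.
Proof. by move=> r0; rewrite scalerA -realCM mulVf // scale1r. Qed.
Lemma halfZ_double (x : V) : (2^-1)%:C *: (x + x) = x.
Proof.
have -> : x + x = (2 : R)%:C *: x.
  by rewrite -[in LHS](scale1r x) -scalerDl -(rmorphD (real_complex R)).
by rewrite realZKV // pnatr_eq0.
Qed.
End LmoduleScalars.
End RealScalars.

Section CStarBasics.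
Context {R : realType} {A : cstarAlgType R}.
Implicit Types (x y a b c : A) (r t : R).

Lemma star0 : star 0 = 0 :> A.
Proof. by have := starZ 0 (0 : A); rewrite !scale0r rmorph0 scale0r. Qed.

Lemma starN x : star (- x) = - star x.
Proof. by rewrite -scaleN1r starZ rmorphN rmorph1 scaleN1r. Qed.

Lemma starB x y : star (x - y) = star x - star y.
Proof. by rewrite starD starN. Qed.

Lemma star1 : star 1 = 1 :> A.
Proof. by rewrite -[LHS]mulr1 -[X in _ * X]starK -starM mulr1 starK. Qed.

Lemma star_sum (J : Type) (s : seq J) (P : pred J) (F : J -> A) :
  star (\sum_(j <- s | P j) F j) = \sum_(j <- s | P j) star (F j).
Proof. by apply: (big_morph star _ star0) => x y; rewrite starD. Qed.

Lemma starZr r x : star (r%:C *: x) = r%:C *: star x.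
Proof. by rewrite starZ conjC_real. Qed.

Lemma cnormZr r x : cnorm (r%:C *: x) = `|r| * cnorm x.
Proof. by apply: realC_inj; rewrite cnormZ normc_real -realCM. Qed.

Lemma cnorm0 : cnorm (0 : A) = 0.
Proof. by rewrite -(scale0r (0 : A)) (cnormZr 0) normr0 mul0r. Qed.

Lemma cnormN x : cnorm (- x) = cnorm x.
Proof. by rewrite -scaleN1r -(rmorphN1 (real_complex R)) cnormZr normrN1 mul1r. Qed.

Lemma cnorm_ge0 x : 0 <= cnorm x.
Proof.
have := cnormD x (- x); rewrite subrr cnorm0 cnormN => h.
by lra.
Qed.

Lemma cnormB x y : cnorm (x - y) <= cnorm x + cnorm y.
Proof. by rewrite (le_trans (cnormD _ _)) ?cnormN. Qed.

Lemma cnormBC x y : cnorm (x - y) = cnorm (y - x).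
Proof. by rewrite -cnormN opprB. Qed.

Lemma cnorm_triangle z x y : cnorm (x - y) <= cnorm (x - z) + cnorm (z - y).
Proof. by rewrite (le_trans _ (cnormD _ _)) // addrA subrK. Qed.

Lemma cnorm_star x : cnorm (star x) = cnorm x.
Proof.
have aux y : cnorm y <= cnorm (star y).
  have [y0|y0] := eqVneq (cnorm y) 0; first by rewrite y0 cnorm_ge0.
  have yp : 0 < cnorm y by rewrite lt_neqAle eq_sym y0 cnorm_ge0.
  by rewrite -(ler_pM2r yp) -expr2 -cnorm_cstar cnormM.
by apply/eqP; rewrite eq_le -{2}(starK x) !aux.
Qed.

Lemma cnorm1 : cnorm (1 : A) = 1.
Proof.
have h := cnorm_cstar (1 : A); rewrite star1 mulr1 expr2 in h.
have n0 : cnorm (1 : A) != 0.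
  by apply/eqP => /cnorm0_eq0/eqP; rewrite oner_eq0.
by apply: (mulfI n0); rewrite -h mulr1.
Qed.

Lemma cnorm_sqr a : star a = a -> cnorm (a * a) = cnorm a ^+ 2.
Proof. by move=> sa; rewrite -{1}sa cnorm_cstar. Qed.

Lemma star_mul_eq0 a : star a * a = 0 -> a = 0.
Proof.
move=> h; apply: cnorm0_eq0; apply/eqP.
by rewrite -sqrf_eq0 -cnorm_cstar h cnorm0.
Qed.

Lemma sqr_eq0 a : star a = a -> a * a = 0 -> a = 0.
Proof. by move=> sa h; apply: star_mul_eq0; rewrite sa. Qed.

Lemma cube_eq0 a : star a = a -> a * a * a = 0 -> a = 0.
Proof.
move=> sa h; apply: sqr_eq0 => //; apply: sqr_eq0; first by rewrite starM sa.
by rewrite !mulrA h mul0r.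
Qed.

Definition rscal t : A := t%:C *: 1.

Lemma rscalE t x : rscal t * x = t%:C *: x.
Proof. by rewrite -scalerAl mul1r. Qed.

Lemma rscalC t x : x * rscal t = rscal t * x.
Proof. by rewrite rscalE -scalerAr mulr1. Qed.

Lemma rscalD t r : rscal (t + r) = rscal t + rscal r.
Proof. by rewrite /rscal realCD scalerDl. Qed.

Lemma rscalN t : rscal (- t) = - rscal t.
Proof. by rewrite /rscal realCN scaleNr. Qed.

Lemma rscalM t r : rscal (t * r) = rscal t * rscal r.
Proof. by rewrite rscalE /rscal scalerA -realCM. Qed.

Lemma rscal0 : rscal 0 = 0. Proof. exact: scale0r. Qed.
Lemma rscal1 : rscal 1 = 1. Proof. exact: scale1r. Qed.

Lemma star_rscal t : star (rscal t) = rscal t.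
Proof. by rewrite starZr star1. Qed.

Lemma cnorm_rscal t : cnorm (rscal t) = `|t|.
Proof. by rewrite cnormZr cnorm1 mulr1. Qed.

Definition converges (u : nat -> A) x :=
  forall e : R, 0 < e -> exists N, forall n, (N <= n)%N -> cnorm (u n - x) < e.

Lemma cvg_const x : converges (fun=> x) x.
Proof. by move=> e e0; exists 0 => n _; rewrite subrr cnorm0. Qed.

Lemma cvg_close u x : converges u x -> forall e : R, 0 < e ->
  exists n, cnorm (u n - x) < e.
Proof. by move=> h e /h [N /(_ N (leqnn N))]; exists N. Qed.

Lemma cnorm_lt_eq0 x : (forall e : R, 0 < e -> cnorm x < e) -> x = 0.
Proof.
move=> h; apply: cnorm0_eq0; apply/eqP; rewrite eq_le cnorm_ge0 andbT.
by apply/ler_addgt0Pl => e /h /ltW; rewrite addr0.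
Qed.

Lemma cvg_unique u x y : converges u x -> converges u y -> x = y.
Proof.
move=> hx hy; apply/eqP; rewrite -subr_eq0; apply/eqP.
apply: cnorm_lt_eq0 => e e0; have e2 : 0 < e / 2 by rewrite divr_gt0.
have [N hN] := hx _ e2; have [M hM] := hy _ e2.
rewrite (le_lt_trans (cnorm_triangle (u (maxn N M)) _ _)) // cnormBC [ltRHS]splitr.
by rewrite ltrD // ?hN ?hM // ?leq_maxl ?leq_maxr.
Qed.

Lemma cvg_lip (f : A -> A) (K : R) u x : 0 <= K ->
  (forall a b, cnorm (f a - f b) <= K * cnorm (a - b)) ->
  converges u x -> converges (fun n => f (u n)) (f x).
Proof.
move=> K0 hf hu e e0.
have K1 : 0 < K + 1 by rewrite ltr_wpDl.
have [N hN] := hu (e / (K + 1)) (divr_gt0 e0 K1).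
exists N => n /hN; rewrite ltr_pdivlMr // mulrC => h.
rewrite (le_lt_trans (hf _ _)) // (le_lt_trans _ h) //.
by rewrite ler_wpM2r ?cnorm_ge0 // lerDl.
Qed.

Lemma cvgD u v x y : converges u x -> converges v y ->
  converges (fun n => u n + v n) (x + y).
Proof.
move=> hx hy e e0; have e2 : 0 < e / 2 by rewrite divr_gt0.
have [N hN] := hx _ e2; have [M hM] := hy _ e2.
exists (maxn N M) => n; rewrite geq_max => /andP[/hN h1 /hM h2].
rewrite opprD addrACA (le_lt_trans (cnormD _ _)) // [ltRHS]splitr.
by rewrite ltrD.
Qed.

Lemma cvgMl c u x : converges u x -> converges (fun n => c * u n) (c * x).
Proof.
apply: (@cvg_lip ( *%R c) (cnorm c)) => [|a b]; first exact: cnorm_ge0.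
by rewrite -mulrBr cnormM.
Qed.

Lemma cvgMr c u x : converges u x -> converges (fun n => u n * c) (x * c).
Proof.
apply: (@cvg_lip ( *%R^~ c) (cnorm c)) => [|a b]; first exact: cnorm_ge0.
by rewrite -mulrBl mulrC cnormM.
Qed.

Lemma cvgZ r u x : converges u x -> converges (fun n => r%:C *: u n) (r%:C *: x).
Proof.
apply: (@cvg_lip ( *:%R r%:C) `|r|) => [|a b] //.
by rewrite -scalerBr cnormZr.
Qed.

Lemma cvg_star u x : converges u x -> converges (fun n => star (u n)) (star x).
Proof.
apply: (@cvg_lip star 1) => // a b.
by rewrite -starB cnorm_star mul1r.
Qed.

Lemma cvg_norm_le u x t : converges u x -> (forall n, cnorm (u n) <= t) ->
  cnorm x <= t.
Proof.
move=> hu ht; apply/ler_addgt0Pr => e /(cvg_close hu) [n hn].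
rewrite -[x](subKr (u n)) (le_trans (cnormB _ _)) //.
by rewrite lerD // ltW.
Qed.

Lemma cvg_ext u v x : (forall n, u n = v n) -> converges u x -> converges v x.
Proof. by move=> uv h e /h [N hN]; exists N => n /hN; rewrite uv. Qed.

Lemma cvg_shift u x : converges u x -> converges (fun n => u n.+1) x.
Proof. by move=> h e /h [N hN]; exists N => n Nn; apply: hN; apply: leqW. Qed.

Lemma cvg_sqr u x : (forall n, cnorm (u n) <= 1) -> converges u x ->
  converges (fun n => u n * u n) (x * x).
Proof.
move=> u1 hu e e0; have x1 := cvg_norm_le hu u1.
have [|N hN] := hu (e / 2); first by rewrite divr_gt0.
exists N => n /hN h.
have -> : u n * u n - x * x = u n * (u n - x) + (u n - x) * x by ncring.
rewrite (le_lt_trans (cnormD _ _)) // [ltRHS]splitr.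
rewrite ltrD // (le_lt_trans (cnormM _ _)) //; apply: le_lt_trans h.
  by rewrite ler_piMl ?cnorm_ge0.
by rewrite ler_piMr ?cnorm_ge0.
Qed.

(* Converges to [1 - sqrt (1 - b)] when [cnorm b <= 1]; its increments are dominated
   by those of the scalar case [b = 1]. *)
Fixpoint sqrt_seq b n : A :=
  if n is k.+1 then (2^-1)%:C *: (b + sqrt_seq b k * sqrt_seq b k) else 0.

Fixpoint sqrt_seqR n : R :=
  if n is k.+1 then 2^-1 * (1 + sqrt_seqR k * sqrt_seqR k) else 0.

Lemma sqrt_seqR_bounds n : 0 <= sqrt_seqR n <= 1.
Proof. by elim: n => [|n /andP[h0 h1]] /=; [rewrite lexx ler01 | nra]. Qed.

(** Choose [N] with its term within [e] of the supremum of the sequence; no term exceeds that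
    supremum. *)
Lemma sqrt_seqR_cauchy (e : R) : 0 < e ->
  exists N, forall n, (N <= n)%N -> sqrt_seqR n - sqrt_seqR N < e.
Proof.
move=> e0; have hs : has_sup (range sqrt_seqR).
  split; first by exists (sqrt_seqR 0), 0.
  by exists 1 => _ [n _ <-]; case/andP: (sqrt_seqR_bounds n).
have [_ [N _ <-] hN] := sup_adherent e0 hs; exists N => n _.
rewrite ltrBlDr -ltrBlDl (le_lt_trans _ hN) //.
by rewrite lerD2r; apply: sup_upper_bound => //; exists n.
Qed.

Lemma double_half x : (2^-1)%:C *: x + (2^-1)%:C *: x = x.
Proof. by rewrite -scalerDr halfZ_double. Qed.

Lemma sqrt_seq_norm b n : cnorm b <= 1 -> cnorm (sqrt_seq b n) <= sqrt_seqR n.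
Proof.
move=> b1; elim: n => [|n ih] /=; first by rewrite cnorm0.
rewrite cnormZr ger0_norm ?invr_ge0 // ler_pM2l ?invr_gt0 //.
rewrite (le_trans (cnormD _ _)) // lerD // (le_trans (cnormM _ _)) //.
by rewrite ler_pM ?cnorm_ge0.
Qed.

(** Consecutive increments satisfy [2 (z - y) = (y - x) y + x (y - x)], in the algebra as well as
    for scalars, so the bound passes from factors to increments by induction. *)
Lemma sqrt_seq_step b n : cnorm b <= 1 ->
  cnorm (sqrt_seq b n.+1 - sqrt_seq b n) <= sqrt_seqR n.+1 - sqrt_seqR n.
Proof.
move=> b1; elim: n => [|n ih].
  rewrite /= !mul0r !addr0 !subr0 mulr1 cnormZr ger0_norm ?invr_ge0 //.
  by rewrite ler_piMr ?invr_ge0.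
have hb k := sqrt_seq_norm k b1; have /andP[u0 _] := sqrt_seqR_bounds n.
have /andP[v0 _] := sqrt_seqR_bounds n.+1.
set y := sqrt_seq b n.+1 in ih *; set x := sqrt_seq b n in ih *.
set v := sqrt_seqR n.+1 in ih v0 *; set u := sqrt_seqR n in ih u0 *.
have -> : sqrt_seqR n.+2 - v = 2^-1 * ((v - u) * v + u * (v - u)).
  by rewrite /v /u /=; ring.
have -> : sqrt_seq b n.+2 - y = (2^-1)%:C *: ((y - x) * y + x * (y - x)).
  have E1 : sqrt_seq b n.+2 = (2^-1)%:C *: (b + y * y) by [].
  have E2 : y = (2^-1)%:C *: (b + x * x) by [].
  rewrite E1 [X in _ - X]E2 -scalerBr.
  by congr (_ *: _); ncring.
rewrite cnormZr ger0_norm ?invr_ge0 // ler_pM2l ?invr_gt0 //.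
rewrite (le_trans (cnormD _ _)) // lerD // (le_trans (cnormM _ _)) //.
  by rewrite ler_pM ?cnorm_ge0 // hb.
by rewrite ler_pM ?cnorm_ge0 // hb.
Qed.

Lemma sqrt_seq_dist b n k : cnorm b <= 1 ->
  cnorm (sqrt_seq b (n + k) - sqrt_seq b n) <= sqrt_seqR (n + k) - sqrt_seqR n.
Proof.
move=> b1; elim: k => [|k ih]; first by rewrite addn0 !subrr cnorm0.
rewrite addnS (le_trans (cnorm_triangle (sqrt_seq b (n + k)) _ _)) //.
have := sqrt_seq_step (n + k) b1; lra.
Qed.

(** The default 0 is used only where the sequence diverges; it converges whenever [cnorm b <= 1]. *)
Definition sqrt_lim b : A := xget 0 [set y | converges (sqrt_seq b) y].

Lemma sqrt_limP b : cnorm b <= 1 -> converges (sqrt_seq b) (sqrt_lim b).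
Proof.
move=> b1; suff [y hy] : exists y, converges (sqrt_seq b) y.
  by rewrite /sqrt_lim; case: xgetP => // /(_ y).
apply: cnorm_complete => e e0; have [|N hN] := @sqrt_seqR_cauchy (e / 2).
  by rewrite divr_gt0.
exists N => m n Nm Nn; rewrite (le_lt_trans (cnorm_triangle (sqrt_seq b N) _ _)) //.
have := sqrt_seq_dist N (m - N) b1; have := sqrt_seq_dist N (n - N) b1.
rewrite !subnKC // [X in X <= _ -> _]cnormBC.
by have := hN _ Nm; have := hN _ Nn; lra.
Qed.

Lemma sqrt_limE b : cnorm b <= 1 ->
  sqrt_lim b + sqrt_lim b = b + sqrt_lim b * sqrt_lim b.
Proof.
move=> b1; have h := sqrt_limP b1.
have n1 n : cnorm (sqrt_seq b n) <= 1.
  by rewrite (le_trans (sqrt_seq_norm n b1)) //; case/andP: (sqrt_seqR_bounds n).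
have e : sqrt_lim b = (2^-1)%:C *: (b + sqrt_lim b * sqrt_lim b).
  apply: (cvg_unique (cvg_shift h)); apply: cvgZ.
  by apply: cvgD; [exact: cvg_const | exact: cvg_sqr].
by rewrite {1 2}e double_half.
Qed.

Lemma sqrt_lim_norm b : cnorm b <= 1 -> cnorm (sqrt_lim b) <= 1.
Proof.
move=> b1; apply: (cvg_norm_le (sqrt_limP b1)) => n.
by rewrite (le_trans (sqrt_seq_norm n b1)) //; case/andP: (sqrt_seqR_bounds n).
Qed.

(** Two different elements are allowed, beyond mere commutation, because [star_mul_neg] compares the
    roots of [p^2] and [q^2] through a [c] with [c p^2 = q^2 c]. *)
Lemma sqrt_lim_intertwine b b' c : cnorm b <= 1 -> cnorm b' <= 1 ->
  c * b = b' * c -> c * sqrt_lim b = sqrt_lim b' * c.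
Proof.
move=> b1 b1' h; have hn n : c * sqrt_seq b n = sqrt_seq b' n * c.
  elim: n => [|n ih]; rewrite /= ?mulr0 ?mul0r //.
  rewrite -scalerAr -scalerAl; congr (_ *: _).
  by rewrite mulrDr mulrDl h mulrA ih -!mulrA ih.
apply: (cvg_unique (cvgMl c (sqrt_limP b1))).
by apply: cvg_ext (cvgMr c (sqrt_limP b1')) => n; rewrite hn.
Qed.

Lemma sqrt_lim_star b : cnorm b <= 1 -> star b = b ->
  star (sqrt_lim b) = sqrt_lim b.
Proof.
move=> b1 sb; apply: (cvg_unique (cvg_star (sqrt_limP b1))).
apply: cvg_ext (sqrt_limP b1) => n.
by elim: n => [|n ih] /=; rewrite ?star0 // starZr starD starM -ih sb.
Qed.

(* The square root of [a], for any [t > 0] with [cnorm (rscal t - a) <= t]. *)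
Definition csqrt t a : A :=
  (Num.sqrt t)%:C *: (1 - sqrt_lim (1 - t^-1%:C *: a)).

Lemma csqrt_arg t a : 0 < t -> cnorm (rscal t - a) <= t ->
  cnorm (1 - t^-1%:C *: a) <= 1.
Proof.
move=> t0 h; have -> : 1 - t^-1%:C *: a = t^-1%:C *: (rscal t - a).
  by rewrite scalerBr /rscal realZKV ?lt0r_neq0.
by rewrite cnormZr gtr0_norm ?invr_gt0 // ler_pdivrMl // mulr1.
Qed.

Lemma csqrt_sqr t a : 0 < t -> cnorm (rscal t - a) <= t ->
  csqrt t a * csqrt t a = a.
Proof.
move=> t0 /(csqrt_arg t0) h; rewrite /csqrt -scalerAl -scalerAr scalerA -realCM.
rewrite -expr2 sqr_sqrtr ?ltW //; set y := sqrt_lim _.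
have -> : (1 - y) * (1 - y) = 1 - (y + y) + y * y by ncring.
rewrite /y sqrt_limE // -/y [X in _ *: X](_ : _ = t^-1%:C *: a); last by ncring.
by rewrite realZVK ?lt0r_neq0.
Qed.

Lemma csqrt_intertwine t a b c : 0 < t -> cnorm (rscal t - a) <= t ->
  cnorm (rscal t - b) <= t -> c * a = b * c -> c * csqrt t a = csqrt t b * c.
Proof.
move=> t0 /(csqrt_arg t0) ha /(csqrt_arg t0) hb h.
rewrite /csqrt -scalerAr -scalerAl; congr (_ *: _).
rewrite mulrBr mulrBl mulr1 mul1r (sqrt_lim_intertwine ha hb) //.
by rewrite mulrBr mulrBl mulr1 mul1r -scalerAr -scalerAl h.
Qed.

Lemma csqrt_star t a : 0 < t -> cnorm (rscal t - a) <= t -> star a = a ->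
  star (csqrt t a) = csqrt t a.
Proof.
move=> t0 /(csqrt_arg t0) h sa; rewrite /csqrt starZr starB star1.
by rewrite sqrt_lim_star // starB star1 starZr sa.
Qed.

Lemma csqrt_norm t a : 0 < t -> cnorm (rscal t - a) <= t ->
  cnorm (rscal (Num.sqrt t) - csqrt t a) <= Num.sqrt t.
Proof.
move=> t0 /(csqrt_arg t0) h; rewrite /csqrt /rscal -scalerBr subKr cnormZr.
rewrite ger0_norm ?sqrtr_ge0 // ler_piMr ?sqrtr_ge0 //.
exact: sqrt_lim_norm.
Qed.

(* A definition of positivity which, unlike [a = star b * b] (see [pos_factor]), is
   visibly stable under addition. *)
Definition pos a := star a = a /\ exists2 t, 0 < t & cnorm (rscal t - a) <= t.

Lemma pos_sa a : pos a -> star a = a. Proof. by case. Qed.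

Lemma pos_bound_le t t' a : t <= t' -> cnorm (rscal t - a) <= t ->
  cnorm (rscal t' - a) <= t'.
Proof.
move=> tt' h; have -> : rscal t' - a = rscal (t' - t) + (rscal t - a).
  by rewrite rscalD rscalN addrA subrK.
rewrite (le_trans (cnormD _ _)) // cnorm_rscal ger0_norm ?subr_ge0 //.
by move: h; lra.
Qed.

(** [csqrt] depends on its parameter [t], and intertwining two roots requires the same [t] for
    both. *)
Lemma pos_bound2 a b : pos a -> pos b -> exists t,
  [/\ 0 < t, cnorm (rscal t - a) <= t & cnorm (rscal t - b) <= t].
Proof.
move=> [_ [t t0 ht]] [_ [r r0 hr]]; exists (t + r).
split; first by rewrite addr_gt0.
  by apply: pos_bound_le ht; rewrite lerDl ltW.
by apply: pos_bound_le hr; rewrite lerDr ltW.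
Qed.

Lemma csqrt_pos t a : 0 < t -> cnorm (rscal t - a) <= t -> star a = a ->
  pos (csqrt t a).
Proof.
move=> t0 h sa; split; first exact: csqrt_star.
by exists (Num.sqrt t); [rewrite sqrtr_gt0 | exact: csqrt_norm].
Qed.

Lemma pos_sqrt a : pos a -> exists s, [/\ star s = s, s * s = a, pos s &
  forall c, c * a = a * c -> c * s = s * c].
Proof.
move=> [sa [t t0 h]]; exists (csqrt t a); split.
- exact: csqrt_star.
- exact: csqrt_sqr.
- exact: csqrt_pos.
- by move=> c; exact: csqrt_intertwine.
Qed.

Lemma pos0 : pos 0.
Proof.
split; first exact: star0.
by exists 1; rewrite ?subr0 ?cnorm_rscal ?normr1.
Qed.

Lemma posD a b : pos a -> pos b -> pos (a + b).
Proof.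
move=> [sa [t t0 h]] [sb [r r0 h']]; split; first by rewrite starD sa sb.
exists (t + r); first by rewrite addr_gt0.
by rewrite rscalD opprD addrACA (le_trans (cnormD _ _)) // lerD.
Qed.

Lemma posZ r a : 0 <= r -> pos a -> pos (r%:C *: a).
Proof.
rewrite le_eqVlt => /predU1P[<- _|r0]; first by rewrite scale0r; exact: pos0.
move=> [sa [t t0 h]]; split; first by rewrite starZr sa.
exists (r * t); first by rewrite mulr_gt0.
by rewrite rscalM rscalE -scalerBr cnormZr gtr0_norm // ler_pM2l.
Qed.

Lemma pos_sum (J : Type) (s : seq J) (P : pred J) (F : J -> A) :
  (forall j, P j -> pos (F j)) -> pos (\sum_(j <- s | P j) F j).
Proof. by move=> h; elim/big_ind: _ => //; [exact: pos0 | exact: posD]. Qed.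

Lemma pos_rscal r : 0 <= r -> pos (rscal r).
Proof.
move=> r0; apply: posZ => //; split; first exact: star1.
by exists 1; rewrite // rscal1 subrr cnorm0.
Qed.

Lemma pos1 : pos 1. Proof. by rewrite -rscal1; exact: pos_rscal. Qed.

Lemma pos_norm_sub a t : star a = a -> cnorm a <= t -> pos (rscal t - a).
Proof.
move=> sa at1; split; first by rewrite starB star_rscal sa.
have h : forall r, t <= r -> cnorm (rscal r - (rscal t - a)) <= r.
  move=> r tr; rewrite opprB addrCA -rscalN -rscalD (le_trans (cnormD _ _)) //.
  by rewrite cnorm_rscal ger0_norm ?subr_ge0 // -lerBrDr opprB addrC subrK.
exists (t + 1); last by apply: h; rewrite lerDl.
by rewrite ltr_wpDl // (le_trans (cnorm_ge0 a)).
Qed.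

Lemma pos_norm_add a t : star a = a -> cnorm a <= t -> pos (rscal t + a).
Proof.
move=> sa at1; rewrite -[a]opprK; apply: pos_norm_sub; first by rewrite starN sa.
by rewrite cnormN.
Qed.

Lemma cnorm_i x : cnorm ('i%C *: x) = cnorm x.
Proof. by apply: realC_inj; rewrite cnormZ normc_def /= expr0n expr1n add0r sqrtr1 mul1r. Qed.

Lemma star_i x : star ('i%C *: x) = - ('i%C *: star x).
Proof. by rewrite starZ -scaleNr; congr (_ *: _); rewrite /= -[RHS]/(_ +i* _) oppr0. Qed.

Lemma iiZ x : 'i%C *: ('i%C *: x) = - x.
Proof. by rewrite scalerA -expr2 sqr_i scaleN1r. Qed.

(** [a] is the real part of [w = a + i b], and commutation gives [w^* w = t], so
    [cnorm a <= cnorm w = sqrt t]. Positivity of [b * b], still unknown at this point, is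
    avoided. *)
Lemma cnorm_sqr_le a b t : star a = a -> star b = b -> a * b = b * a ->
  0 <= t -> a * a + b * b = rscal t -> cnorm (a * a) <= t.
Proof.
move=> sa sb ab t0 h; set w := a + 'i%C *: b.
have sw : star w = a - 'i%C *: b by rewrite starD star_i sa sb.
have nw : cnorm w ^+ 2 = t.
  rewrite -cnorm_cstar sw -[RHS](ger0_norm t0) -cnorm_rscal -h; congr cnorm.
  rewrite mulrDr !mulrBl -!scalerAl -!scalerAr iiZ ab.
  by rewrite opprK addrA subrK.
have aw : cnorm a <= cnorm w.
  have aa : (2 : R)%:C *: a = w + star w.
    by rewrite sw /w addrACA subrr addr0 -mulr2n -scaler_nat rmorph_nat.
  rewrite -(@ler_pM2l _ 2) // -[X in X * _](@ger0_norm R) // -cnormZr aa.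
  rewrite (le_trans (cnormD _ _)) // cnorm_star.
  by rewrite mulrC mulr_natr mulr2n.
by rewrite cnorm_sqr // -nw lerXn2r ?nnegrE ?cnorm_ge0.
Qed.

(** In the unit ball, [1 - b^2] has a root [s] that commutes with [b]; from [s^2 + b^2 = 1] follows
    [cnorm (1 - b^2) <= 1], which is positivity of [b^2] with [t = 1]. *)
Lemma pos_sqr a : star a = a -> pos (a * a).
Proof.
suff unit_ball b : star b = b -> cnorm b <= 1 -> pos (b * b).
  move=> sa; have K0 : 0 < cnorm a + 1 by rewrite ltr_wpDl ?cnorm_ge0.
  set K := cnorm a + 1 in K0; pose b := K^-1%:C *: a.
  have -> : a * a = (K ^+ 2)%:C *: (b * b).
    rewrite /b -scalerAl -scalerAr !scalerA -!realCM.
    rewrite [X in X%:C](_ : _ = 1) ?scale1r //; field.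
    by rewrite lt0r_neq0.
  apply: posZ; first by rewrite sqr_ge0.
  apply: unit_ball; first by rewrite starZr sa.
  rewrite cnormZr gtr0_norm ?invr_gt0 // ler_pdivrMl // mulr1.
  by rewrite /K lerDl.
move=> sb b1; split; first by rewrite starM sb.
exists 1 => //; have h : cnorm (rscal 1 - (1 - b * b)) <= 1.
  by rewrite rscal1 subKr cnorm_sqr // expr_le1 ?cnorm_ge0.
have ss := csqrt_sqr ltr01 h.
rewrite rscal1 -{1}ss; apply: (@cnorm_sqr_le _ b) => //.
- by apply: csqrt_star => //; rewrite starB star1 starM sb.
- by symmetry; apply: csqrt_intertwine => //; rewrite mulrBr mulrBl mulr1 mul1r mulrA.
- by rewrite ss subrK rscal1.
Qed.

(** The roots [u] of [a] and [v] of [t - a] commute and satisfy [u^2 + v^2 = t]. *)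
Lemma pos_norm_le a t : 0 <= t -> pos a -> pos (rscal t - a) -> cnorm a <= t.
Proof.
move=> t0 /pos_sqrt [u [su uu _ cu]] /pos_sqrt [v [sv vv _ cv]].
rewrite -uu; apply: (@cnorm_sqr_le _ v) => //.
- apply: cv; rewrite mulrBr mulrBl rscalC; congr (_ - _).
  by rewrite -uu mulrA.
- by rewrite uu vv addrC subrK.
Qed.

Lemma pos_norm_bound a t : pos a -> cnorm a <= t -> cnorm (rscal t - a) <= t.
Proof.
move=> pa at1; apply: pos_norm_le; first exact: le_trans (cnorm_ge0 a) at1.
  by apply: pos_norm_sub => //; apply: pos_sa.
by rewrite subKr.
Qed.

Lemma pos_proper a : pos a -> pos (- a) -> a = 0.
Proof.
move=> pa pna; apply: cnorm0_eq0; apply/eqP; rewrite eq_le cnorm_ge0 andbT.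
by apply: pos_norm_le => //; rewrite rscal0 sub0r.
Qed.

Lemma pos_add_eq0 a b : pos a -> pos b -> a + b = 0 -> a = 0 /\ b = 0.
Proof.
move=> pa pb /eqP; rewrite addr_eq0 => /eqP h.
have b0 : b = 0 by apply: pos_proper; rewrite // -h.
by rewrite h b0 oppr0.
Qed.

Lemma pos_le_norm a b : pos a -> pos (b - a) -> cnorm a <= cnorm b.
Proof.
move=> pa pba; apply: pos_norm_le => //; first exact: cnorm_ge0.
have -> : rscal (cnorm b) - a = (rscal (cnorm b) - b) + (b - a).
  by rewrite addrA subrK.
apply: posD => //; apply: pos_norm_sub => //.
by rewrite -(subrK a b) starD !pos_sa.
Qed.

(** The witness [cnorm a + 1] does not depend on [r]. Each positive [r + a] has norm at most
    [cnorm a + 1 + r], which gives the required estimate up to an error [r]. *)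
Lemma pos_archimedean a : star a = a -> (forall r, 0 < r -> pos (rscal r + a)) ->
  pos a.
Proof.
move=> sa h; split=> //; exists (cnorm a + 1).
  by rewrite ltr_wpDl ?cnorm_ge0.
apply/ler_addgt0Pr => r r0.
have -> : rscal (cnorm a + 1) - a = rscal (cnorm a + 1 + r) - (rscal r + a).
  by rewrite [in RHS]rscalD opprD addrA addrK.
apply: pos_norm_bound; first exact: h.
rewrite (le_trans (cnormD _ _)) // cnorm_rscal gtr0_norm //.
by rewrite addrC addrAC lerDl.
Qed.

(* With [m] the modulus of [x] and [y = m - x], twice the negative part of [x],
   one has [y (m + x) = 0], whence [y x y = - y m y] and [y ^ 3 = 2 y m y]. *)
Lemma negative_witness x : star x = x -> exists y v,
  [/\ star y = y, star v = v, y * x * y = - (v * v),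
      y * x * y = 0 -> pos x &
      forall c, c * x = x * c -> c * y = y * c /\ c * v = v * c].
Proof.
move=> sx; have [m [sm mm pm cm]] := pos_sqrt (pos_sqr sx).
have [r [sr rr pr cr]] := pos_sqrt pm.
have xm : x * m = m * x by apply: cm; rewrite mulrA.
set y := m - x; have y0 : y * (m + x) = 0.
  by rewrite mulrDr !mulrBl mm xm addrA subrK subrr.
have my : m * y = y * m by rewrite mulrBr mulrBl xm.
have ry : r * y = y * r by symmetry; apply: cr.
have yxE : y * x = - (y * m).
  by apply/eqP; rewrite -addr_eq0 -mulrDr addrC y0.
have yx : y * x * y = - (r * y * (r * y)).
  by rewrite yxE mulNr {1}ry -[in LHS]rr !mulrA.
exists y, (r * y); split => //.
- by rewrite starB sm sx.
- by rewrite starM starB sm sx sr ry.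
- move=> h; have ymy : y * m * y = 0.
    by apply: oppr_inj; rewrite -mulNr -yxE h oppr0.
  suff y00 : y = 0 by rewrite (_ : x = m) //; apply/esym/eqP; rewrite -subr_eq0 -/y y00.
  apply: cube_eq0; first by rewrite starB sm sx.
  by rewrite {2}/y (mulrBr y) mulrBl ymy h subrr.
- move=> c cx; have cm' : c * m = m * c by apply: cm; rewrite mulrA cx -mulrA cx mulrA.
  have cy : c * y = y * c by rewrite mulrBr mulrBl cm' cx.
  by split=> //; rewrite mulrA (cr _ cm') -mulrA cy mulrA.
Qed.

Lemma pos_conj_comm a b : pos a -> star b = b -> a * b = b * a -> pos (b * a * b).
Proof.
move=> pa sb ab; have [s [ss sss _ cs]] := pos_sqrt pa.
have bs : b * s = s * b by apply: cs.
have -> : b * a * b = (s * b) * (s * b).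
  by rewrite -sss -{1}bs !mulrA.
by apply: pos_sqr; rewrite starM ss sb bs.
Qed.

(** With [d = s - p] one has [d (s + p) = 0], so the positive elements [d s d] and [d p d] add up to
    0. Both vanish, and [d^3] is their difference. *)
Lemma pos_sqrt_unique p s : pos p -> pos s -> p * s = s * p -> s * s = p * p ->
  s = p.
Proof.
move=> pp ps ps_c sspp; pose d := s - p.
have sd : star d = d by rewrite starB !pos_sa.
have dsp : d * (s + p) = 0.
  by rewrite mulrDr !mulrBl sspp ps_c addrA subrK subrr.
have [] := @pos_add_eq0 (d * s * d) (d * p * d).
- by apply: pos_conj_comm => //; rewrite mulrBr mulrBl ps_c.
- by apply: pos_conj_comm => //; rewrite mulrBr mulrBl ps_c.
- by rewrite -mulrDl -mulrDr dsp mul0r.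
move=> h1 h2; apply/eqP; rewrite -subr_eq0 -/d; apply/eqP.
by apply: cube_eq0 => //; rewrite {2}/d (mulrBr d) mulrBl h1 h2 subrr.
Qed.

(* If [c^* c = - p] with [p] positive then [q = c c^*] is positive too, and
   [c p = - q c]; uniqueness of square roots turns [c p^2 = q^2 c] into
   [c p = q c]. *)
Lemma star_mul_neg c p : pos p -> star c * c = - p -> c = 0.
Proof.
move=> pp h; have [q qE] : exists q, q = c * star c by eexists.
have sq : star q = q by rewrite qE starM starK.
have sp := pos_sa pp; have pq : pos q.
  rewrite -(halfZ_double q); apply: posZ; first by rewrite invr_ge0.
  pose k := 'i%C *: (c - star c).
  have -> : q + q = (c + star c) * (c + star c) + k * k + (p + p).
    have -> : k * k = - ((c - star c) * (c - star c)).
      by rewrite /k -scalerAl -scalerAr iiZ.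
    by rewrite -[p]opprK -h qE; ncring.
  apply: posD; last exact: posD.
  apply: posD; apply: pos_sqr; first by rewrite starD starK addrC.
  by rewrite star_i starB starK -scalerN opprB.
have cp : c * p = - (q * c) by rewrite qE -mulrA h mulrN opprK.
have [t [t0 h1 h2]] := pos_bound2 (pos_sqr sp) (pos_sqr sq).
have e : c * (p * p) = (q * q) * c by rewrite mulrA cp mulNr -[q * c * p]mulrA cp mulrN opprK mulrA.
have := csqrt_intertwine t0 h1 h2 e.
have root z : pos z -> cnorm (rscal t - z * z) <= t -> csqrt t (z * z) = z.
  move=> pz hz; apply: pos_sqrt_unique => //.
  - by apply: csqrt_pos => //; rewrite starM (pos_sa pz).
  - by apply: csqrt_intertwine => //; rewrite mulrA.
  - exact: csqrt_sqr.
(* Now [c p] equals both [q c] and [- q c]. *)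
rewrite !root // cp => /eqP; rewrite eq_sym -addr_eq0 => /eqP qc0.
have {}qc0 : q * c = 0 by apply: addxx_inj; rewrite qc0 addr0.
apply: star_mul_eq0; apply: sqr_eq0; first by rewrite starM starK.
by rewrite -!mulrA [c * (_ * _)]mulrA -qE qc0 mulr0.
Qed.

(** For [x = a^* a] the witness satisfies [(a y)^* (a y) = y x y = - v^2], so [a y = 0] by
    [star_mul_neg]. *)
Lemma pos_star_mul a : pos (star a * a).
Proof.
have sx : star (star a * a) = star a * a by rewrite starM starK.
have [y [v [sy sv yxy ypos _]]] := negative_witness sx; apply: ypos.
have h : star (a * y) * (a * y) = - (v * v) by rewrite -yxy starM sy !mulrA.
by rewrite -!mulrA (star_mul_neg (pos_sqr sv) h) !mulr0.
Qed.

Lemma pos_factor a : pos a <-> exists b, a = star b * b.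
Proof.
split=> [/pos_sqrt [s [ss h _ _]]|[b ->]]; last exact: pos_star_mul.
by exists s; rewrite ss.
Qed.

Lemma pos_conj a b : pos a -> pos (star b * a * b).
Proof.
move=> /pos_factor [c ->]; have := pos_star_mul (c * b).
by rewrite starM !mulrA.
Qed.

(** If [w y w = - v^2] then [w y^3 w = - (v y)^2] is both positive and negative. Hence [v y = 0],
    and then [(w y)^2 = - v^2 y = 0]. *)
Lemma pos_cube y : star y = y -> pos (y * y * y) -> pos y.
Proof.
move=> sy py; have [w [v [sw sv wyw wpos cw]]] := negative_witness sy.
have [yw yv] := cw y erefl; apply: wpos.
have vy0 : v * y = 0.
  have sp : star (v * y) = v * y by rewrite starM sv sy.
  apply: sqr_eq0 => //; apply: oppr_inj; rewrite oppr0.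
  apply/eqP; rewrite oppr_eq0; apply/eqP; apply: pos_proper; first exact: pos_sqr.
  have -> : - (v * y * (v * y)) = star w * (y * y * y) * w.
    have -> : star w * (y * y * y) * w = (y * w) * y * (w * y).
      by rewrite sw yw -{2}yw !mulrA.
    have -> : y * w * y * (w * y) = y * (w * y * w) * y by rewrite !mulrA.
    by rewrite wyw mulrN mulNr -{1}yv !mulrA.
  exact: pos_conj.
have wy0 : w * y = 0.
  apply: sqr_eq0; first by rewrite starM sw sy yw.
  by rewrite mulrA wyw mulNr -mulrA vy0 mulr0 oppr0.
by rewrite wy0 mul0r.
Qed.

(** With [m] the modulus of [x], the elements [m + x] and [m - x] are twice the positive and
    negative parts of [x]; the doubling dispenses with halves. The last clause makes both parts
    central when [x] is. *)
Lemma pos_parts x : star x = x -> exists f g,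
  [/\ pos f, pos g, g * f = 0, x + x = f - g &
      forall c, c * x = x * c -> c * f = f * c /\ c * g = g * c].
Proof.
move=> sx; have [m [sm mm pm cm]] := pos_sqrt (pos_sqr sx).
have xm : x * m = m * x by apply: cm; rewrite mulrA.
have [r [sr rr pr cr]] := pos_sqrt pm.
suff posB z : star z = z -> z * z = m * m -> z * m = m * z -> pos (m - z).
  exists (m + x), (m - x); split.
  - rewrite -[x in m + x]opprK; apply: posB; first by rewrite starN sx.
      by rewrite mulrNN mm.
    by rewrite mulNr mulrN xm.
  - by apply: posB; rewrite // mm.
  - by rewrite mulrDr !mulrBl mm xm addrA subrK subrr.
  - by ncring.
  - move=> c cx.
    have cm' : c * m = m * c by apply: cm; rewrite mulrA cx -mulrA cx mulrA.
    by rewrite !mulrBr !mulrBl !mulrDr !mulrDl cm' cx.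
move=> sz zz zm; have sy : star (m - z) = m - z by rewrite starB sm sz.
(* [(m - z)^3] is twice the square of the selfadjoint element [r (m - z)], where [r^2 = m]. *)
apply: pos_cube => //; set y := m - z.
have zr : z * r = r * z by apply: cr.
have mr : m * r = r * m by apply: cr.
have yr : y * r = r * y by rewrite mulrBl mulrBr zr mr.
have -> : y * y * y = r * y * (r * y) + r * y * (r * y).
  have -> : r * y * (r * y) = y * m * y by rewrite -{1}yr -rr !mulrA.
  have -> : y * y = y * m + y * m.
    have -> : y * y = (m * m - z * m) - (m * z - z * z) by rewrite /y; ncring.
    by rewrite zz zm /y mulrBl zm; ncring.
  by rewrite mulrDl.
by apply: posD; apply: pos_sqr; rewrite starM sr sy yr.
Qed.

End CStarBasics.

(** * Matrices over a C*-algebra *)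

(** An alias, because matrices over a ring are already a module over that ring; here the complex
    scalars act entrywise. *)
Definition entry_mx (T : Type) (m n : nat) := 'M[T]_(m, n).

Section EntrywiseModule.
Context {K : pzRingType} {V : lmodType K} {m n : nat}.

HB.instance Definition _ := GRing.Zmodule.copy (entry_mx V m n) 'M[V]_(m, n).

Let scale_mx (c : K) (X : entry_mx V m n) : entry_mx V m n :=
  map_mx (fun x => c *: x) X.

Let scale_mxA c d (X : entry_mx V m n) : scale_mx c (scale_mx d X) = scale_mx (c * d) X.
Proof. by apply/matrixP => i j; rewrite !mxE scalerA. Qed.
Let scale_mx1 : left_id 1 scale_mx.
Proof. by move=> X; apply/matrixP => i j; rewrite !mxE scale1r. Qed.
Let scale_mxDr : right_distributive scale_mx +%R.
Proof. by move=> c X Y; apply/matrixP => i j; rewrite !mxE scalerDr. Qed.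
Let scale_mxDl X : {morph scale_mx^~ X : a b / a + b}.
Proof. by move=> c d; apply/matrixP => i j; rewrite !mxE scalerDl. Qed.

HB.instance Definition _ := GRing.Zmodule_isLmodule.Build K (entry_mx V m n)
  scale_mxA scale_mx1 scale_mxDr scale_mxDl.

Lemma entry_mxZ (c : K) (X : entry_mx V m n) i j : (c *: X) i j = c *: X i j.
Proof. by rewrite mxE. Qed.
End EntrywiseModule.

Section MatrixAdjoint.
Context {R : realType} {A : cstarAlgType R}.

Definition madj m n (X : 'M[A]_(m, n)) : 'M[A]_(n, m) := (map_mx star X)^T.

Lemma madjE m n (X : 'M[A]_(m, n)) i j : madj X i j = star (X j i).
Proof. by rewrite !mxE. Qed.

Lemma madjK m n (X : 'M[A]_(m, n)) : madj (madj X) = X.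
Proof. by apply/matrixP => i j; rewrite !madjE starK. Qed.

Lemma madjD m n (X Y : 'M[A]_(m, n)) : madj (X + Y) = madj X + madj Y.
Proof. by apply/matrixP => i j; rewrite !mxE starD. Qed.

Lemma madjN m n (X : 'M[A]_(m, n)) : madj (- X) = - madj X.
Proof. by apply/matrixP => i j; rewrite !mxE starN. Qed.

Lemma madjM m n p (X : 'M[A]_(m, n)) (Y : 'M[A]_(n, p)) :
  madj (X *m Y) = madj Y *m madj X.
Proof.
apply/matrixP => i j; rewrite madjE !mxE star_sum.
by apply: eq_bigr => k _; rewrite starM !madjE.
Qed.

Lemma madj_scalar n (a : A) : madj (a%:M : 'M_n) = (star a)%:M.
Proof.
apply/matrixP => i j; rewrite madjE !mxE eq_sym.
by case: (i == j); rewrite ?mulr1n // mulr0n star0.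
Qed.

Lemma pos_diag_mul m n (Y : 'M[A]_(m, n)) i : pos ((madj Y *m Y) i i).
Proof.
rewrite mxE; apply: pos_sum => j _.
by rewrite madjE; exact: pos_star_mul.
Qed.

Lemma madj_mul_eq0 m n (Y : 'M[A]_(m, n)) :
  (forall i, (madj Y *m Y) i i = 0) -> Y = 0.
Proof.
move=> h; apply/matrixP => i j; rewrite mxE.
have := h j; rewrite mxE (bigD1 i) //= !madjE => /pos_add_eq0 [].
- exact: pos_star_mul.
- by apply: pos_sum => k _; rewrite madjE; exact: pos_star_mul.
- by move/star_mul_eq0.
Qed.

Lemma mul_cV_scalar n (u : 'cV[A]_n) (a : A) i : (u *m a%:M : 'cV_n) i 0 = u i 0 * a.
Proof. by rewrite mxE big_ord1 mxE eqxx mulr1n. Qed.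

(** * The Hilbert module of column vectors over a C*-algebra *)

Section InnerProduct.
Context {n : nat}.
Implicit Types u v w : 'cV[A]_n.

Definition ip u v : A := (madj u *m v) 0 0.

Lemma ipDl u v w : ip (u + v) w = ip u w + ip v w.
Proof. by rewrite /ip madjD mulmxDl mxE. Qed.
Lemma ipDr u v w : ip u (v + w) = ip u v + ip u w.
Proof. by rewrite /ip mulmxDr mxE. Qed.
Lemma ipNl u v : ip (- u) v = - ip u v.
Proof. by rewrite /ip madjN mulNmx mxE. Qed.
Lemma ipNr u v : ip u (- v) = - ip u v.
Proof. by rewrite /ip mulmxN mxE. Qed.
Lemma ip_star u v : star (ip u v) = ip v u.
Proof. by rewrite /ip -madjE madjM madjK. Qed.
Lemma ipZr u v (a : A) : ip u (v *m a%:M) = ip u v * a.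
Proof. by rewrite /ip mulmxA mul_cV_scalar. Qed.
Lemma ipZl u v (a : A) : ip (u *m a%:M) v = star a * ip u v.
Proof. by rewrite -ip_star ipZr starM ip_star. Qed.
Lemma ip_pos v : pos (ip v v). Proof. exact: pos_diag_mul. Qed.
Lemma ip_eq0 v : ip v v = 0 -> v = 0.
Proof. by move=> h; apply: madj_mul_eq0 => i; rewrite ord1. Qed.
Lemma ipE u v : ip u v = \sum_i star (u i 0) * v i 0.
Proof. by rewrite /ip mxE; apply: eq_bigr => i _; rewrite madjE. Qed.

Lemma ip_cauchy_schwarz u v :
  cnorm (ip u v) ^+ 2 <= cnorm (ip u u) * cnorm (ip v v).
Proof.
set K := cnorm (ip u u); have [K0|K0] := eqVneq K 0.
  rewrite (_ : u = 0); last by apply: ip_eq0; apply: cnorm0_eq0.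
  rewrite ipE big1 ?cnorm0 ?expr0n /= ?K0 ?mulr_ge0 ?cnorm_ge0 // => i _.
  by rewrite mxE star0 mul0r.
have Kp : 0 < K by rewrite lt_neqAle eq_sym K0 cnorm_ge0.
(* [w] is chosen so that adding [a^* (K - <u, u>) a], which is positive, to [<w, w>] leaves
   [K (K <v, v> - a^* a)]. *)
set a := ip u v; pose w := u *m a%:M - v *m (rscal K)%:M.
have hw : ip w w = star a * ip u u * a - rscal K * (star a * a)
     - (rscal K * (star a * a) - rscal K * (rscal K * ip v v)).
  rewrite /w !(ipDl, ipDr, ipNl, ipNr) !(ipZl, ipZr) star_rscal.
  rewrite -/a -[ip v u]ip_star -/a (rscalC K a) (rscalC K (ip v v)).
  by rewrite [star a * (rscal K * a)]mulrA (rscalC K (star a)); ncring.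
have h1 : pos (star a * (rscal K - ip u u) * a).
  by apply: pos_conj; apply: pos_norm_sub => //; exact: ip_star.
have h2 := posD (ip_pos w) h1.
have {h1 hw}h : pos (rscal K * ip v v - star a * a).
  have -> : rscal K * ip v v - star a * a = K^-1%:C *:
     (ip w w + star a * (rscal K - ip u u) * a).
    apply: (@realZ_inj _ _ K) => //; rewrite realZVK // -rscalE hw.
    have -> : star a * (rscal K - ip u u) * a =
       rscal K * (star a * a) - star a * ip u u * a.
      by rewrite mulrBr mulrBl (rscalC K (star a)) !mulrA.
    by ncring.
  by apply: posZ; rewrite // invr_ge0 ltW.
have := pos_le_norm (pos_star_mul a) h.
by rewrite cnorm_cstar rscalE cnormZr gtr0_norm.
Qed.

Definition cvnorm v : R := Num.sqrt (cnorm (ip v v)).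

Lemma cvnorm_ge0 v : 0 <= cvnorm v. Proof. exact: sqrtr_ge0. Qed.

Lemma cvnorm_sqr v : cvnorm v ^+ 2 = cnorm (ip v v).
Proof. by rewrite sqr_sqrtr ?cnorm_ge0. Qed.

Lemma cnorm_ip_le u v : cnorm (ip u v) <= cvnorm u * cvnorm v.
Proof.
rewrite -(@ler_pXn2r _ 2) ?nnegrE ?cnorm_ge0 ?mulr_ge0 ?cvnorm_ge0 //.
by rewrite exprMn !cvnorm_sqr ip_cauchy_schwarz.
Qed.

Lemma cvnormD u v : cvnorm (u + v) <= cvnorm u + cvnorm v.
Proof.
rewrite -(@ler_pXn2r _ 2) ?nnegrE ?addr_ge0 ?cvnorm_ge0 // cvnorm_sqr ipDl !ipDr.
have := cnormD (ip u u + ip u v) (ip v u + ip v v).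
have := cnormD (ip u u) (ip u v); have := cnormD (ip v u) (ip v v).
have := cnorm_ip_le u v; have := cnorm_ip_le v u.
by rewrite -!cvnorm_sqr; nra.
Qed.

Lemma cvnorm_eq0 v : cvnorm v = 0 -> v = 0.
Proof.
by move=> h; apply/ip_eq0/cnorm0_eq0; rewrite -cvnorm_sqr h expr0n.
Qed.

Lemma cvnorm0 : cvnorm 0 = 0.
Proof. by rewrite /cvnorm /ip mulmx0 mxE cnorm0 sqrtr0. Qed.

Lemma cvnormZ (c : R[i]) v :
  (cvnorm (v *m (c%:A)%:M))%:C = `|c| * (cvnorm v)%:C.
Proof.
rewrite normc_def -realCM; congr (_%:C); apply/eqP.
have k0 : 0 <= complex.Re c ^+ 2 + complex.Im c ^+ 2 by rewrite addr_ge0 ?sqr_ge0.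
rewrite -(@eqrXn2 _ 2) ?mulr_ge0 ?sqrtr_ge0 ?cvnorm_ge0 //.
rewrite exprMn !cvnorm_sqr sqr_sqrtr // ipZl ipZr starZ star1.
rewrite -!scalerAr -!scalerAl mulr1 mul1r scalerA.
have -> : (c * c^*)%C = (complex.Re c ^+ 2 + complex.Im c ^+ 2)%:C.
  case: c {k0} => a b; apply/eqP; rewrite eq_complex /=.
  by apply/andP; split; apply/eqP; ring.
by rewrite cnormZr ger0_norm.
Qed.

Lemma cnorm_entry v i : cnorm (v i 0) <= cvnorm v.
Proof.
rewrite -(@ler_pXn2r _ 2) ?nnegrE ?cvnorm_ge0 ?cnorm_ge0 // cvnorm_sqr -cnorm_cstar.
apply: pos_le_norm; first exact: pos_star_mul.
rewrite ipE (bigD1 i) //= addrAC subrr add0r; apply: pos_sum => j _.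
exact: pos_star_mul.
Qed.

Lemma cvnorm_le_sum v : cvnorm v <= \sum_i cnorm (v i 0).
Proof.
have s0 : 0 <= \sum_i cnorm (v i 0) by apply: sumr_ge0 => i _; exact: cnorm_ge0.
rewrite -(@ler_pXn2r _ 2) ?nnegrE ?cvnorm_ge0 // cvnorm_sqr ipE.
rewrite (le_trans (y := \sum_i cnorm (v i 0) ^+ 2)) //.
  elim/big_ind2: _ => [|a r b t ha hb|i _]; first by rewrite cnorm0.
    by rewrite (le_trans (cnormD _ _)) // lerD.
  by rewrite cnorm_cstar.
rewrite expr2 mulr_suml; apply: ler_sum => i _; rewrite expr2 ler_wpM2l ?cnorm_ge0 //.
by rewrite (bigD1 i) //= lerDl sumr_ge0 // => j _; exact: cnorm_ge0.
Qed.
End InnerProduct.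

Lemma ip_madj m n (X : 'M[A]_(m, n)) u v : ip (X *m u) v = ip u (madj X *m v).
Proof. by rewrite /ip madjM mulmxA. Qed.

(** * The operator norm of matrices acting on columns *)

Section OperatorNorm.
Context {n : nat}.
Implicit Types (X Y : 'M[A]_n.+1) (v : 'cV[A]_n.+1).

Lemma cvnorm_mul_bound X : exists2 K, 0 <= K &
  forall v, cvnorm (X *m v) <= K * cvnorm v.
Proof.
exists (\sum_i \sum_j cnorm (X i j)).
  by apply: sumr_ge0 => i _; apply: sumr_ge0 => j _; exact: cnorm_ge0.
move=> v; rewrite (le_trans (cvnorm_le_sum _)) // mulr_suml; apply: ler_sum => i _.
rewrite mxE mulr_suml (le_trans (y := \sum_j cnorm (X i j * v j 0))) //.
  by elim/big_ind2: _ => [|a r b t ha hb|//]; rewrite ?cnorm0 // (le_trans (cnormD _ _)) // lerD.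
apply: ler_sum => j _; rewrite (le_trans (cnormM _ _)) //.
by rewrite ler_wpM2l ?cnorm_ge0 ?cnorm_entry.
Qed.

Definition mxnorm X : R := inf [set K | 0 <= K /\
  forall v, cvnorm (X *m v) <= K * cvnorm v].

Let bounds X : has_inf [set K | 0 <= K /\ forall v, cvnorm (X *m v) <= K * cvnorm v].
Proof.
split; last by exists 0 => K [].
by have [K K0 h] := cvnorm_mul_bound X; exists K.
Qed.

Lemma mxnorm_ge0 X : 0 <= mxnorm X.
Proof. by apply: lb_le_inf; [case: (bounds X) | move=> K []]. Qed.

Lemma mxnorm_le X K : 0 <= K -> (forall v, cvnorm (X *m v) <= K * cvnorm v) ->
  mxnorm X <= K.
Proof. by move=> K0 h; apply: ge_inf; [case: (bounds X) | split]. Qed.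

Lemma cvnorm_mul X v : cvnorm (X *m v) <= mxnorm X * cvnorm v.
Proof.
have [v0|v0] := eqVneq (cvnorm v) 0.
  by rewrite v0 mulr0 (cvnorm_eq0 v0) mulmx0 cvnorm0.
have vp : 0 < cvnorm v by rewrite lt_neqAle eq_sym v0 cvnorm_ge0.
rewrite -ler_pdivrMr //; apply: lb_le_inf; first by case: (bounds X).
by move=> K [K0 h]; rewrite ler_pdivrMr.
Qed.

Lemma mxnormD X Y : mxnorm (X + Y) <= mxnorm X + mxnorm Y.
Proof.
apply: mxnorm_le; first by rewrite addr_ge0 ?mxnorm_ge0.
by move=> v; rewrite mulmxDl (le_trans (cvnormD _ _)) // mulrDl lerD ?cvnorm_mul.
Qed.

Lemma mxnormM X Y : mxnorm (X *m Y) <= mxnorm X * mxnorm Y.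
Proof.
apply: mxnorm_le; first by rewrite mulr_ge0 ?mxnorm_ge0.
move=> v; rewrite -mulmxA (le_trans (cvnorm_mul _ _)) // -mulrA.
by rewrite ler_wpM2l ?mxnorm_ge0 ?cvnorm_mul.
Qed.

Lemma mxnorm_eq0 X : mxnorm X = 0 -> X = 0.
Proof.
move=> X0; apply/matrixP => i j; rewrite mxE.
have : X *m delta_mx j 0 = 0 :> 'cV_n.+1.
  apply: cvnorm_eq0; apply/eqP; rewrite eq_le cvnorm_ge0 andbT.
  by rewrite (le_trans (cvnorm_mul _ _)) // X0 mul0r.
by move/matrixP/(_ i 0); rewrite -colE !mxE.
Qed.

Lemma mxnorm_cstar X : mxnorm (madj X *m X) = mxnorm X ^+ 2.
Proof.
have h Y : mxnorm Y ^+ 2 <= mxnorm (madj Y *m Y).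
  have r0 := mxnorm_ge0 (madj Y *m Y).
  rewrite -[leRHS](sqr_sqrtr r0) lerXn2r ?nnegrE ?mxnorm_ge0 ?sqrtr_ge0 //.
  apply: mxnorm_le => [|v]; first exact: sqrtr_ge0.
  rewrite -(@ler_pXn2r _ 2) ?nnegrE ?mulr_ge0 ?cvnorm_ge0 ?sqrtr_ge0 //.
  rewrite exprMn (sqr_sqrtr r0) [X in X <= _]cvnorm_sqr ip_madj mulmxA.
  rewrite (le_trans (cnorm_ip_le _ _)) // expr2 mulrA [leRHS]mulrC.
  by rewrite ler_wpM2l ?cvnorm_ge0 ?cvnorm_mul.
have h2 Y : mxnorm Y <= mxnorm (madj Y).
  have [->|Y0] := eqVneq (mxnorm Y) 0; first exact: mxnorm_ge0.
  have Yp : 0 < mxnorm Y by rewrite lt_neqAle eq_sym Y0 mxnorm_ge0.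
  by rewrite -(ler_pM2r Yp) -expr2 (le_trans (h Y)) // mxnormM.
apply/eqP; rewrite eq_le h andbT (le_trans (mxnormM _ _)) // expr2.
by rewrite ler_wpM2r ?mxnorm_ge0 // -{2}(madjK X) h2.
Qed.

Lemma cnorm_mxentry X i j : cnorm (X i j) <= mxnorm X.
Proof.
have h := cvnorm_mul X (delta_mx j 0); rewrite -colE in h.
have e : cvnorm (delta_mx j 0 : 'cV[A]_n.+1) <= 1.
  rewrite (le_trans (cvnorm_le_sum _)) // (bigD1 j) //= mxE !eqxx cnorm1 big1 ?addr0 //.
  by move=> k kj; rewrite mxE (negbTE kj) cnorm0.
have := cnorm_entry (col j X) i; rewrite mxE => /le_trans; apply.
by rewrite (le_trans h) // ler_piMr ?mxnorm_ge0.
Qed.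

Lemma mxnorm_le_sum X : mxnorm X <= \sum_i \sum_j cnorm (X i j).
Proof.
apply: mxnorm_le => [|v].
  by apply: sumr_ge0 => i _; apply: sumr_ge0 => j _; exact: cnorm_ge0.
rewrite (le_trans (cvnorm_le_sum _)) // mulr_suml; apply: ler_sum => i _.
rewrite mxE mulr_suml (le_trans (y := \sum_j cnorm (X i j * v j 0))) //.
  by elim/big_ind2: _ => [|a r b t ha hb|//]; rewrite ?cnorm0 // (le_trans (cnormD _ _)) // lerD.
apply: ler_sum => j _; rewrite (le_trans (cnormM _ _)) //.
by rewrite ler_wpM2l ?cnorm_ge0 ?cnorm_entry.
Qed.
End OperatorNorm.
End MatrixAdjoint.

(** The size is [n.+1] because algebras satisfy [1 != 0]; matrices of size 0 are treated apart where
    they occur. *)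
Definition cmx (T : Type) (n : nat) := entry_mx T n.+1 n.+1.

Section MatrixCStar.
Context {R : realType} {A : cstarAlgType R} {n : nat}.
Local Notation M := (cmx A n).

HB.instance Definition _ := GRing.NzRing.copy M 'M[A]_n.+1.
HB.instance Definition _ := GRing.Zmodule_isLmodule.Build R[i] M
  (@scalerA R[i] (entry_mx A n.+1 n.+1)) (@scale1r R[i] (entry_mx A n.+1 n.+1))
  (@scalerDr R[i] (entry_mx A n.+1 n.+1)) (@scalerDl R[i] (entry_mx A n.+1 n.+1)).

Let scaleAl (c : R[i]) (X Y : M) : c *: (X * Y) = (c *: X) * Y.
Proof.
apply/matrixP => i j; rewrite !mxE scaler_sumr; apply: eq_bigr => k _.
by rewrite !mxE scalerAl.
Qed.
HB.instance Definition _ := GRing.Lmodule_isLalgebra.Build R[i] M scaleAl.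

Let scaleAr (c : R[i]) (X Y : M) : c *: (X * Y) = X * (c *: Y).
Proof.
apply/matrixP => i j; rewrite !mxE scaler_sumr; apply: eq_bigr => k _.
by rewrite !mxE scalerAr.
Qed.
HB.instance Definition _ := GRing.Lalgebra_isAlgebra.Build R[i] M scaleAr.

Let mstar (X : M) : M := madj X.
Let mnorm (X : M) : R := mxnorm X.

Let mstarD (X Y : M) : mstar (X + Y) = mstar X + mstar Y.
Proof. exact: madjD. Qed.
Let mstarZ (c : R[i]) (X : M) : mstar (c *: X) = c^*%C *: mstar X.
Proof. by apply/matrixP => i j; rewrite madjE !mxE starZ. Qed.
Let mstarM (X Y : M) : mstar (X * Y) = mstar Y * mstar X.
Proof. exact: madjM. Qed.
Let mstarK (X : M) : mstar (mstar X) = X.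
Proof. exact: madjK. Qed.
Let mnormZ (c : R[i]) (X : M) : (mnorm (c *: X))%:C = `|c| * (mnorm X)%:C.
Proof.
have e (d : R[i]) (Y : M) (v : 'cV[A]_n.+1) :
    (d *: Y : 'M[A]_n.+1) *m v = ((Y : 'M[A]_n.+1) *m v) *m (d%:A)%:M.
  apply/matrixP => i j; rewrite ord1 mul_cV_scalar !mxE mulr_suml.
  by apply: eq_bigr => k _; rewrite mxE -scalerAr mulr1 -scalerAl.
have le (d : R[i]) (Y : M) : mnorm (d *: Y) <= complex.Re `|d| * mnorm Y.
  have dE : `|d| = (complex.Re `|d|)%:C by rewrite normc_def.
  have d0 : 0 <= complex.Re `|d| by rewrite normc_def /= sqrtr_ge0.
  apply: mxnorm_le => [|v]; first by rewrite mulr_ge0 ?mxnorm_ge0.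
  move: dE d0; move: (complex.Re `|d|) => k dE k0.
  rewrite e -mulrA -lecR cvnormZ dE -realCM lecR.
  by rewrite ler_wpM2l ?cvnorm_mul.
have cE : `|c| = (complex.Re `|c|)%:C by rewrite normc_def.
have := le c X; have := le c^-1 (c *: X).
have := normr_ge0 c; have := normr_eq0 c; rewrite normfV cE {cE le}.
move: (complex.Re `|c|) => k; rewrite -realCV -realCM lecR /= => ck k0 h2 h1.
congr (_%:C); apply/eqP; rewrite eq_le h1 /=.
have [c0|c0] := eqVneq c 0.
  move: ck; rewrite c0 eqxx => /eqP [->].
  by rewrite mul0r mxnorm_ge0.
have kp : 0 < k by rewrite lt_neqAle eq_sym -realC_neq0 ck c0 k0.
by move: h2; rewrite scalerA mulVf // scale1r ler_pdivlMl.
Qed.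
Let mcomplete (u : nat -> M) :
  (forall e : R, 0 < e -> exists N, forall m n, (N <= m)%N -> (N <= n)%N ->
    mnorm (u m - u n) < e) ->
  exists x, forall e : R, 0 < e -> exists N, forall n, (N <= n)%N ->
    mnorm (u n - x) < e.
Proof.
move=> hu; have ex i j : exists x, converges (fun k => u k i j) x.
  apply: cnorm_complete => e /hu [N hN]; exists N => p q Np Nq.
  rewrite (le_lt_trans _ (hN _ _ Np Nq)) //.
  by have := cnorm_mxentry (u p - u q) i j; rewrite !mxE.
have [x hx] := choice (fun ij : 'I_n.+1 * 'I_n.+1 => ex ij.1 ij.2).
exists (\matrix_(i, j) x (i, j)) => e e0.
(* The operator norm is at most the sum over all entries; with this bound on each of the
   [n.+1 * n.+1] entries the sum stays strictly below [e]. *)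
have d0 : 0 < e / (n.+1%:R * n.+1%:R + 1).
  by rewrite divr_gt0 // ltr_wpDl // mulr_ge0.
have [N hN] := choice (fun ij => hx ij _ d0).
exists (\max_ij N ij)%N => p hp.
rewrite (le_lt_trans (mxnorm_le_sum _)) //.
rewrite (le_lt_trans (y := \sum_(i < n.+1) \sum_(j < n.+1) e / (n.+1%:R * n.+1%:R + 1))) //.
  apply: ler_sum => i _; apply: ler_sum => j _; rewrite !mxE ltW //.
  by apply: (hN (i, j)); rewrite (leq_trans _ hp) // leq_bigmax.
rewrite !sumr_const !card_ord -mulrnA -[(e / _) *+ _]mulr_natr natrM mulrAC ltr_pdivrMr.
  by rewrite ltr_pM2l // ltrDl.
by rewrite ltr_wpDl // mulr_ge0.
Qed.

HB.instance Definition _ := isCStarAlgebra.Build R M mstarD mstarZ mstarM mstarK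
  (@mxnorm_eq0 R A n) (@mxnormD R A n) mnormZ (@mxnormM R A n) mcomplete
  (@mxnorm_cstar R A n).
End MatrixCStar.

Section CStarMatrixOrder.
Context {R : realType} {A : cstarAlgType R}.

Lemma cstar_mxpos0n (X : 'M[A]_0) : cstar_mxpos X.
Proof. by exists X; rewrite [LHS]flatmx0 [RHS]flatmx0. Qed.

Lemma cmx_posP n (X : cmx A n) : pos X <-> cstar_mxpos (X : 'M[A]_n.+1).
Proof. exact: pos_factor. Qed.

(** For the converse, [Y X Y = - V^2] has diagonal entries [<Y e_j, X Y e_j>], which are positive by
    assumption, while those of [V^* V] are positive too. Hence [V = 0]. *)
Lemma cstar_mxposP n (X : 'M[A]_n) : cstar_mxpos X <->
  madj X = X /\ forall v : 'cV[A]_n, pos (ip v (X *m v)).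
Proof.
split=> [[Y ->]|].
  rewrite -/(madj Y); split; first by rewrite madjM madjK.
  by move=> v; rewrite -mulmxA -ip_madj; exact: ip_pos.
case: n X => [|n] X [sX hX]; first exact: cstar_mxpos0n.
have [Y [V [sY sV YXY Xpos _]]] := @negative_witness R (cmx A n) X sX.
apply/cmx_posP/Xpos; rewrite YXY (_ : V = 0) ?mul0r ?oppr0 //.
apply: madj_mul_eq0 => j; apply: pos_proper; first exact: pos_diag_mul.
have -> : - (madj V *m V) j j = ip (Y *m delta_mx j 0) (X *m (Y *m delta_mx j 0)).
  rewrite ip_madj !mulmxA.
  have -> : madj Y *m X *m Y = - (madj V *m V).
    by rewrite [madj Y]sY [madj V]sV; exact: YXY.
  rewrite -colE ipE (bigD1 j) //= big1 ?addr0.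
    by rewrite !mxE !eqxx star1 mul1r.
  by move=> k kj; rewrite !mxE (negbTE kj) star0 mul0r.
exact: hX.
Qed.

Lemma cstar_mxpos_sa n (X : 'M[A]_n) : cstar_mxpos X -> madj X = X.
Proof. by case/cstar_mxposP. Qed.

Lemma cstar_mxpos_mul m n (Y : 'M[A]_(m, n)) : cstar_mxpos (madj Y *m Y).
Proof.
apply/cstar_mxposP; split; first by rewrite madjM madjK.
by move=> v; rewrite -mulmxA -ip_madj; exact: ip_pos.
Qed.

Lemma cstar_mxpos_conj m n (X : 'M[A]_m) (Y : 'M[A]_(m, n)) :
  cstar_mxpos X -> cstar_mxpos (madj Y *m X *m Y).
Proof.
move=> [Z ->]; have := cstar_mxpos_mul (Z *m Y).
by rewrite madjM !mulmxA.
Qed.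

Lemma cstar_mxpos0 n : cstar_mxpos (0 : 'M[A]_n).
Proof. by have := cstar_mxpos_mul (0 : 'M[A]_n); rewrite mulmx0. Qed.

Lemma cstar_mxposD n (X Y : 'M[A]_n) :
  cstar_mxpos X -> cstar_mxpos Y -> cstar_mxpos (X + Y).
Proof.
move=> /cstar_mxposP [sX hX] /cstar_mxposP [sY hY]; apply/cstar_mxposP.
split; first by rewrite madjD sX sY.
by move=> v; rewrite mulmxDl ipDr; apply: posD.
Qed.

Lemma cstar_mxpos_proper n (X : 'M[A]_n) :
  cstar_mxpos X -> cstar_mxpos (- X) -> X = 0.
Proof.
case: n X => [|n] X; first by rewrite [X]flatmx0.
by move=> /cmx_posP h1 /cmx_posP h2; exact: pos_proper h1 h2.
Qed.

Lemma compressE n m (a : 'M[R[i]]_(n, m)) (X : 'M[A]_n) :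
  compress a X = madj (map_mx (fun c => c%:A) a) *m X *m map_mx (fun c => c%:A) a.
Proof.
apply/matrixP => i j; rewrite !mxE exchange_big /=; apply: eq_bigr => l _.
rewrite mxE mulr_suml; apply: eq_bigr => k _.
by rewrite !mxE starZ star1 -!scalerAl mul1r -scalerAr mulr1 scalerA.
Qed.

Lemma cstar_mxpos_compress n m (a : 'M[R[i]]_(n, m)) (X : 'M[A]_n) :
  cstar_mxpos X -> cstar_mxpos (compress a X).
Proof. by rewrite compressE; exact: cstar_mxpos_conj. Qed.

Lemma cstar_mxpos_scalar n (a : A) : pos a -> cstar_mxpos (a%:M : 'M_n).
Proof.
move=> /pos_factor [b ->].
by have := cstar_mxpos_mul (b%:M : 'M_n); rewrite madj_scalar -scalar_mxM.
Qed.

Lemma rscal_cmx n (r : R) : (rscal r : cmx A n) = (r%:C *: 1)%:M.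
Proof.
apply/matrixP => i j; rewrite entry_mxZ !mxE; case: (i == j).
  by rewrite !mulr1n.
by rewrite !mulr0n scaler0.
Qed.

Lemma cstar_order_unit n (X : 'M[A]_n) : madj X = X ->
  exists2 r : R, 0 < r & cstar_mxpos ((r%:C *: 1)%:M + X).
Proof.
case: n X => [|n] X sX; first by exists 1 => //; exact: cstar_mxpos0n.
exists (mxnorm X + 1); first by rewrite ltr_wpDl ?mxnorm_ge0.
apply/cmx_posP; have := @pos_norm_add R (cmx A n) X (mxnorm X + 1) sX.
by rewrite rscal_cmx; apply; rewrite lerDl.
Qed.

Lemma cstar_archimedean n (X : 'M[A]_n) : madj X = X ->
  (forall r : R, 0 < r -> cstar_mxpos ((r%:C *: 1)%:M + X)) -> cstar_mxpos X.
Proof.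
case: n X => [|n] X sX hX; first exact: cstar_mxpos0n.
apply/cmx_posP; apply: pos_archimedean => // r /hX /cmx_posP.
by rewrite rscal_cmx.
Qed.

Lemma cstar_mxpos11 (a : A) : cstar_mxpos (a%:M : 'M_1) <-> pos a.
Proof.
split=> [/cstar_mxposP [_ /(_ 1%:M)]|/pos_factor [b ->]].
  by rewrite /ip mulmx1 madj_scalar star1 mul1mx mxE eqxx mulr1n.
by have := cstar_mxpos_mul (b%:M : 'M_1); rewrite madj_scalar -scalar_mxM.
Qed.
End CStarMatrixOrder.

(** A copy of [A] that carries the operator system structure, so that facts such as injectivity of I
    apply to maps out of a C*-algebra. *)
Definition cstar_os {R : realType} (A : cstarAlgType R) : Type := A.

Section CStarOperatorSystem.
Context {R : realType} (A : cstarAlgType R).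
HB.instance Definition _ := GRing.Lmodule.copy (cstar_os A) A.
HB.instance Definition _ := isOperatorSystem.Build R (cstar_os A)
  (@starD R A) (@starZ R A) (@starK R A) (@cstar_mxpos_sa R A)
  (@cstar_mxpos0 R A) (@cstar_mxposD R A) (@cstar_mxpos_proper R A)
  (@cstar_mxpos_compress R A) (@star1 R A) (@cstar_order_unit R A)
  (@cstar_archimedean R A).
End CStarOperatorSystem.

Section StarHomomorphism.
Context {R : realType} {A B : cstarAlgType R} (f : {linear A -> B}).
Hypothesis fM : forall x y, f (x * y) = f x * f y.
Hypothesis fS : forall x, f (star x) = star (f x).

Lemma map_mxM_hom m n p (X : 'M[A]_(m, n)) (Y : 'M[A]_(n, p)) :
  map_mx f (X *m Y) = map_mx f X *m map_mx f Y.
Proof.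
apply/matrixP => i j; rewrite !mxE linear_sum; apply: eq_bigr => k _.
by rewrite fM !mxE.
Qed.

Lemma map_madj m n (X : 'M[A]_(m, n)) : map_mx f (madj X) = madj (map_mx f X).
Proof. by apply/matrixP => i j; rewrite !mxE fS. Qed.

Lemma starhom_cp : completely_positive (@cstar_mxpos R A) (@cstar_mxpos R B) f.
Proof.
move=> n _ [Y ->]; rewrite -/(madj Y) map_mxM_hom map_madj.
exact: cstar_mxpos_mul.
Qed.

(** Applying [f] to [Y X Y = - V^2] gives a matrix that is positive together with its negative; so
    [f] kills [V^* V], and [V = 0] by injectivity. *)
Lemma starhom_reflects n (X : 'M[A]_n) : injective f ->
  cstar_mxpos (map_mx f X) -> cstar_mxpos X.
Proof.
move=> finj; have mxinj p q (Y Z : 'M[A]_(p, q)) : map_mx f Y = map_mx f Z -> Y = Z.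
  move=> /matrixP h; apply/matrixP => i j; apply: finj.
  by have := h i j; rewrite !mxE.
case: n X => [|n] X hX; first exact: cstar_mxpos0n.
have sX : madj X = X by apply: mxinj; rewrite map_madj cstar_mxpos_sa.
have [Y [V [sY sV YXY Xpos _]]] := @negative_witness R (cmx A n) X sX.
apply/cmx_posP/Xpos; rewrite YXY (_ : V = 0) ?mul0r ?oppr0 //.
have h1 := cstar_mxpos_conj (map_mx f Y) hX.
rewrite -map_madj -!map_mxM_hom [madj Y]sY in h1.
have h2 := cstar_mxpos_mul (map_mx f V).
have e : map_mx f (Y *m X *m Y) = - (madj (map_mx f V) *m map_mx f V).
  rewrite -map_madj -map_mxM_hom [madj V]sV -map_mxN; congr (map_mx f _).
  exact: YXY.
rewrite e in h1; have := cstar_mxpos_proper h2 h1 => e0.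
apply: mxinj; rewrite map_mx0; apply: madj_mul_eq0 => i.
by rewrite e0 mxE.
Qed.
End StarHomomorphism.

(** * Matrix preorders and their quotients *)

(* An operator system whose cones need not be proper. *)
Record preos (R : realType) (V : lmodType R[i]) := Preos {
  padj : V -> V;
  pcone : forall n, 'M[V]_n -> Prop;
  punit : V;
  padjD : forall x y, padj (x + y) = padj x + padj y;
  padjZ : forall (c : R[i]) x, padj (c *: x) = c^*%C *: padj x;
  padjK : forall x, padj (padj x) = x;
  pcone_adj : forall n (X : 'M[V]_n), pcone X -> (map_mx padj X)^T = X;
  pcone0 : forall n, pcone (0 : 'M[V]_n);
  pconeD : forall n (X Y : 'M[V]_n), pcone X -> pcone Y -> pcone (X + Y);
  pcone_compress : forall n m (a : 'M[R[i]]_(n, m)) (X : 'M[V]_n),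
    pcone X -> pcone (compress a X);
  punit_adj : padj punit = punit;
  punit_order : forall n (X : 'M[V]_n), (map_mx padj X)^T = X ->
    exists2 r : R, 0 < r & pcone ((r%:C *: punit)%:M + X);
  punit_archimedean : forall n (X : 'M[V]_n), (map_mx padj X)^T = X ->
    (forall r : R, 0 < r -> pcone ((r%:C *: punit)%:M + X)) -> pcone X
}.

Definition os_preos (R : realType) (S : opSystemType R) : preos S :=
  Preos (@adjD R S) (@Defs.adjZ R S) (@adjK R S) (@mxpos_adj R S) (@mxpos0 R S)
    (@mxposD R S) (@mxpos_compress R S) (@ounit_adj R S) (@ounit_order R S)
    (@ounit_archimedean R S).

Section Compress.
Context {R : realType} {V : lmodType R[i]}.

Lemma compress_map (W : lmodType R[i]) (f : {linear V -> W}) n m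
    (a : 'M[R[i]]_(n, m)) (X : 'M[V]_n) :
  map_mx f (compress a X) = compress a (map_mx f X).
Proof.
apply/matrixP => i j; rewrite !mxE linear_sum; apply: eq_bigr => k _.
by rewrite linear_sum; apply: eq_bigr => l _; rewrite linearZ mxE.
Qed.

Lemma compress_scalar n (c : R[i]) (X : 'M[V]_n) :
  compress c%:M X = map_mx (fun x => (c^*%C * c) *: x) X.
Proof.
apply/matrixP => i j; rewrite !mxE (bigD1 i) //= (bigD1 j) //=.
rewrite !mxE !eqxx !mulr1n [X in _ + X + _]big1 ?addr0.
  rewrite big1 ?addr0 // => k ki; apply: big1 => l _.
  by rewrite !mxE (negbTE ki) mulr0n rmorph0 mul0r scale0r.
by move=> l lj; rewrite !mxE (negbTE lj) mulr0n mulr0 scale0r.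
Qed.

Lemma compress_delta n m (k : 'I_n) (j : 'I_m) (X : 'M[V]_n) i l :
  compress (delta_mx k j) X i l = X k k *+ ((i == j) && (l == j)).
Proof.
rewrite mxE (bigD1 k) //= (bigD1 k) //= !mxE !eqxx /= conjc_nat -natrM mulnb.
rewrite [X in _ + X + _]big1 ?addr0 => [|q qk]; last first.
  by rewrite !mxE (negbTE qk) mulr0 scale0r.
rewrite big1 ?addr0 => [|p pk]; last first.
  by apply: big1 => q _; rewrite !mxE (negbTE pk) rmorph0 mul0r scale0r.
by rewrite scaler_nat.
Qed.

Lemma compress_id n (X : 'M[V]_n) : compress 1%:M X = X.
Proof.
rewrite compress_scalar; apply/matrixP => i j.
by rewrite mxE rmorph1 mul1r scale1r.
Qed.

End Compress.

Section PreosTheory.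
#[local] Arguments conjc : simpl never.
Context {R : realType} {V : lmodType R[i]} (P : preos V).
Implicit Types (x y : V) (r : R).

Definition herm n (X : 'M[V]_n) := (map_mx (padj P) X)^T = X.

Lemma hermE n (X : 'M[V]_n) : herm X <-> forall i j, padj P (X j i) = X i j.
Proof.
split=> [h i j|h]; first by rewrite -[RHS](congr1 (fun Y : 'M[V]_n => Y i j) h) !mxE.
by apply/matrixP => i j; rewrite !mxE.
Qed.

Lemma padj0 : padj P 0 = 0.
Proof. by have := padjZ P 0 0; rewrite !scale0r rmorph0 scale0r. Qed.

Lemma padjN x : padj P (- x) = - padj P x.
Proof. by rewrite -scaleN1r padjZ rmorphN rmorph1 scaleN1r. Qed.

Lemma padjZr r x : padj P (r%:C *: x) = r%:C *: padj P x.
Proof. by rewrite padjZ conjC_real. Qed.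

Lemma pcone_sum n (J : Type) (s : seq J) (Q : pred J) (F : J -> 'M[V]_n) :
  (forall j, Q j -> pcone P (F j)) -> pcone P (\sum_(j <- s | Q j) F j).
Proof. by move=> h; elim/big_ind: _ => //; [exact: pcone0 | exact: pconeD]. Qed.

Lemma pconeZ n r (X : 'M[V]_n) : 0 <= r -> pcone P X ->
  pcone P (map_mx (fun x => r%:C *: x) X).
Proof.
move=> r0 /(pcone_compress (Num.sqrt r)%:C%:M); rewrite compress_scalar.
by rewrite conjC_real -realCM -expr2 sqr_sqrtr.
Qed.

(** Positivity of the unit is derived from the order unit axiom applied to the unit itself: some
    [(t + 1) e] is positive, and rescaling does the rest. *)
Lemma pcone_unit n r : 0 <= r -> pcone P ((r%:C *: punit P)%:M : 'M_n).
Proof.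
have herm1 : herm ((1%:C *: punit P)%:M : 'M_n).
  apply/hermE => i j; rewrite !mxE eq_sym; case: eqP => _.
    by rewrite mulr1n scale1r punit_adj.
  by rewrite mulr0n padj0.
have [t t0 ht] := punit_order herm1; move=> r0.
have t1 : 0 < t + 1 by rewrite addr_gt0.
have := pconeZ (divr_ge0 r0 (ltW t1)) ht; congr pcone.
apply/matrixP => i j; rewrite !mxE -mulrnDl -scalerDl -realCD !scalerMnr scalerA.
by rewrite -realCM divfK ?lt0r_neq0.
Qed.

Lemma punit_order_ge n (X : 'M[V]_n) r t : r <= t ->
  pcone P ((r%:C *: punit P)%:M + X) -> pcone P ((t%:C *: punit P)%:M + X).
Proof.
move=> rt h; have t0 : 0 <= t - r by rewrite subr_ge0.
have -> : (t%:C *: punit P)%:M + X =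
    ((t - r)%:C *: punit P)%:M + ((r%:C *: punit P)%:M + X).
  by rewrite addrA -raddfD -scalerDl -realCD subrK.
by apply: pconeD => //; exact: pcone_unit.
Qed.

Lemma herm_scalar x : padj P x = x -> herm (x%:M : 'M_1).
Proof. by move=> h; apply/hermE => i j; rewrite !ord1 !mxE. Qed.

Definition offdiag x : 'M[V]_2 :=
  \matrix_(i, j) if i == 0 then (if j == 0 then 0 else x)
                 else (if j == 0 then padj P x else 0).

Lemma herm_offdiag x : herm (offdiag x).
Proof.
apply/hermE => i j; rewrite !mxE.
by case: (i == 0); case: (j == 0); rewrite ?padj0 ?padjK.
Qed.

(** Compression by [diag(1, -1)] turns [offdiag x] into its negative, so a null [x] must vanish in
    every quotient with proper cones. The 2 by 2 encoding makes sense for [x] that is not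
    hermitian. *)
Definition null x := pcone P (offdiag x).

Lemma compress2 m (a : 'M[R[i]]_(2, m)) x i j :
  compress a (offdiag x) i j =
  ((a 0 i)^*%C * a 1 j) *: x + ((a 1 i)^*%C * a 0 j) *: padj P x.
Proof.
rewrite !mxE !big_ord_recl !big_ord0 !mxE /= !scaler0 !addr0 !add0r.
by rewrite (_ : lift ord0 ord0 = 1) //; apply/val_inj.
Qed.

Lemma null0 : null 0.
Proof.
rewrite /null (_ : offdiag 0 = 0); first exact: pcone0.
by apply/matrixP => i j; rewrite !mxE padj0; do 2 case: ifP.
Qed.

Lemma nullD x y : null x -> null y -> null (x + y).
Proof.
move=> hx hy; rewrite /null (_ : offdiag (x + y) = offdiag x + offdiag y).
  exact: pconeD.
by apply/matrixP => i j; rewrite !mxE padjD; do 2 case: ifP; rewrite ?addr0.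
Qed.

Lemma nullZ (c : R[i]) x : null x -> null (c *: x).
Proof.
move=> /(pcone_compress (\matrix_(i, j) (if i == j then (if i == 0 then 1 else c) else 0))).
congr pcone; apply/matrixP => i j; rewrite compress2 !mxE.
case: i => [[|[|//]] hi]; case: j => [[|[|//]] hj] /=;
  by rewrite !(rmorph0, rmorph1, mul0r, mulr0, mul1r, mulr1, scale0r, addr0, add0r, padjZ).
Qed.

Lemma null_adj x : null x -> null (padj P x).
Proof.
move=> /(pcone_compress (\matrix_(i, j) (if i == j then 0 else 1))).
congr pcone; apply/matrixP => i j; rewrite compress2 !mxE.
case: i => [[|[|//]] hi]; case: j => [[|[|//]] hj] /=;
  by rewrite !(rmorph0, rmorph1, mul0r, mulr0, mul1r, mulr1, scale0r, scale1r, addr0, add0r, padjK).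
Qed.

(** Compressing [offdiag (X i j)] by the rows [e_i], [e_j] puts [X i j] at position (i, j) and its
    adjoint at (j, i). Summing over all i, j counts each entry of the hermitian [X] twice. *)
Lemma herm_null_pcone n (X : 'M[V]_n) : herm X -> (forall i j, null (X i j)) ->
  pcone P X.
Proof.
move=> /hermE hX hN.
pose a (i j : 'I_n) : 'M[R[i]]_(2, n) :=
  \matrix_(p, k) (if p == 0 then (k == i)%:R else (k == j)%:R).
have h : pcone P (\sum_i \sum_j compress (a i j) (offdiag (X i j))).
  by apply: pcone_sum => i _; apply: pcone_sum => j _; apply: pcone_compress; exact: hN.
have := pconeZ (ltac:(by rewrite invr_ge0) : 0 <= 2^-1 :> R) h.
congr pcone; apply/matrixP => k l; rewrite mxE -[RHS](halfZ_double (X k l)); congr (_ *: _).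
rewrite summxE.
under eq_bigr => i _.
  rewrite summxE; under eq_bigr => j _ do rewrite compress2 !mxE /= !conjc_nat.
  over.
rewrite /=; under eq_bigr do rewrite big_split /=.
rewrite big_split /=; congr (_ + _).
  rewrite (bigD1 k) //= (bigD1 l) //= !eqxx mulr1 scale1r big1 ?addr0 ?big1 ?addr0 //.
    by move=> i ik; apply: big1 => j _; rewrite eq_sym (negbTE ik) mul0r scale0r.
  by move=> j jl; rewrite [l == j]eq_sym (negbTE jl) mulr0 scale0r.
rewrite (bigD1 l) //= (bigD1 k) //= !eqxx mulr1 scale1r hX big1 ?addr0 ?big1 ?addr0 //.
  by move=> i il; apply: big1 => j _; rewrite [l == i]eq_sym (negbTE il) mulr0 scale0r.
by move=> j jk; rewrite [k == j]eq_sym (negbTE jk) mul0r scale0r.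
Qed.

Lemma pcone_null n (X : 'M[V]_n) : pcone P X -> pcone P (- X) ->
  forall i j, null (X i j).
Proof.
move=> h1 h2 i j; have /hermE hX := pcone_adj h1.
pose a (s : R[i]) : 'M[R[i]]_(n, 2) :=
  \matrix_(k, p) (if p == 0 then (k == i)%:R else s * (k == j)%:R).
(* Compression of [X] along [e_i, e_j] and of [- X] along [e_i, - e_j]: the diagonal cancels and the
   off-diagonal entries double. *)
have h := pconeD (pcone_compress (a 1) h1) (pcone_compress (a (-1)) h2).
have := pconeZ (ltac:(by rewrite invr_ge0) : 0 <= 2^-1 :> R) h.
rewrite /null; congr pcone; apply/matrixP => p q; rewrite mxE [X in _ *: X]mxE.
have e (s : R[i]) (Y : 'M[V]_n) : compress (a s) Y p q =
   ((if p == 0 then 1 else s^*%C) * (if q == 0 then 1 else s)) *: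
   Y (if p == 0 then i else j) (if q == 0 then i else j).
  rewrite mxE (bigD1 (if p == 0 then i else j)) //= (bigD1 (if q == 0 then i else j)) //=.
  rewrite !mxE [X in _ + X + _]big1 ?addr0; last first.
    by move=> l hl; rewrite !mxE; case: ifP hl => _ /negbTE ->; rewrite !mulr0 scale0r.
  rewrite [X in _ + X]big1 ?addr0; last first.
    move=> l hl; apply: big1 => l' _; rewrite !mxE.
    by case: ifP hl => _ /negbTE ->; rewrite ?mulr0 rmorph0 mul0r scale0r.
  congr (_ *: _); case: (p == 0); case: (q == 0) => /=;
    by rewrite ?mxE ?eqxx ?mulr1 ?rmorph1.
rewrite !e !mxE !rmorphN !rmorph1; case: ifP => _; case: ifP => _;
  rewrite ?mul1r ?mulr1 ?mulN1r ?opprK ?scaleN1r ?scale1r ?opprK ?subrr ?scaler0 //.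
  by rewrite halfZ_double.
by rewrite hX halfZ_double.
Qed.
End PreosTheory.

Definition null_pred {R : realType} {V : lmodType R[i]} (P : preos V) : {pred V} :=
  fun x => `[< null P x >].

Section QuotientModule.
Context {R : realType} {V : lmodType R[i]} (P : preos V).

Let null_zmod : zmod_closed (null_pred P).
Proof.
split=> [|x y]; first by apply/asboolP; exact: null0.
move=> /asboolP hx /asboolP hy; apply/asboolP; apply: nullD => //.
by rewrite -scaleN1r; exact: nullZ.
Qed.
HB.instance Definition _ := GRing.isZmodClosed.Build V (null_pred P) null_zmod.

Definition pquot : Type := (Quotient.quot [the zmodClosed V of null_pred P]).
HB.instance Definition _ := GRing.Zmodule.copy pquot (Quotient.quot [the zmodClosed V of null_pred P]).

Definition pq (x : V) : pquot := \pi_((Quotient.quot [the zmodClosed V of null_pred P]))%qT x.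
Definition plift (y : pquot) : V := repr (y : (Quotient.quot [the zmodClosed V of null_pred P])).

Lemma pliftK : cancel plift pq.
Proof. by move=> y; rewrite /pq /plift reprK. Qed.

Lemma pqD x y : pq (x + y) = pq x + pq y.
Proof. exact: raddfD. Qed.

Lemma pq_eq x y : pq x = pq y <-> null P (x - y).
Proof.
split=> [/eqP|h]; rewrite /pq.
  by rewrite -Quotient.idealrBE => /asboolP.
by apply/eqP; rewrite -Quotient.idealrBE; apply/asboolP.
Qed.

Let scaleq (c : R[i]) (y : pquot) : pquot := pq (c *: plift y).
Let pqZ' c x : pq (c *: x) = scaleq c (pq x).
Proof.
apply/pq_eq; rewrite -scalerBr; apply: nullZ.
by apply/pq_eq; rewrite pliftK.
Qed.
Let scaleqA c d y : scaleq c (scaleq d y) = scaleq (c * d) y.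
Proof. by rewrite -(pliftK y) -!pqZ' scalerA. Qed.
Let scaleq1 : left_id 1 scaleq.
Proof. by move=> y; rewrite -(pliftK y) -pqZ' scale1r. Qed.
Let scaleqDr : right_distributive scaleq +%R.
Proof. by move=> c x y; rewrite -(pliftK x) -(pliftK y) -pqD -!pqZ' scalerDr pqD. Qed.
Let scaleqDl y : {morph scaleq^~ y : a b / a + b}.
Proof. by move=> a b; rewrite -(pliftK y) -!pqZ' scalerDl pqD. Qed.
HB.instance Definition _ := GRing.Zmodule_isLmodule.Build R[i] pquot
  scaleqA scaleq1 scaleqDr scaleqDl.

Lemma pq_is_linear : linear pq.
Proof. by move=> c x y; rewrite pqD pqZ'. Qed.
HB.instance Definition _ := GRing.isLinear.Build R[i] V pquot _ pq pq_is_linear.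

Definition qadj (y : pquot) : pquot := pq (padj P (plift y)).

Lemma qadjE x : qadj (pq x) = pq (padj P x).
Proof.
apply/pq_eq; rewrite -[- _]padjN -padjD; apply: null_adj.
by apply/pq_eq; rewrite pliftK.
Qed.

Definition qcone n (X : 'M[pquot]_n) : Prop :=
  exists2 Y : 'M[V]_n, pcone P Y & map_mx pq Y = X.

(** Two hermitian lifts of one matrix differ by a hermitian matrix with null entries, which lies in
    the cone by [herm_null_pcone]. *)
Lemma herm_qcone n (Y : 'M[V]_n) : herm P Y -> qcone (map_mx pq Y) -> pcone P Y.
Proof.
move=> hY [Z hZ eZ]; rewrite -(subrK Z Y); apply: pconeD => //.
apply: herm_null_pcone.
  apply/hermE => i j; have /hermE h1 := hY; have /hermE h2 := pcone_adj hZ.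
  by rewrite !mxE padjD padjN h1 h2.
move=> i j; rewrite !mxE; apply/pq_eq.
by have /matrixP/(_ i j) := eZ; rewrite !mxE.
Qed.

Lemma map_pq_herm n (Y : 'M[V]_n) : herm P Y ->
  (map_mx qadj (map_mx pq Y))^T = map_mx pq Y.
Proof.
by move=> /hermE h; apply/matrixP => i j; rewrite !mxE qadjE h.
Qed.

Lemma herm_lift n (X : 'M[pquot]_n) : (map_mx qadj X)^T = X ->
  exists2 Y : 'M[V]_n, herm P Y & map_mx pq Y = X.
Proof.
move=> hX; pose Y := \matrix_(i, j)
  ((2^-1)%:C *: (plift (X i j) + padj P (plift (X j i)))).
exists Y; first by apply/hermE => i j; rewrite !mxE padjZr padjD padjK addrC.
apply/matrixP => i j; rewrite !mxE linearZ linearD /= -qadjE !pliftK.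
have /matrixP/(_ i j) := hX; rewrite !mxE => ->.
by rewrite halfZ_double.
Qed.

Let qadjD x y : qadj (x + y) = qadj x + qadj y.
Proof. by rewrite -(pliftK x) -(pliftK y) -pqD !qadjE padjD pqD. Qed.
Let qadjZ (c : R[i]) x : qadj (c *: x) = c^*%C *: qadj x.
Proof. by rewrite -(pliftK x) -linearZ !qadjE padjZ linearZ. Qed.
Let qadjK x : qadj (qadj x) = x.
Proof. by rewrite -(pliftK x) !qadjE padjK. Qed.
Let qcone_adj n (X : 'M[pquot]_n) : qcone X -> (map_mx qadj X)^T = X.
Proof. by move=> [Y hY <-]; rewrite map_pq_herm //; exact: pcone_adj. Qed.
Let qcone0 n : qcone (0 : 'M[pquot]_n).
Proof.
exists 0; first exact: pcone0.
by apply/matrixP => i j; rewrite !mxE linear0.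
Qed.
Let qconeD n (X Y : 'M[pquot]_n) : qcone X -> qcone Y -> qcone (X + Y).
Proof.
move=> [X' hX <-] [Y' hY <-]; exists (X' + Y'); first exact: pconeD.
by apply/matrixP => i j; rewrite !mxE linearD.
Qed.
Let qcone_proper n (X : 'M[pquot]_n) : qcone X -> qcone (- X) -> X = 0.
Proof.
move=> [Y hY <-] h; have sY := pcone_adj hY.
have hNY : pcone P (- Y).
  apply: herm_qcone.
    by apply/hermE => i j; rewrite !mxE padjN; have /hermE -> := sY.
  have -> // : map_mx pq (- Y) = - map_mx pq Y.
  by apply/matrixP => i j; rewrite !mxE linearN.
apply/matrixP => i j; rewrite !mxE -[RHS](linear0 pq); apply/pq_eq.
by rewrite subr0; exact: pcone_null.
Qed.
Let qcone_compress n m (a : 'M[R[i]]_(n, m)) (X : 'M[pquot]_n) :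
  qcone X -> qcone (compress a X).
Proof.
move=> [Y hY <-]; exists (compress a Y); first exact: pcone_compress.
exact: (compress_map pq).
Qed.
Let qunit_adj : qadj (pq (punit P)) = pq (punit P).
Proof. by rewrite qadjE punit_adj. Qed.
Let pq_unit n (r : R) (Y : 'M[V]_n) : map_mx pq ((r%:C *: punit P)%:M + Y) =
   (r%:C *: pq (punit P))%:M + map_mx pq Y.
Proof. by apply/matrixP => i j; rewrite !mxE linearD linearMn linearZ. Qed.
Let qunit_order n (X : 'M[pquot]_n) : (map_mx qadj X)^T = X ->
  exists2 r : R, 0 < r & qcone ((r%:C *: pq (punit P))%:M + X).
Proof.
move=> /herm_lift [Y hY <-]; have [r r0 h] := punit_order hY; exists r => //.
by exists ((r%:C *: punit P)%:M + Y).
Qed.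
Let qunit_archimedean n (X : 'M[pquot]_n) : (map_mx qadj X)^T = X ->
  (forall r : R, 0 < r -> qcone ((r%:C *: pq (punit P))%:M + X)) -> qcone X.
Proof.
move=> /herm_lift [Y hY <-] h; exists Y => //; apply: punit_archimedean => // r r0.
apply: herm_qcone; last by rewrite pq_unit; exact: h.
apply/hermE => i j; have /hermE h1 := hY.
rewrite !mxE padjD h1 eq_sym; case: (_ == _).
  by rewrite !mulr1n padjZr punit_adj.
by rewrite !mulr0n padj0.
Qed.

HB.instance Definition _ := isOperatorSystem.Build R pquot qadjD qadjZ qadjK
  qcone_adj qcone0 qconeD qcone_proper qcone_compress qunit_adj qunit_order
  qunit_archimedean.
End QuotientModule.

(** The quotient through the properties that matter. Reflection is restricted to hermitian matrices,
    since a matrix with null entries maps to 0 even if it is not hermitian. *)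
Lemma preos_quotient {R : realType} {V : lmodType R[i]} (P : preos V) :
  exists (T : opSystemType R) (q : {linear V -> T}),
  [/\ forall y, exists x, q x = y, q (punit P) = ounit,
      forall n (X : 'M[V]_n), pcone P X -> mxpos (map_mx q X) &
      forall n (X : 'M[V]_n), herm P X -> mxpos (map_mx q X) -> pcone P X].
Proof.
exists (pquot P), (@pq _ _ P : {linear V -> pquot P}); split=> //.
- by move=> y; exists (plift y); exact: pliftK.
- by move=> n X hX; exists X.
- by move=> n X; exact: herm_qcone.
Qed.

Lemma quotient_null {R : realType} {V : lmodType R[i]} (P : preos V)
    (T : opSystemType R) (q : {linear V -> T}) x :
  (forall n (X : 'M[V]_n), pcone P X -> mxpos (map_mx q X)) -> null P x -> q x = 0.
Proof.
move=> qpos hx; have hNx := nullZ (-1) hx.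
have := @mxpos_proper R T _ _ (qpos _ _ hx).
have -> : - map_mx q (offdiag P x) = map_mx q (offdiag P (-1 *: x)).
  apply/matrixP => i j; rewrite !mxE scaleN1r padjN.
  by case: ifP => _; case: ifP => _; rewrite ?linear0 ?oppr0 ?linearN.
by move=> /(_ (qpos _ _ hNx)) /matrixP /(_ 0 1); rewrite !mxE.
Qed.

Section OperatorSystemMaps.
Context {R : realType}.
Implicit Types (S T U : opSystemType R).

Lemma mxpos_unit S n (r : R) : 0 <= r -> mxpos ((r%:C *: ounit)%:M : 'M[S]_n).
Proof. exact: (@pcone_unit R S (os_preos S)). Qed.

Lemma os_cp_comp S T U (f : {linear S -> T}) (g : {linear T -> U}) :
  os_cp f -> os_cp g -> os_cp (g \o f).
Proof.
move=> hf hg n X /hf /hg; congr mxpos.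
by apply/matrixP => i j; rewrite !mxE.
Qed.

Lemma os_cp_id S : @os_cp R S S idfun.
Proof.
by move=> n X; congr mxpos; apply/matrixP => i j; rewrite mxE.
Qed.

Lemma conjC_i (U : lmodType R[i]) (y : U) : 'i%C^*%C *: y = - ('i%C *: y).
Proof. by rewrite -scaleNr; congr (_ *: _); rewrite /= -[RHS]/(_ +i* _) oppr0. Qed.

Lemma i_neq0 : ('i%C : R[i]) != 0.
Proof. by rewrite eq_complex /= oner_eq0 andbF. Qed.

Lemma adj_compat (V W : lmodType R[i]) (a : V -> V) (b : W -> W) (f : {linear V -> W}) :
  (forall x y, a (x + y) = a x + a y) -> (forall (c : R[i]) x, a (c *: x) = c^*%C *: a x) ->
  (forall x, a (a x) = x) -> (forall x y, b (x + y) = b x + b y) ->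
  (forall (c : R[i]) x, b (c *: x) = c^*%C *: b x) -> (forall x, b (b x) = x) ->
  (forall x, a x = x -> b (f x) = f x) -> forall x, f (a x) = b (f x).
Proof.
move=> aD aZ aK bD bZ bK fherm x.
have aN y : a (- y) = - a y by rewrite -scaleN1r aZ rmorphN rmorph1 scaleN1r.
have bN y : b (- y) = - b y by rewrite -scaleN1r bZ rmorphN rmorph1 scaleN1r.
have := fherm (x + a x); rewrite aD aK addrC => /(_ erefl).
rewrite !linearD !bD => h2.
have := fherm ('i%C *: (x - a x)).
rewrite aZ conjC_i aD aN aK -scalerN opprB => /(_ erefl).
rewrite linearZ bZ conjC_i -scalerN => h1; have {}h1 := scalerI i_neq0 h1.
move: h1; rewrite linearB bD bN opprB => h1.
have h3 : b (f (a x)) + b (f (a x)) = f x + f x.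
  rewrite -[X in X + _](subrK (b (f x))) h1.
  by rewrite -addrA h2 addrACA addNr addr0.
by rewrite -(addxx_inj h3) bK.
Qed.

(** A hermitian [x] is the difference of [r e + x] and [r e], both in the cone, and cones consist of
    hermitian elements. *)
Lemma cp_adj (V W : lmodType R[i]) (P : preos V) (Q : preos W) (f : {linear V -> W}) :
  completely_positive (@pcone R V P) (@pcone R W Q) f ->
  forall x, f (padj P x) = padj Q (f x).
Proof.
move=> hf; apply: adj_compat; do ?[exact: padjD|exact: padjZ|exact: padjK].
move=> x hx; have h y : pcone P (y%:M : 'M_1) -> padj Q (f y) = f y.
  move=> /hf /pcone_adj /hermE /(_ 0 0).
  by rewrite !mxE eqxx !mulr1n.
have [r r0 hr] := punit_order (herm_scalar hx).
have h1 := h _ (pcone_unit P 1 (ltW r0)).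
rewrite -raddfD /= in hr; have := h _ hr.
by rewrite !linearD padjD h1 => /addrI.
Qed.

Lemma os_cp_adj S T (f : {linear S -> T}) : os_cp f ->
  forall x, f (adj x) = adj (f x).
Proof. by move=> hf; exact: (@cp_adj S T (os_preos S) (os_preos T)). Qed.
End OperatorSystemMaps.

(** * Essential extensions and rigidity *)

Section CompressUnit.
Context {R : realType} {V : lmodType R[i]}.

Lemma compressD n m (a : 'M[R[i]]_(n, m)) (X Y : 'M[V]_n) :
  compress a (X + Y) = compress a X + compress a Y.
Proof.
apply/matrixP => i j; rewrite !mxE -big_split; apply: eq_bigr => k _ /=.
by rewrite -big_split; apply: eq_bigr => l _ /=; rewrite mxE scalerDr.
Qed.

Lemma compressZ n m (a : 'M[R[i]]_(n, m)) (c : R[i]) (X : 'M[V]_n) :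
  compress a (map_mx (fun x => c *: x) X) = map_mx (fun x => c *: x) (compress a X).
Proof.
apply/matrixP => i j; rewrite !mxE scaler_sumr; apply: eq_bigr => k _.
rewrite scaler_sumr; apply: eq_bigr => l _.
by rewrite mxE !scalerA mulrC.
Qed.

Variable P : preos V.

Lemma herm_compress n m (a : 'M[R[i]]_(n, m)) (X : 'M[V]_n) :
  herm P X -> herm P (compress a X).
Proof.
move=> hX; have [r r0 hr] := punit_order hX.
have e : compress a X = compress a ((r%:C *: punit P)%:M + X)
    - compress a (r%:C *: punit P)%:M.
  by rewrite compressD addrAC subrr add0r.
have /hermE h1 := pcone_adj (pcone_compress a hr).
have /hermE h2 := pcone_adj (pcone_compress a (pcone_unit P n (ltW r0))).
by rewrite e; apply/hermE => i j; rewrite [X in padj P X]mxE [X in _ + X]mxE padjD padjN h1 h2 [RHS]mxE [X in _ = _ + X]mxE.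
Qed.

Lemma hermD n (X Y : 'M[V]_n) : herm P X -> herm P Y -> herm P (X + Y).
Proof. by move=> /hermE h1 /hermE h2; apply/hermE => i j; rewrite !mxE padjD h1 h2. Qed.

Lemma hermN n (X : 'M[V]_n) : herm P X -> herm P (- X).
Proof. by move=> /hermE h1; apply/hermE => i j; rewrite !mxE padjN h1. Qed.

Lemma herm_unit n (r : R) : herm P ((r%:C *: punit P)%:M : 'M_n).
Proof.
apply/hermE => i j; rewrite !mxE eq_sym; case: (_ == _).
  by rewrite mulr1n padjZr punit_adj.
by rewrite !mulr0n padj0.
Qed.

(** Lets Archimedean limits pass through compressions: [t e] dominates the compressed unit for some
    [t], so a perturbation by [r / t] before compressing costs at most [r] afterwards. *)
Lemma compress_unit_split n m (a : 'M[R[i]]_(n, m)) (r : R) : 0 < r ->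
  exists e : R, 0 < e /\ exists2 Z : 'M[V]_m, pcone P Z &
  forall X : 'M[V]_n, (r%:C *: punit P)%:M + compress a X =
    compress a ((e%:C *: punit P)%:M + X) + Z.
Proof.
move=> r0; pose U := compress a ((1%:C *: punit P)%:M : 'M[V]_n).
have hU : herm P (- U) by apply: hermN; apply: herm_compress; exact: herm_unit.
have [t t0 ht] := punit_order hU; have e0 : 0 < r / t by rewrite divr_gt0.
exists (r / t); split => //.
exists (map_mx (fun x => (r / t)%:C *: x) ((t%:C *: punit P)%:M - U)).
  by apply: pconeZ => //; exact: ltW.
move=> X; rewrite compressD addrAC; congr (_ + _).
have -> : (((r / t)%:C *: punit P)%:M : 'M_n) =
    map_mx (fun x => (r / t)%:C *: x) (1%:C *: punit P)%:M.
  by apply/matrixP => i j; rewrite !mxE scale1r scalerMnr.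
rewrite compressZ -/U; move: (U) => W; apply/matrixP => i j; rewrite !mxE.
rewrite -scalerDr [W i j + _]addrC subrK !scalerMnr scalerA -realCM.
by rewrite divfK ?lt0r_neq0.
Qed.
End CompressUnit.

Section LinearIterates.
Context {R : realType} {V : lmodType R[i]} (f : {linear V -> V}).

Lemma iter_linear k : linear (iter k f).
Proof. by elim: k => [|k ih] c x y //=; rewrite ih linearP. Qed.

Definition cesaro n x := (n.+1%:R^-1 : R)%:C *: \sum_(k < n.+1) iter k f x.

Lemma cesaro_linear n : linear (cesaro n).
Proof.
move=> c x y; rewrite /cesaro scalerA mulrC -scalerA -scalerDr; congr (_ *: _).
rewrite scaler_sumr -big_split; apply: eq_bigr => k _.
exact: iter_linear.
Qed.
HB.instance Definition _ n := GRing.isLinear.Build R[i] V V _ (cesaro n) (cesaro_linear n).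

Lemma cesaro_fix n x : f x = x -> cesaro n x = x.
Proof.
move=> fx; rewrite /cesaro (eq_bigr (fun=> x)) => [|k _].
  rewrite sumr_const card_ord -scaler_nat -(rmorph_nat (real_complex R)).
  by rewrite realZKV // pnatr_eq0.
by elim: (k : nat) => //= p ->.
Qed.

Lemma cesaro_sub n x : cesaro n (x - f x) = (n.+1%:R^-1 : R)%:C *: (x - iter n.+1 f x).
Proof.
have it k : iter k f (x - f x) = iter k f x - iter k.+1 f x.
  by elim: k => [//|k ih]; rewrite iterS ih linearB.
rewrite /cesaro; congr (_ *: _); under eq_bigr do rewrite it.
by elim: n.+1 => [|k ih]; rewrite ?big_ord0 ?subrr // big_ord_recr ih /= addrA subrK.
Qed.
End LinearIterates.

Section EssentialExtension.
Context {R : realType} {S I : opSystemType R} (iota : {linear S -> I}).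

(* A matrix ordering of I which is coarser than the given one, but which induces
   the given ordering of S. *)
Record coarser_order (Q : forall n, 'M[I]_n -> Prop) : Prop := {
  coarser_mxpos : forall n (X : 'M[I]_n), mxpos X -> Q n X;
  coarser_herm : forall n (X : 'M[I]_n), Q n X -> (map_mx adj X)^T = X;
  coarserD : forall n (X Y : 'M[I]_n), Q n X -> Q n Y -> Q n (X + Y);
  coarser_compress : forall n m (a : 'M[R[i]]_(n, m)) (X : 'M[I]_n),
    Q n X -> Q m (compress a X);
  coarser_archimedean : forall n (X : 'M[I]_n), (map_mx adj X)^T = X ->
    (forall r : R, 0 < r -> Q n ((r%:C *: ounit)%:M + X)) -> Q n X;
  coarser_reflects : forall n (X : 'M[S]_n), Q n (map_mx iota X) -> mxpos X
}.

Lemma coarser0 Q (hQ : coarser_order Q) n : Q n 0.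
Proof. by apply: (coarser_mxpos hQ); exact: mxpos0. Qed.

Lemma coarser_order_unit Q (hQ : coarser_order Q) n (X : 'M[I]_n) :
  (map_mx adj X)^T = X -> exists2 r : R, 0 < r & Q n ((r%:C *: ounit)%:M + X).
Proof.
by move=> /ounit_order [r r0 h]; exists r => //; apply: (coarser_mxpos hQ).
Qed.

Definition coarser_preos Q (hQ : coarser_order Q) : preos I :=
  @Preos R I adj Q ounit (@adjD R I) (@Defs.adjZ R I) (@adjK R I)
    (coarser_herm hQ) (coarser0 hQ) (coarserD hQ) (coarser_compress hQ)
    (@ounit_adj R I) (coarser_order_unit hQ) (coarser_archimedean hQ).

(** If [f x = 0] then [f] sends both [offdiag x] and [offdiag (- x)] to 0, so both are positive and
    properness gives [x = 0]. *)
Lemma os_reflects_inj (T T' : opSystemType R) (f : {linear T -> T'}) : os_cp f ->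
  (forall n (X : 'M[T]_n), (map_mx adj X)^T = X -> mxpos (map_mx f X) -> mxpos X) ->
  injective f.
Proof.
move=> hf hr; apply: raddf_inj => x fx0.
have p (s : R[i]) : mxpos (offdiag (os_preos T) (s *: x)).
  apply: hr; first exact: (@herm_offdiag R T (os_preos T)).
  rewrite (_ : map_mx _ _ = 0); first exact: mxpos0.
  have adj0 : adj (0 : T') = 0 := @padj0 R T' (os_preos T').
  apply/matrixP => i j; rewrite !mxE.
  by case: ifP => _; case: ifP => _;
    rewrite ?linear0 ?(os_cp_adj hf) ?linearZ /= ?fx0 ?scaler0 ?adj0.
have := @mxpos_proper R T _ _ (p 1).
have -> : - offdiag (os_preos T) (1 *: x) = offdiag (os_preos T) (-1 *: x).
  apply/matrixP => i j; rewrite !mxE scaleN1r scale1r padjN.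
  by case: ifP => _; case: ifP => _; rewrite ?oppr0.
move=> /(_ (p (-1))) /matrixP /(_ 0 1).
by rewrite !mxE /= scale1r.
Qed.

Lemma os_embedding_herm (T T' : opSystemType R) (f : {linear T -> T'}) : os_cp f ->
  (forall n (X : 'M[T]_n), (map_mx adj X)^T = X -> mxpos (map_mx f X) -> mxpos X) ->
  f ounit = ounit -> os_embedding f.
Proof.
move=> hf hr f1; have f_inj := os_reflects_inj hf hr; split => //; split => // n X h.
apply: hr => //; apply/matrixP => i j; apply: f_inj.
rewrite !mxE (os_cp_adj hf).
by have /matrixP/(_ i j) := mxpos_adj _ _ h; rewrite !mxE.
Qed.

Lemma herm_linear_ext (V W : lmodType R[i]) (P : preos V) (f g : {linear V -> W}) :
  (forall x, padj P x = x -> f x = g x) -> f =1 g.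
Proof.
move=> h x; have h1 : f (x + padj P x) = g (x + padj P x).
  by apply: h; rewrite padjD padjK addrC.
have h2 := h ('i%C *: (x - padj P x)).
rewrite padjZ conjC_i padjD padjN padjK -scalerN opprB in h2.
have {h2}/(scalerI i_neq0) h2 : 'i%C *: f (x - padj P x) = 'i%C *: g (x - padj P x).
  by rewrite -!linearZ; exact: h2.
apply: addxx_inj.
have e : x + x = (x - padj P x) + (x + padj P x).
  by rewrite [x + padj P x]addrC addrA subrK.
rewrite -(raddfD f) -(raddfD g) e (raddfD f) (raddfD g).
by congr (_ + _); [exact: h2 | exact: h1].
Qed.

Hypotheses (iota_emb : os_embedding iota).

Let iota_refl n (X : 'M[S]_n) : mxpos (map_mx iota X) -> mxpos X.
Proof. by case: iota_emb => -[_ _ h] _; exact: h. Qed.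
Let iota1 : iota ounit = ounit. Proof. by case: iota_emb. Qed.

Definition fixes_S (g : {linear I -> I}) := forall x, g (iota x) = iota x.

Lemma fixes_unit g : fixes_S g -> g ounit = ounit.
Proof. by move=> h; rewrite -iota1 h. Qed.

Lemma fixes_unitD g (r : R) x : fixes_S g ->
  g (r%:C *: ounit + x) = r%:C *: ounit + g x.
Proof. by move=> h; rewrite linearD linearZ fixes_unit. Qed.

Definition cone_of (g : {linear I -> I}) n (X : 'M[I]_n) :=
  (map_mx adj X)^T = X /\ mxpos (map_mx g X).

Lemma coarser_cone_of g : os_cp g -> fixes_S g -> coarser_order (cone_of g).
Proof.
move=> hg gS; split.
- by move=> n X hX; split; [exact: mxpos_adj | exact: hg].
- by move=> n X [].
- move=> n X Y [h1 h2] [h3 h4]; split; first exact: (@hermD R I (os_preos I)).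
  have -> : map_mx g (X + Y) = map_mx g X + map_mx g Y.
    by apply/matrixP => i j; rewrite !mxE linearD.
  exact: mxposD.
- move=> n m a X [h1 h2]; split; first exact: (@herm_compress R I (os_preos I)).
  by rewrite compress_map; exact: mxpos_compress.
- move=> n X hX h; split => //; apply: ounit_archimedean.
    have /(@hermE R I (os_preos I)) hX' := hX.
    apply/(@hermE R I (os_preos I)) => i j /=.
    by rewrite !mxE -(os_cp_adj hg); congr (g _); exact: hX'.
  move=> r /h [_]; have -> // : map_mx g ((r%:C *: ounit)%:M + X) =
    (r%:C *: ounit)%:M + map_mx g X.
  by apply/matrixP => i j; rewrite !mxE linearD linearMn linearZ /= fixes_unit.
- move=> n X [_]; have -> : map_mx g (map_mx iota X) = map_mx iota X.
    by apply/matrixP => i j; rewrite !mxE gS.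
  exact: iota_refl.
Qed.

Lemma os_cp_cesaro g n : os_cp g -> @os_cp R I I (cesaro g n).
Proof.
move=> hg p X hX.
have hk k : mxpos (map_mx (iter k g) X).
  elim: k => [|k ih]; first by rewrite (_ : map_mx _ _ = X) //; apply/matrixP => i j; rewrite mxE.
  have := hg _ _ ih; congr mxpos; by apply/matrixP => i j; rewrite !mxE.
have := @pconeZ R I (os_preos I) p (n.+1%:R^-1) (\sum_(k < n.+1) map_mx (iter k g) X).
rewrite invr_ge0 ler0n => /(_ isT) h.
have -> : map_mx (cesaro g n) X =
  map_mx (fun x => (n.+1%:R^-1 : R)%:C *: x) (\sum_(k < n.+1) map_mx (iter k g) X).
  apply/matrixP => i j; rewrite !mxE summxE; congr (_ *: _).
  by apply: eq_bigr => k _; rewrite mxE.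
by apply: h; apply: (@pcone_sum R I (os_preos I)) => k _; exact: hk.
Qed.

(* Cesaro means of the powers of [g] send [x - g x] close to 0. *)
Lemma almost_positive g x (r : R) : os_cp g -> fixes_S g -> adj x = x -> 0 < r ->
  exists g' : {linear I -> I}, [/\ os_cp g', fixes_S g' &
    mxpos ((r%:C *: ounit + g' (x - g x))%:M : 'M_1)].
Proof.
move=> hg gS hx r0.
have [t t0 h1] := @ounit_order R I _ _ (@herm_scalar R I (os_preos I) x hx).
have [t' t'0 h2] := @ounit_order R I _ _ (@herm_scalar R I (os_preos I) (- x)
   (etrans (@padjN R I (os_preos I) x) (congr1 _ hx))).
rewrite -!raddfD /= in h1 h2.
(* The mean equals [(x - g^(n+1) x) / (n+1)], which is at least [- (t + t') / (n+1)]; this [n] makes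
   the bound at least [- r]. *)
pose n := Num.truncn ((t + t') / r).
exists (cesaro g n); split; first exact: os_cp_cesaro.
  by move=> y; apply: cesaro_fix; exact: gS.
rewrite /= cesaro_sub.
have h3 : mxpos ((t'%:C *: ounit - iter n.+1 g x)%:M : 'M_1).
  elim: n.+1 => [//|k ih]; have := hg _ _ ih; congr mxpos.
  apply/matrixP => i j; rewrite !mxE linearMn linearB linearZ /= fixes_unit //.
have h4 := @mxposD R I _ _ _ h1 h3; rewrite -raddfD /= in h4.
have n0 : 0 <= n.+1%:R^-1 :> R by rewrite invr_ge0.
have := @pconeZ R I (os_preos I) 1 (n.+1%:R^-1) _ n0 h4.
have k0 : 0 <= r - n.+1%:R^-1 * (t + t').
  rewrite subr_ge0 mulrC ler_pdivrMr ?ltr0n // mulrC -ler_pdivrMr //.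
  by rewrite ltW // truncnS_gt.
move=> h5; have := @mxposD R I _ _ _ (mxpos_unit I 1 k0) h5; congr mxpos.
apply/matrixP => i j; rewrite !mxE !ord1 eqxx !mulr1n addrACA -scalerDl -realCD.
rewrite scalerDr scalerA -realCM addrA -scalerDl -realCD subrK.
by [].
Qed.

End EssentialExtension.

Section ChainUnion.
Context {R : realType} {S I : opSystemType R} (iota : {linear S -> I}).
Hypothesis iota_emb : os_embedding iota.
Variable C : set (forall n, 'M[I]_n -> Prop).
Hypothesis C_coarser : forall Q, C Q -> coarser_order iota Q.
Hypothesis C_chain : forall Q Q', C Q -> C Q' ->
  (forall n X, Q n X -> Q' n X) \/ (forall n X, Q' n X -> Q n X).
Variable Q0 : forall n, 'M[I]_n -> Prop.
Hypothesis CQ0 : C Q0.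

(** The union of a chain of orderings need not be Archimedean, so it is replaced by its Archimedean
    closure. Reflection on S survives because S is Archimedean. *)
Definition chain_closure n (X : 'M[I]_n) := (map_mx adj X)^T = X /\
  forall r : R, 0 < r -> exists2 Q, C Q & Q n ((r%:C *: ounit)%:M + X).

Lemma half_unit n (r : R) (X : 'M[I]_n) : (r%:C *: ounit)%:M + X =
  ((r / 2)%:C *: ounit)%:M + (((r / 2)%:C *: ounit)%:M + X).
Proof. by rewrite addrA -raddfD -scalerDl -realCD -splitr. Qed.

Lemma sub_chain_closure Q n (X : 'M[I]_n) : C Q -> Q n X -> chain_closure X.
Proof.
move=> CQ hX; split; first exact: (coarser_herm (C_coarser CQ)).
move=> r r0; exists Q => //; apply: (coarserD (C_coarser CQ)) => //.
by apply: (coarser_mxpos (C_coarser CQ)); apply: mxpos_unit; exact: ltW.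
Qed.

Lemma chain_closure_coarser : coarser_order iota chain_closure.
Proof.
have [[iota_inj iota_cp iota_refl] iota1] := iota_emb.
split.
- move=> n X hX; apply: (sub_chain_closure CQ0).
  exact: (coarser_mxpos (C_coarser CQ0)).
- by move=> n X [].
- move=> n X Y [hX h1] [hY h2]; split; first exact: (@hermD R I (os_preos I)).
  move=> r r0; have r2 : 0 < r / 2 by rewrite divr_gt0.
  have [Q CQ hQ] := h1 _ r2; have [Q' CQ' hQ'] := h2 _ r2.
  have -> : (r%:C *: ounit)%:M + (X + Y) =
      (((r / 2)%:C *: ounit)%:M + X) + (((r / 2)%:C *: ounit)%:M + Y).
    by rewrite half_unit addrACA -addrA.
  have [sub|sub] := C_chain CQ CQ'.
    by exists Q' => //; apply: (coarserD (C_coarser CQ')) => //; exact: sub.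
  by exists Q => //; apply: (coarserD (C_coarser CQ)) => //; exact: sub.
- move=> n m a X [hX h]; split; first exact: (@herm_compress R I (os_preos I)).
  move=> r r0; have [e [e0 [Z hZ eZ]]] := compress_unit_split (os_preos I) a r0.
  have [Q CQ hQ] := h _ e0; exists Q => //.
  rewrite [X in Q _ X]eZ; apply: (coarserD (C_coarser CQ)).
    exact: (coarser_compress (C_coarser CQ)).
  exact: (coarser_mxpos (C_coarser CQ)).
- move=> n X hX h; split => // r r0; have r2 : 0 < r / 2 by rewrite divr_gt0.
  have [_ /(_ _ r2) [Q CQ hQ]] := h _ r2; exists Q => //.
  by rewrite half_unit.
- move=> n X [hX h]; apply: ounit_archimedean.
    apply/matrixP => i j; apply: iota_inj.
    by rewrite !mxE (os_cp_adj iota_cp); have /matrixP/(_ i j) := hX; rewrite !mxE.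
  move=> r /h [Q CQ hQ]; apply: (coarser_reflects (C_coarser CQ)).
  have -> // : map_mx iota ((r%:C *: ounit)%:M + X) =
    (r%:C *: ounit)%:M + map_mx iota X.
  by apply/matrixP => i j; rewrite !mxE linearD linearMn linearZ /= iota1.
Qed.
End ChainUnion.

Section Rigidity.
Context {R : realType} {S I : opSystemType R} (iota : {linear S -> I}).
Hypothesis iota_emb : os_embedding iota.

Lemma maximal_coarser Q0 : coarser_order iota Q0 -> exists Q,
  [/\ coarser_order iota Q, forall n X, Q0 n X -> Q n X &
   forall Q', coarser_order iota Q' -> (forall n X, Q n X -> Q' n X) ->
     forall n X, Q' n X -> Q n X].
Proof.
move=> h0; pose T := {Q : forall n, 'M[I]_n -> Prop |
  coarser_order iota Q /\ forall n X, Q0 n X -> Q n X}.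
pose le (s t : T) := `[< forall n X, sval s n X -> sval t n X >].
pose t0 : T := exist _ Q0 (conj h0 (fun n X h => h)).
have le_refl t : le t t by apply/asboolP.
have le_trans r s t : le r s -> le s t -> le r t.
  by move=> /asboolP h1 /asboolP h2; apply/asboolP => n X /h1 /h2.
have le_chain C : total_on C le -> exists t, forall s, C s -> le s t.
  (* The empty chain is bounded by [Q0] itself; [chain_closure] needs a member. *)
  move=> totC; have [[c0 Cc0]|C0] := pselect (exists c, C c); last first.
    by exists t0 => s Cs; case: C0; exists s.
  pose C' : set (forall n, 'M[I]_n -> Prop) := [set sval s | s in C].
  have hC' : forall Q, C' Q -> coarser_order iota Q.
    by move=> _ [s _ <-]; case: (svalP s).
  have chC' Q Q' : C' Q -> C' Q' ->
      (forall n X, Q n X -> Q' n X) \/ (forall n X, Q' n X -> Q n X).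
    move=> [s Cs <-] [t Ct <-]; have [/asboolP h|/asboolP h] := totC _ _ Cs Ct.
      by left; exact: h.
    by right; exact: h.
  have Cc : C' (sval c0) by exists c0.
  have hsub n X : Q0 n X -> chain_closure C' X.
    move=> /(proj2 (svalP c0)); exact: (sub_chain_closure hC').
  exists (exist _ (@chain_closure R I C')
    (conj (chain_closure_coarser iota_emb hC' chC' Cc) hsub)).
  move=> s Cs; apply/asboolP => n X /=; apply: (sub_chain_closure hC').
  by exists s.
have [t ht] := ZL_preorder t0 le_refl le_trans le_chain.
have [hQ hQ0] := svalP t; exists (sval t); split => // Q' hQ' sub.
pose t' : T := exist _ Q' (conj hQ' (fun n X h => sub n X (hQ0 n X h))).
by have /ht/asboolP : le t t' by apply/asboolP.
Qed.

Hypothesis I_inj : injective_os I.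
Hypothesis I_min : forall (Q : opSystemType R) (j : {linear Q -> I}),
  os_embedding j -> range iota `<=` range j -> injective_os Q -> range j = setT.

Lemma pos_sub_eq0 (T : opSystemType R) (x : T) : adj x = x ->
  (forall r : R, 0 < r -> mxpos ((r%:C *: ounit + x)%:M : 'M_1)) ->
  (forall r : R, 0 < r -> mxpos ((r%:C *: ounit - x)%:M : 'M_1)) -> x = 0.
Proof.
move=> hx h1 h2.
have p (y : T) : adj y = y -> (forall r : R, 0 < r -> mxpos ((r%:C *: ounit + y)%:M : 'M_1)) ->
    mxpos (y%:M : 'M_1).
  move=> hy h; apply: ounit_archimedean; first exact: (@herm_scalar R T (os_preos T) y hy).
  by move=> r /h; rewrite raddfD.
have p1 := p _ hx h1; have p2 : mxpos (- (x%:M) : 'M_1).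
  rewrite -raddfN; apply: p => //.
  by rewrite [adj (- x)](@padjN R T (os_preos T)) /= hx.
have := @mxpos_proper R T _ _ p1 p2.
by move/matrixP/(_ 0 0); rewrite !mxE eqxx mulr1n.
Qed.

(* Take [Q] maximal with quotient operator system [q : I -> T] and extend [iota] along
   [q \o iota] to [f : T -> I].  By maximality [X] lies in [Q] as soon as its image
   under [phi = f \o q] is positive; hence [phi] is idempotent and [f] embeds the
   injective [T] in [I], so that [f] is onto because [I] is an envelope. *)
Lemma coarser_order_trivial Q0 : coarser_order iota Q0 ->
  forall n (X : 'M[I]_n), Q0 n X -> mxpos X.
Proof.
have [[iota_inj iota_cp iota_refl] iota1] := iota_emb.
move=> /maximal_coarser [Q [hQ Q0Q maxQ]].
have [T [q [qsurj q1 qpos qrefl]]] := preos_quotient (coarser_preos hQ).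
have qcp : os_cp q by move=> n X /(coarser_mxpos hQ); exact: qpos.
have qi_emb : os_embedding (q \o iota).
  apply: os_embedding_herm; first exact: os_cp_comp.
    move=> n X hX h; apply: (coarser_reflects hQ); apply: qrefl.
      apply/matrixP => i j; rewrite !mxE /= -(os_cp_adj iota_cp).
      by move/matrixP/(_ i j): hX; rewrite !mxE => ->.
    by move: h; congr mxpos; apply/matrixP => i j; rewrite !mxE.
  by rewrite /= iota1 q1.
have [f fcp fq] := I_inj qi_emb iota_cp.
pose phi : {linear I -> I} := f \o q.
have phi_cp : os_cp phi by exact: os_cp_comp.
have phiS : fixes_S iota phi by move=> x; exact: fq.
have Qphi n (X : 'M[I]_n) : Q n X -> cone_of phi X.
  move=> hX; split; first exact: (coarser_herm hQ).
  have := fcp _ _ (qpos _ _ hX); congr mxpos.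
  by apply/matrixP => i j; rewrite !mxE.
(* The ordering pulled back along [g \o phi] contains [Q], hence equals it by maximality. The extra
   map [g] makes room for Cesaro means. *)
have phiQ g n (X : 'M[I]_n) : os_cp g -> fixes_S iota g -> (map_mx adj X)^T = X ->
    mxpos (map_mx (g \o phi) X) -> Q n X.
  move=> gcp gS hX h.
  have gcp' : os_cp (g \o phi) by exact: os_cp_comp.
  have gS' : fixes_S iota (g \o phi) by move=> x /=; rewrite -[f (q _)]/(phi _) phiS gS.
  apply: (maxQ _ (coarser_cone_of iota_emb gcp' gS')) => //.
  move=> m Y /Qphi [hY hm]; split=> //; have := gcp _ _ hm; congr mxpos.
  by apply/matrixP => i j; rewrite !mxE.
have phiphi : phi \o phi =1 phi.
  apply: (@herm_linear_ext R I I (os_preos I) (phi \o phi) phi) => x /= hx.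
  have hpx : adj (phi x) = phi x by rewrite -(os_cp_adj phi_cp) hx.
  (* [almost_positive] at [phi y] makes [g (phi (r + y - phi y))] positive; by [phiQ] the argument
     lies in [Q], so [phi] alone already maps it to a positive element. Using [y] and [- y] gives
     equality. *)
  have key y : adj y = y -> forall r : R, 0 < r ->
      mxpos ((r%:C *: ounit + phi (y - phi y))%:M : 'M_1).
    move=> hy r r0; have hpy : adj (phi y) = phi y by rewrite -(os_cp_adj phi_cp) hy.
    have [g [gcp gS gpos]] := almost_positive iota_emb phi_cp phiS hpy r0.
    have hz : adj (r%:C *: ounit + (y - phi y)) = r%:C *: ounit + (y - phi y).
      rewrite !adjD [adj (- _)](@padjN R I (os_preos I)) /= hy hpy.
      by rewrite [adj (_ *: _)](@padjZr R I (os_preos I)) /= ounit_adj.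
    have /Qphi [_] : Q 1%N (r%:C *: ounit + (y - phi y))%:M.
      apply: (phiQ g) => //; first exact: (@herm_scalar R I (os_preos I) _ hz).
      move: gpos; congr mxpos; apply/matrixP => i j; rewrite !ord1 !mxE eqxx !mulr1n.
      rewrite -[RHS]/(g (phi (r%:C *: ounit + (y - phi y)))).
      by rewrite !(fixes_unitD iota_emb) // (linearB phi).
    congr mxpos; apply/matrixP => i j; rewrite !ord1 !mxE eqxx !mulr1n.
    by rewrite (fixes_unitD iota_emb).
  have h0 : phi (x - phi x) = 0.
    apply: pos_sub_eq0.
    - by rewrite -(os_cp_adj phi_cp) adjD [adj (- _)](@padjN R I (os_preos I)) /= hx hpx.
    - exact: key.
    - have hNx : adj (- x) = - x by rewrite [LHS](@padjN R I (os_preos I)) /= hx.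
      have e : phi (- x - phi (- x)) = - phi (x - phi x).
        by rewrite (linearN phi x) opprK -(linearN phi) opprB addrC.
      by move=> r /(key _ hNx); rewrite e.
  by apply/esym/eqP; rewrite -subr_eq0 -h0 (linearB phi).
have finj : injective f.
  apply: raddf_inj => y; have [x <-] := qsurj y => fqx.
  have px (s : R[i]) : phi (s *: x) = 0 by rewrite linearZ /= fqx scaler0.
  have e (s : R[i]) : Q 2%N (offdiag (os_preos I) (s *: x)).
    apply: (phiQ idfun) => //; first exact: os_cp_id.
      exact: (@herm_offdiag R I (os_preos I)).
    rewrite (_ : map_mx _ _ = 0); first exact: mxpos0.
    have adj0 : adj (0 : I) = 0 := @padj0 R I (os_preos I).
    apply/matrixP => i j; rewrite !mxE -[LHS]/(phi _).
    by case: ifP => _; case: ifP => _;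
      rewrite ?(linear0 phi) ?(os_cp_adj phi_cp) ?px ?adj0.
  have := @mxpos_proper R T _ _ (qpos _ _ (e 1)) .
  have -> : - map_mx q (offdiag (os_preos I) (1 *: x)) =
      map_mx q (offdiag (os_preos I) (-1 *: x)).
    apply/matrixP => i j; rewrite !mxE scaleN1r scale1r padjN.
    by case: ifP => _; case: ifP => _; rewrite ?linear0 ?oppr0 ?linearN.
  move=> /(_ (qpos _ _ (e (-1)))) /matrixP /(_ 0 1).
  by rewrite !mxE /= scale1r.
have qf y : q (f y) = y.
  have [x <-] := qsurj y; apply: finj; exact: phiphi.
have f_emb : os_embedding f.
  split; last by rewrite -q1 -(fixes_unit iota_emb phiS).
  split => // n Y /qcp; congr mxpos.
  by apply/matrixP => i j; rewrite !mxE qf.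
(* [T] is a retract of I: extend into I, then come back by [q]. *)
have T_inj : injective_os T.
  move=> S1 S2 j hj h hcp.
  have hcp' : os_cp (f \o h) by exact: os_cp_comp.
  have [g gcp ge] := I_inj hj hcp'.
  exists (q \o g); first exact: os_cp_comp.
  by move=> x /=; rewrite ge /= qf.
have fsurj : range f = setT.
  apply: I_min f_emb _ T_inj => _ [x _ <-].
  by exists (q (iota x)) => //; exact: fq.
move=> n X /Q0Q /Qphi [_]; congr mxpos; apply/matrixP => i j; rewrite mxE.
have [y _ <-] : range f (X i j) by rewrite fsurj.
by rewrite /= qf.
Qed.

(** By [almost_positive], [r + x - g x] is positive after some [g'] that fixes S. Pulling back along
    [g'] is a coarser ordering, so by essentiality this element is truly positive; the same holds
    for [- x]. *)
Lemma rigid (g : {linear I -> I}) : os_cp g -> fixes_S iota g -> g =1 id.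
Proof.
move=> gcp gS.
apply: (@herm_linear_ext R I I (os_preos I) g idfun) => x /= hx.
have hgx : adj (g x) = g x by rewrite -(os_cp_adj gcp) hx.
have key y : adj y = y -> adj (g y) = g y -> forall r : R, 0 < r ->
    mxpos ((r%:C *: ounit + (y - g y))%:M : 'M_1).
  move=> hy hgy r r0.
  have [g' [gcp' gS' gpos]] := almost_positive iota_emb gcp gS hy r0.
  apply: (coarser_order_trivial (coarser_cone_of iota_emb gcp' gS')).
  split.
    refine (@herm_scalar R I (os_preos I) _ _).
    rewrite /= !adjD [adj (- _)](@padjN R I (os_preos I)) /= hy hgy.
    by rewrite [adj (_ *: _)](@padjZr R I (os_preos I)) /= ounit_adj.
  move: gpos; congr mxpos; apply/matrixP => i j; rewrite !ord1 !mxE eqxx !mulr1n.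
  by rewrite (fixes_unitD iota_emb).
apply/esym/eqP; rewrite -subr_eq0; apply/eqP; apply: pos_sub_eq0.
- by rewrite adjD [adj (- _)](@padjN R I (os_preos I)) /= hx hgx.
- exact: key.
- have adjN (y : I) : adj (- y) = - adj y by exact: (@padjN R I (os_preos I)).
  have -> : - (x - g x) = - x - g (- x) by rewrite linearN opprK opprB addrC.
  by apply: key; rewrite ?linearN adjN ?hx ?hgx.
Qed.
End Rigidity.

(** * Representations of operator systems *)

Import Normc.

Section RealCompleteness.
Context {R : realType}.

(** The limit is the supremum of the numbers that are eventually lower bounds. *)
Lemma real_complete (u : nat -> R) :
  (forall e : R, 0 < e -> exists N, forall m n, (N <= m)%N -> (N <= n)%N ->
     `|u m - u n| < e) ->
  exists x, forall e : R, 0 < e -> exists N, forall n, (N <= n)%N -> `|u n - x| < e.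
Proof.
move=> hu; pose L := [set y | exists N, forall n, (N <= n)%N -> y <= u n].
have hsup : has_sup L.
  have [N hN] := hu _ ltr01; split.
    exists (u N - 1), N => n Nn; have := hN N n (leqnn N) Nn.
    by rewrite ltr_norml; lra.
  exists (u N + 1) => y [M hM]; have := hM _ (leq_maxr N M).
  have := hN N (maxn N M) (leqnn N) (leq_maxl N M).
  by rewrite ltr_norml; lra.
exists (sup L) => e e0; have e2 : 0 < e / 2 by rewrite divr_gt0.
have [N hN] := hu _ e2; exists N => n Nn.
have h1 : u n - e / 2 <= sup L.
  apply: sup_upper_bound => //; exists N => m Nm.
  by have := hN n m Nn Nm; rewrite ltr_norml; lra.
have h2 : sup L <= u n + e / 2.
  apply: ge_sup => [|y [M hM]]; first by case: hsup.
  have := hM _ (leq_maxr n M).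
  have := hN n (maxn n M) Nn (leq_trans Nn (leq_maxl n M)).
  by rewrite ltr_norml; lra.
by rewrite ltr_norml; lra.
Qed.
End RealCompleteness.

Definition ccomplex (R : realType) : Type := R[i].

Section ComplexCStar.
Context {R : realType}.
Local Notation C := (ccomplex R).

HB.instance Definition _ := GRing.Algebra.copy C (R[i]^o).

Let cstar (z : C) : C := (z : R[i])^*%C.
Let cnrm (z : C) : R := normc (z : R[i]).

Let cstarD x y : cstar (x + y) = cstar x + cstar y. Proof. exact: rmorphD. Qed.
Let cstarZ (c : R[i]) x : cstar (c *: x) = c^*%C *: cstar x. Proof. exact: rmorphM. Qed.
Let cstarM x y : cstar (x * y) = cstar y * cstar x.
Proof. by rewrite mulrC; exact: rmorphM. Qed.
Let cstarK x : cstar (cstar x) = x. Proof. exact: conjcK. Qed.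
Let cnrm_eq0 x : cnrm x = 0 -> x = 0. Proof. exact: eq0_normc. Qed.
Let cnrmD x y : cnrm (x + y) <= cnrm x + cnrm y.
Proof.
have := ler_normD (x : R[i]) y.
by rewrite -lecR realCD.
Qed.
Let cnrmM x y : cnrm (x * y) = cnrm x * cnrm y.
Proof. exact: normcM. Qed.
Let cnrmZ (c : R[i]) x : (cnrm (c *: x))%:C = `|c| * (cnrm x)%:C.
Proof. by rewrite [cnrm _]cnrmM realCM. Qed.
Let cnrm_cstar x : cnrm (cstar x * x) = cnrm x ^+ 2.
Proof.
rewrite cnrmM expr2; congr (_ * _); case: x => a b.
by rewrite /cnrm /cstar /= sqrrN.
Qed.
Let cnrm_complete (u : nat -> C) :
  (forall e : R, 0 < e -> exists N, forall m n, (N <= m)%N -> (N <= n)%N ->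
    cnrm (u m - u n) < e) ->
  exists x, forall e : R, 0 < e -> exists N, forall n, (N <= n)%N ->
    cnrm (u n - x) < e.
Proof.
have re_le (z : R[i]) : `|complex.Re z| <= normc z.
  case: z => a b /=; rewrite -sqrtr_sqr ler_wsqrtr // lerDl sqr_ge0.
by [].
have im_le (z : R[i]) : `|complex.Im z| <= normc z.
  by case: z => a b /=; rewrite -sqrtr_sqr ler_wsqrtr // lerDr sqr_ge0.
have le_sum (z : R[i]) : normc z <= `|complex.Re z| + `|complex.Im z|.
  case: z => a b /=; rewrite -[leRHS]ger0_norm ?addr_ge0 // -sqrtr_sqr ler_wsqrtr //.
  rewrite sqrrD !real_normK ?num_real // addrAC lerDl mulrn_wge0 ?mulr_ge0 //.
have reB (z w : R[i]) : complex.Re (z - w) = complex.Re z - complex.Re w.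
  by case: z; case: w.
have imB (z w : R[i]) : complex.Im (z - w) = complex.Im z - complex.Im w.
  by case: z; case: w.
move=> hu; have [|a ha] := @real_complete R (fun n => complex.Re (u n : R[i])).
  move=> e /hu [N hN]; exists N => m n Nm Nn.
  by rewrite (le_lt_trans _ (hN m n Nm Nn)) // -reB; exact: re_le.
have [|b hb] := @real_complete R (fun n => complex.Im (u n : R[i])).
  move=> e /hu [N hN]; exists N => m n Nm Nn.
  by rewrite (le_lt_trans _ (hN m n Nm Nn)) // -imB; exact: im_le.
exists (a +i* b : R[i]) => e e0; have e2 : 0 < e / 2 by rewrite divr_gt0.
have [N hN] := ha _ e2; have [M hM] := hb _ e2.
exists (maxn N M) => n; rewrite geq_max => /andP[/hN h1 /hM h2].
rewrite (le_lt_trans (le_sum _)) // reB imB [ltRHS]splitr.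
by rewrite ltrD.
Qed.
HB.instance Definition _ := isCStarAlgebra.Build R C cstarD cstarZ cstarM cstarK
  cnrm_eq0 cnrmD cnrmZ (fun x y => eq_ind_r (fun t => t <= _) (lexx _) (cnrmM x y))
  cnrm_complete cnrm_cstar.
End ComplexCStar.

(** [cindex0] makes the family nonempty, as the product must satisfy [1 != 0]. *)
Record cfamily (R : realType) := CFamily {
  cindex : Type;
  cindex0 : cindex;
  cmember :> cindex -> cstarAlgType R
}.

Record bounded_family (R : realType) (F : cfamily R) : Type := BoundedFamily {
  bcoord :> forall k, F k;
  bcoord_bounded : exists M : R, forall k, cnorm (bcoord k) <= M
}.

Section ProductCStar.
Context {R : realType} (F : cfamily R).
Local Notation B := (bounded_family F).
Implicit Types (x y z : B).

Lemma bfam_ext x y : (forall k, x k = y k) -> x = y.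
Proof.
case: x y => [x hx] [y hy] /= h.
have e : x = y by apply: functional_extensionality_dep.
by rewrite {}e in hx *; congr BoundedFamily; exact: Prop_irrelevance.
Qed.

HB.instance Definition _ := gen_eqMixin B.
HB.instance Definition _ := gen_choiceMixin B.

Let badd x y : B.
Proof.
exists (fun k => x k + y k).
have [M hM] := bcoord_bounded x; have [N hN] := bcoord_bounded y.
by exists (M + N) => k; rewrite (le_trans (cnormD _ _)) // lerD.
Defined.
Let bopp x : B.
Proof.
exists (fun k => - x k).
by have [M hM] := bcoord_bounded x; exists M => k; rewrite cnormN.
Defined.
Let bzero : B.
Proof. by exists (fun k => 0); exists 0 => k; rewrite cnorm0. Defined.
Let bone : B.
Proof. by exists (fun k => 1); exists 1 => k; rewrite cnorm1. Defined.
Let bmul x y : B.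
Proof.
exists (fun k => x k * y k).
have [M hM] := bcoord_bounded x; have [N hN] := bcoord_bounded y.
by exists (M * N) => k; rewrite (le_trans (cnormM _ _)) // ler_pM ?cnorm_ge0.
Defined.
Let bscale (c : R[i]) x : B.
Proof.
exists (fun k => c *: x k).
have [M hM] := bcoord_bounded x; exists (normc c * M) => k.
by rewrite -lecR cnormZ realCM ler_wpM2l ?normr_ge0 // lecR.
Defined.
Let bstar x : B.
Proof.
exists (fun k => star (x k)).
by have [M hM] := bcoord_bounded x; exists M => k; rewrite cnorm_star.
Defined.

Let baddA : associative badd. Proof. by move=> x y z; apply: bfam_ext => k /=; rewrite addrA. Qed.
Let baddC : commutative badd. Proof. by move=> x y; apply: bfam_ext => k /=; rewrite addrC. Qed.
Let badd0 : left_id bzero badd. Proof. by move=> x; apply: bfam_ext => k /=; rewrite add0r. Qed.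
Let baddN : left_inverse bzero bopp badd.
Proof. by move=> x; apply: bfam_ext => k /=; rewrite addNr. Qed.
HB.instance Definition _ := GRing.isZmodule.Build B baddA baddC badd0 baddN.

Let bmulA : associative bmul. Proof. by move=> x y z; apply: bfam_ext => k /=; rewrite mulrA. Qed.
Let bmul1 : left_id bone bmul. Proof. by move=> x; apply: bfam_ext => k /=; rewrite mul1r. Qed.
Let bmulr1 : right_id bone bmul. Proof. by move=> x; apply: bfam_ext => k /=; rewrite mulr1. Qed.
Let bmulDl : left_distributive bmul badd.
Proof. by move=> x y z; apply: bfam_ext => k /=; rewrite mulrDl. Qed.
Let bmulDr : right_distributive bmul badd.
Proof. by move=> x y z; apply: bfam_ext => k /=; rewrite mulrDr. Qed.
Let bone_neq0 : bone != bzero.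
Proof.
apply/eqP => /(congr1 (fun x : B => x (cindex0 F))) /= /eqP.
by rewrite oner_eq0.
Qed.
HB.instance Definition _ := GRing.Zmodule_isNzRing.Build B bmulA bmul1 bmulr1
  bmulDl bmulDr bone_neq0.

Let bscaleA c d x : bscale c (bscale d x) = bscale (c * d) x.
Proof. by apply: bfam_ext => k /=; rewrite scalerA. Qed.
Let bscale1 : left_id 1 bscale.
Proof. by move=> x; apply: bfam_ext => k /=; rewrite scale1r. Qed.
Let bscaleDr : right_distributive bscale +%R.
Proof. by move=> c x y; apply: bfam_ext => k /=; rewrite scalerDr. Qed.
Let bscaleDl x : {morph bscale^~ x : a b / a + b}.
Proof. by move=> a b; apply: bfam_ext => k /=; rewrite scalerDl. Qed.
HB.instance Definition _ := GRing.Zmodule_isLmodule.Build R[i] B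
  bscaleA bscale1 bscaleDr bscaleDl.
Let bscaleAl (c : R[i]) x y : c *: (x * y) = (c *: x) * y.
Proof. by apply: bfam_ext => k /=; rewrite scalerAl. Qed.
HB.instance Definition _ := GRing.Lmodule_isLalgebra.Build R[i] B bscaleAl.
Let bscaleAr (c : R[i]) x y : c *: (x * y) = x * (c *: y).
Proof. by apply: bfam_ext => k /=; rewrite scalerAr. Qed.
HB.instance Definition _ := GRing.Lalgebra_isAlgebra.Build R[i] B bscaleAr.

Lemma bcoordB x y k : (x - y) k = x k - y k. Proof. by []. Qed.

Definition bnorm x : R := sup [set cnorm (x k) | k in setT].

Let bnorm_has x : has_sup [set cnorm (x k) | k in setT].
Proof.
split; first by exists (cnorm (x (cindex0 F))), (cindex0 F).
by have [M hM] := bcoord_bounded x; exists M => _ [k _ <-].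
Qed.

Lemma bcoord_le_norm x k : cnorm (x k) <= bnorm x.
Proof. by apply: sup_upper_bound; [exact: bnorm_has | exists k]. Qed.

Lemma bnorm_le x M : (forall k, cnorm (x k) <= M) -> bnorm x <= M.
Proof.
by move=> h; apply: ge_sup; [case: (bnorm_has x) | move=> _ [k _ <-]].
Qed.

Let bnorm_ge0 x : 0 <= bnorm x.
Proof. by rewrite (le_trans (cnorm_ge0 _) (bcoord_le_norm x (cindex0 F))). Qed.

Let bstarD x y : bstar (x + y) = bstar x + bstar y.
Proof. by apply: bfam_ext => k /=; rewrite starD. Qed.
Let bstarZ (c : R[i]) x : bstar (c *: x) = c^*%C *: bstar x.
Proof. by apply: bfam_ext => k /=; rewrite starZ. Qed.
Let bstarM x y : bstar (x * y) = bstar y * bstar x.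
Proof. by apply: bfam_ext => k /=; rewrite starM. Qed.
Let bstarK x : bstar (bstar x) = x.
Proof. by apply: bfam_ext => k /=; rewrite starK. Qed.
Let bnorm_eq0 x : bnorm x = 0 -> x = 0.
Proof.
move=> h; apply: bfam_ext => k; apply: cnorm0_eq0; apply/eqP.
by rewrite eq_le cnorm_ge0 andbT -h bcoord_le_norm.
Qed.
Let bnormD x y : bnorm (x + y) <= bnorm x + bnorm y.
Proof.
apply: bnorm_le => k; rewrite (le_trans (cnormD _ _)) //.
by rewrite lerD // bcoord_le_norm.
Qed.
Let bnormZ (c : R[i]) x : (bnorm (c *: x))%:C = `|c| * (bnorm x)%:C.
Proof.
have nE (d : R[i]) : `|d| = (normc d)%:C by [].
have n0 (d : R[i]) : 0 <= normc d by rewrite -lecR -nE normr_ge0.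
have le (d : R[i]) y : bnorm (d *: y) <= normc d * bnorm y.
  apply: bnorm_le => k; rewrite -lecR cnormZ realCM nE -!realCM lecR.
  by rewrite ler_wpM2l ?bcoord_le_norm.
rewrite nE -realCM; congr (_%:C); apply/eqP; rewrite eq_le le /=.
have [c0|c0] := eqVneq c 0.
  by rewrite c0 -lecR realCM -nE normr0 mul0r lecR.
have cp : 0 < normc c by rewrite -ltcR -nE normr_gt0.
have := le c^-1 (c *: x); rewrite scalerA mulVf // scale1r normcV.
by rewrite ler_pdivlMl.
Qed.
Let bnormM x y : bnorm (x * y) <= bnorm x * bnorm y.
Proof.
apply: bnorm_le => k; rewrite (le_trans (cnormM _ _)) //.
by rewrite ler_pM ?cnorm_ge0 // bcoord_le_norm.
Qed.
Let bnorm_cstar x : bnorm (bstar x * x) = bnorm x ^+ 2.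
Proof.
apply/eqP; rewrite eq_le; apply/andP; split.
  apply: bnorm_le => k /=; rewrite cnorm_cstar.
  by rewrite lerXn2r ?nnegrE ?cnorm_ge0 // bcoord_le_norm.
have h0 := bnorm_ge0 (bstar x * x).
rewrite -[leRHS](sqr_sqrtr h0) lerXn2r ?nnegrE ?sqrtr_ge0 //.
apply: bnorm_le => k; rewrite -(@ler_pXn2r _ 2) ?nnegrE ?sqrtr_ge0 ?cnorm_ge0 //.
by rewrite (sqr_sqrtr h0) -cnorm_cstar; exact: (bcoord_le_norm (bstar x * x)).
Qed.
Let bnorm_complete (u : nat -> B) :
  (forall e : R, 0 < e -> exists N, forall m n, (N <= m)%N -> (N <= n)%N ->
    bnorm (u m - u n) < e) ->
  exists x, forall e : R, 0 < e -> exists N, forall n, (N <= n)%N ->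
    bnorm (u n - x) < e.
Proof.
move=> hu; have ex k : exists a : F k, converges (fun n => u n k) a.
  apply: cnorm_complete => e /hu [N hN]; exists N => m n Nm Nn.
  by rewrite (le_lt_trans _ (hN m n Nm Nn)) // -bcoordB bcoord_le_norm.
pose x k := sval (cid (ex k)); have hx k : converges (fun n => u n k) (x k) := svalP (cid (ex k)).
have hb (N : nat) (e : R) : (forall m n, (N <= m)%N -> (N <= n)%N -> bnorm (u m - u n) < e) ->
    forall n k, (N <= n)%N -> cnorm (u n k - x k) <= e.
  move=> hN n k Nn; apply/ler_addgt0Pr => d d0.
  have [M hM] := hx k _ d0.
  rewrite (le_trans (cnorm_triangle (u (maxn N M) k) _ _)) //.
  rewrite lerD //; last by rewrite ltW // hM ?leq_maxr.
  by rewrite -bcoordB (le_trans (bcoord_le_norm _ _)) // ltW // hN // leq_maxl.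
have xb : exists M : R, forall k, cnorm (x k) <= M.
  have [N hN] := hu _ ltr01; exists (bnorm (u N) + 1) => k.
  rewrite -[x k](subKr (u N k)) (le_trans (cnormB _ _)) //.
  by rewrite lerD ?bcoord_le_norm // (hb N).
exists (BoundedFamily xb) => e e0; have e2 : 0 < e / 2 by rewrite divr_gt0.
have [N hN] := hu _ e2; exists N => n Nn.
rewrite (@le_lt_trans _ _ (e / 2)) //; last by lra.
by apply: bnorm_le => k; apply: hb Nn.
Qed.
HB.instance Definition _ := isCStarAlgebra.Build R B bstarD bstarZ bstarM bstarK
  bnorm_eq0 bnormD bnormZ bnormM bnorm_complete bnorm_cstar.

(** The factors [Y k] are chosen independently in each coordinate. They still form bounded families,
    because the square of the norm of [Y k i j] is at most the norm of the diagonal entry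
    [X j j]. *)
Lemma bfam_mxpos n (X : 'M[B]_n) :
  (forall k, cstar_mxpos (map_mx (fun x : B => x k) X)) <-> cstar_mxpos X.
Proof.
split=> [h|[Y ->] k].
  pose Y k := sval (cid (h k)); have hY k : map_mx (fun x : B => x k) X = (map_mx star (Y k))^T *m Y k := svalP (cid (h k)).
  have yb i j : exists M : R, forall k, cnorm (Y k i j) <= M.
    have [M hM] := bcoord_bounded (X j j); exists (Num.sqrt M) => k.
    rewrite -(@ler_pXn2r _ 2) ?nnegrE ?sqrtr_ge0 ?cnorm_ge0 // sqr_sqrtr; last first.
      by rewrite (le_trans (cnorm_ge0 _) (hM k)).
    rewrite -cnorm_cstar (le_trans _ (hM k)) //.
    have /matrixP/(_ j j) := hY k; rewrite mxE => ->.
    apply: pos_le_norm; first exact: pos_star_mul.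
    rewrite mxE (bigD1 i) //= !mxE addrAC subrr add0r; apply: pos_sum => l _.
    by rewrite !mxE; exact: pos_star_mul.
  exists (\matrix_(i, j) BoundedFamily (yb i j)).
  apply/matrixP => i j; apply: bfam_ext => k.
  have /matrixP/(_ i j) := hY k; rewrite mxE => ->; rewrite !mxE.
  have cs (J : Type) (s : seq J) (G : J -> B) :
      (\sum_(l <- s) G l) k = \sum_(l <- s) G l k.
    by elim: s => [|a s ih]; rewrite ?big_nil // !big_cons -ih.
  by rewrite cs; apply: eq_bigr => l _; rewrite !mxE.
exists (map_mx (fun x : B => x k) Y); apply/matrixP => i j; rewrite !mxE.
have cs (J : Type) (s : seq J) (G : J -> B) :
    (\sum_(l <- s) G l) k = \sum_(l <- s) G l k.
  by elim: s => [|a s ih]; rewrite ?big_nil // !big_cons -ih.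
by rewrite cs; apply: eq_bigr => l _; rewrite !mxE.
Qed.
End ProductCStar.

(** * Separation of hermitian elements by states *)

Section States.
Context {R : realType} {W : lmodType R[i]}.
Variables (adjW : W -> W) (P : set W) (e : W).
Hypothesis adjWD : forall x y, adjW (x + y) = adjW x + adjW y.
Hypothesis adjWZ : forall (c : R[i]) x, adjW (c *: x) = c^*%C *: adjW x.
Hypothesis adjWK : forall x, adjW (adjW x) = x.
Hypothesis P_herm : forall x, P x -> adjW x = x.
Hypothesis PD : forall x y, P x -> P y -> P (x + y).
Hypothesis PZ : forall (r : R) x, 0 <= r -> P x -> P (r%:C *: x).
Hypothesis P_unit : P e.
Hypothesis P_order : forall x, adjW x = x -> exists2 r : R, 0 < r & P (r%:C *: e + x).
Hypothesis P_arch : forall x, adjW x = x ->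
  (forall r : R, 0 < r -> P (r%:C *: e + x)) -> P x.

Let P0 : P 0. Proof. by rewrite -(scale0r e); apply: (@PZ 0). Qed.
Let adjWN x : adjW (- x) = - adjW x.
Proof. by rewrite -scaleN1r adjWZ rmorphN rmorph1 scaleN1r. Qed.
Let adjWZr (r : R) x : adjW (r%:C *: x) = r%:C *: adjW x.
Proof. by rewrite adjWZ conjC_real. Qed.
Let adjWe : adjW e = e. Proof. exact: P_herm. Qed.

Record proper_cone (C : set W) : Prop := {
  pcone_herm : forall x, C x -> adjW x = x;
  proper_coneD : forall x y, C x -> C y -> C (x + y);
  proper_coneZ : forall (r : R) x, 0 <= r -> C x -> C (r%:C *: x);
  proper_cone_sub : P `<=` C;
  proper_cone_unit : ~ C (- e)
}.

Lemma maximal_cone C0 : proper_cone C0 -> exists C, [/\ proper_cone C, C0 `<=` C &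
  forall C', proper_cone C' -> C `<=` C' -> C' `<=` C].
Proof.
move=> h0; pose T := {C : set W | proper_cone C /\ C0 `<=` C}.
pose le (s t : T) := `[< sval s `<=` sval t >].
pose t0 : T := exist _ C0 (conj h0 (fun x h => h)).
have le_refl t : le t t by apply/asboolP.
have le_trans r s t : le r s -> le s t -> le r t.
  by move=> /asboolP h1 /asboolP h2; apply/asboolP; exact: subset_trans h2.
have le_chain A : total_on A le -> exists t, forall s, A s -> le s t.
  move=> totA; have [[c0 Ac0]|A0] := pselect (exists c, A c); last first.
    by exists t0 => s As; case: A0; exists s.
  pose U : set W := [set x | exists2 s, A s & sval s x].
  have hA s : A s -> proper_cone (sval s) by move=> _; case: (svalP s).
  have hU : proper_cone U.
    split.
    - by move=> x [s As]; exact: (pcone_herm (hA _ As)).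
    - move=> x y [s As sx] [t At ty].
      have [/asboolP h|/asboolP h] := totA _ _ As At.
        by exists t => //; apply: (proper_coneD (hA _ At)) => //; exact: h.
      by exists s => //; apply: (proper_coneD (hA _ As)) => //; exact: h.
    - by move=> r x r0 [s As sx]; exists s => //; exact: (proper_coneZ (hA _ As)).
    - by move=> x Px; exists c0 => //; exact: (proper_cone_sub (hA _ Ac0)).
    - by move=> [s As]; exact: (proper_cone_unit (hA _ As)).
  have C0U : C0 `<=` U by move=> x C0x; exists c0 => //; case: (svalP c0) => _; exact.
  exists (exist _ U (conj hU C0U)) => s As; apply/asboolP => x sx.
  by exists s.
have [t ht] := ZL_preorder t0 le_refl le_trans le_chain.
have [hC C0C] := svalP t; exists (sval t); split => // C' hC' sub.
pose t' : T := exist _ C' (conj hC' (subset_trans C0C sub)).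
by have /ht/asboolP : le t t' by apply/asboolP.
Qed.

Section MaximalCone.
Variable C : set W.
Hypothesis hC : proper_cone C.
Hypothesis maxC : forall C', proper_cone C' -> C `<=` C' -> C' `<=` C.

Let C0 : C 0. Proof. exact: (proper_cone_sub hC). Qed.

Lemma neg_unit_notin (r : R) : C ((- r)%:C *: e) -> r <= 0.
Proof.
move=> h; rewrite leNgt; apply/negP => r0; apply: (proper_cone_unit hC).
have := proper_coneZ hC (r := r^-1) _ h; rewrite invr_ge0 ltW // => /(_ isT).
by rewrite scalerA -realCM mulrN mulVf ?lt0r_neq0 // realCN scaleN1r.
Qed.

(** By maximality, adjoining the ray of [x] must destroy properness, so [- e] lies in the enlarged
    cone. *)
Lemma maximal_cone_ray x : adjW x = x -> ~ C x ->
  exists c (r : R), [/\ C c, 0 < r & - e = c + r%:C *: x].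
Proof.
move=> hx nCx; apply: contrapT => hn; apply: nCx.
pose C' : set W := [set y | exists c (r : R), [/\ C c, 0 <= r & y = c + r%:C *: x]].
have hC' : proper_cone C'.
  split.
  - move=> _ [c [r [Cc r0 ->]]].
    by rewrite adjWD adjWZr hx (pcone_herm hC).
  - move=> _ _ [c [r [Cc r0 ->]]] [d [s [Cd s0 ->]]]; exists (c + d), (r + s).
    split; [exact: (proper_coneD hC) | exact: addr_ge0 |].
    by rewrite addrACA -scalerDl -realCD.
  - move=> t _ t0 [c [r [Cc r0 ->]]]; exists (t%:C *: c), (t * r).
    split; [exact: (proper_coneZ hC) | exact: mulr_ge0 |].
    by rewrite scalerDr scalerA -realCM.
  - move=> y /(proper_cone_sub hC) Cy; exists y, 0; split => //.
    by rewrite scale0r addr0.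
  - move=> [c [r [Cc]]]; rewrite le_eqVlt => /predU1P[<-|r0 hE].
      by rewrite scale0r addr0 => hE; apply: (proper_cone_unit hC); rewrite hE.
    by apply: hn; exists c, r.
apply: (maxC hC').
  by move=> y Cy; exists y, 0; split => //; rewrite scale0r addr0.
by exists 0, 1; split => //; rewrite scale1r add0r.
Qed.

(** If neither sign occurs, [- e = c + r x] and [- e = d - s x]; eliminating [x] puts [- (s + r) e]
    in the cone. *)
Lemma maximal_cone_total x : adjW x = x -> C x \/ C (- x).
Proof.
move=> hx; have [Cx|nCx] := pselect (C x); first by left.
right; apply: contrapT => nCNx.
have hNx : adjW (- x) = - x by rewrite adjWN hx.
have [c [r [Cc r0 h1]]] := maximal_cone_ray hx nCx.
have [d [s [Cd s0 h2]]] := maximal_cone_ray hNx nCNx.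
have h : C ((- (s + r))%:C *: e).
  have -> : (- (s + r))%:C *: e = s%:C *: c + r%:C *: d.
    rewrite realCN scaleNr -scalerN realCD scalerDl {1}h1 h2 !scalerDr.
    rewrite !scalerA -!realCM scalerN [r * s]mulrC addrACA subrr addr0.
    by [].
  by apply: (proper_coneD hC); apply: (proper_coneZ hC) => //; exact: ltW.
by have := neg_unit_notin h; rewrite leNgt addr_gt0.
Qed.

Definition cone_fun (x : W) : R := sup [set t | C (x - t%:C *: e)].

Let D_sup x : adjW x = x -> has_sup [set t | C (x - t%:C *: e)].
Proof.
move=> hx; split.
  have [r r0 h] := P_order hx; exists (- r) => /=.
  by rewrite realCN scaleNr opprK addrC; exact: (proper_cone_sub hC).
have hNx : adjW (- x) = - x by rewrite adjWN hx.
have [r r0 h] := P_order hNx; exists r => t /= ht.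
have := proper_coneD hC (proper_cone_sub hC h) ht.
have -> : (r%:C *: e - x) + (x - t%:C *: e) = (- (t - r))%:C *: e.
  by rewrite addrA subrK opprB realCB scalerBl.
by move/neg_unit_notin; rewrite subr_le0.
Qed.

Let fun_ge x t : adjW x = x -> C (x - t%:C *: e) -> t <= cone_fun x.
Proof. by move=> hx h; apply: sup_upper_bound; [exact: D_sup | exact: h]. Qed.

Let fun_lt x t : adjW x = x -> t < cone_fun x -> C (x - t%:C *: e).
Proof.
move=> hx ht; have d0 : 0 < cone_fun x - t by rewrite subr_gt0.
have [s hs] := sup_adherent d0 (D_sup hx).
rewrite -/(cone_fun x) subKr => ts.
have -> : x - t%:C *: e = (x - s%:C *: e) + (s - t)%:C *: e.
  by rewrite realCB scalerBl addrA subrK.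
apply: (proper_coneD hC) => //; apply: (proper_coneZ hC).
  by rewrite subr_ge0 ltW.
exact: (proper_cone_sub hC).
Qed.

Let fun_le x y : adjW x = x -> (forall t, t < cone_fun x -> t <= y) ->
  cone_fun x <= y.
Proof.
move=> hx h; rewrite leNgt; apply/negP => hlt.
have := h ((cone_fun x + y) / 2); lra.
Qed.

Let fun_super x y : adjW x = x -> adjW y = y ->
  cone_fun x + cone_fun y <= cone_fun (x + y).
Proof.
move=> hx hy; rewrite -lerBrDr; apply: fun_le => // t tx.
rewrite lerBrDr -lerBrDl; apply: fun_le => // s sy; rewrite lerBrDl.
apply: fun_ge; first by rewrite adjWD hx hy.
rewrite realCD scalerDl opprD addrACA.
by apply: (proper_coneD hC); exact: fun_lt.
Qed.

Let fun0 : cone_fun 0 = 0.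
Proof.
have a0 : adjW 0 = 0 by exact: P_herm.
apply/eqP; rewrite eq_le; apply/andP; split.
  apply: fun_le => // t /(fun_lt a0).
  by rewrite sub0r -scaleNr -realCN => /neg_unit_notin.
by apply: fun_ge => //; rewrite scale0r subr0.
Qed.

Let funN x : adjW x = x -> cone_fun (- x) = - cone_fun x.
Proof.
move=> hx; have hNx : adjW (- x) = - x by rewrite adjWN hx.
apply/eqP; rewrite eq_le; apply/andP; split.
  by have := fun_super hx hNx; rewrite subrr fun0; lra.
rewrite leNgt; apply/negP => h.
(* Under [h] this midpoint lies strictly between [cone_fun x] and [- cone_fun (- x)], so neither
   sign of [x - t e] is possible. *)
pose t := (cone_fun x - cone_fun (- x)) / 2.
have tsa : adjW (x - t%:C *: e) = x - t%:C *: e.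
  by rewrite adjWD adjWN adjWZr hx adjWe.
have [/(fun_ge hx)|] := maximal_cone_total tsa; first by rewrite /t; lra.
rewrite opprB addrC -[t%:C *: e]opprK -scaleNr -realCN => /(fun_ge hNx).
by rewrite /t; lra.
Qed.

Lemma cone_funD x y : adjW x = x -> adjW y = y ->
  cone_fun (x + y) = cone_fun x + cone_fun y.
Proof.
move=> hx hy; apply/eqP; rewrite eq_le fun_super // andbT.
have hxy : adjW (x + y) = x + y by rewrite adjWD hx hy.
have hNy : adjW (- y) = - y by rewrite adjWN hy.
by have := fun_super hxy hNy; rewrite addrK funN //; lra.
Qed.

Let funZ_pos (r : R) x : 0 < r -> adjW x = x ->
  r * cone_fun x <= cone_fun (r%:C *: x).
Proof.
move=> r0 hx; rewrite -ler_pdivlMl //; apply: fun_le => // t tx.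
rewrite ler_pdivlMl //; apply: fun_ge; first by rewrite adjWZr hx.
rewrite realCM -scalerA -scalerBr; apply: (proper_coneZ hC); first exact: ltW.
exact: fun_lt.
Qed.

Lemma cone_funZ (r : R) x : adjW x = x -> cone_fun (r%:C *: x) = r * cone_fun x.
Proof.
have pos_case s y : 0 < s -> adjW y = y -> cone_fun (s%:C *: y) = s * cone_fun y.
  move=> s0 hy; apply/eqP; rewrite eq_le funZ_pos // andbT.
  have hsy : adjW (s%:C *: y) = s%:C *: y by rewrite adjWZr hy.
  have si : 0 < s^-1 by rewrite invr_gt0.
  have := funZ_pos si hsy; rewrite realZKV ?lt0r_neq0 //.
  by rewrite ler_pdivrMl.
move=> hx; have [r0|r0|->] := ltrgt0P r.
- exact: pos_case.
- have Nr0 : 0 < - r by rewrite oppr_gt0.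
  have := pos_case _ _ Nr0 hx; rewrite realCN scaleNr funN ?adjWZr ?hx //.
  by rewrite mulNr => /oppr_inj.
- by rewrite scale0r fun0 mul0r.
Qed.

Lemma cone_fun_ge0 x : C x -> 0 <= cone_fun x.
Proof.
move=> Cx; apply: fun_ge; first exact: (pcone_herm hC).
by rewrite scale0r subr0.
Qed.

Lemma cone_fun_unit : cone_fun e = 1.
Proof.
apply/eqP; rewrite eq_le; apply/andP; split; last first.
  by apply: fun_ge; rewrite // scale1r subrr.
apply: fun_le => // t /(fun_lt adjWe).
have -> : e - t%:C *: e = (- (t - 1))%:C *: e.
  by rewrite opprB realCB scalerBl scale1r.
by move/neg_unit_notin; rewrite subr_le0.
Qed.

Let re x := (2^-1)%:C *: (x + adjW x).
Let re_sa x : adjW (re x) = re x.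
Proof. by rewrite /re adjWZr adjWD adjWK addrC. Qed.
Let reD x y : re (x + y) = re x + re y.
Proof. by rewrite /re adjWD addrACA scalerDr. Qed.
Let reZ (r : R) x : re (r%:C *: x) = r%:C *: re x.
Proof. by rewrite /re adjWZr -scalerDr !scalerA mulrC. Qed.
Let g x := cone_fun (re x).
Let gD x y : g (x + y) = g x + g y.
Proof. by rewrite /g reD cone_funD. Qed.
Let gZ (r : R) x : g (r%:C *: x) = r * g x.
Proof. by rewrite /g reZ cone_funZ. Qed.

(** The complex linear functional whose real part is [g]. *)
Definition cone_state (x : W) : R[i]^o := g x +i* - g ('i%C *: x).

Let iZ (c : R[i]) (x : W) : c *: x = (complex.Re c)%:C *: x + (complex.Im c)%:C *: ('i%C *: x).
Proof. by rewrite scalerA -scalerDl {1}(complexE c) [X in _ + X]mulrC. Qed.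

Lemma cone_state_linear : linear cone_state.
Proof.
move=> c x y; rewrite /cone_state scalerDr !gD.
have -> : g (c *: x) = complex.Re c * g x + complex.Im c * g ('i%C *: x).
  by rewrite {1}iZ gD !gZ.
have -> : g ('i%C *: (c *: x)) = complex.Re c * g ('i%C *: x) - complex.Im c * g x.
  rewrite scalerA mulrC -scalerA {1}iZ gD !gZ scalerA -expr2 sqr_i.
  by rewrite -(rmorphN1 (real_complex R)) gZ mulN1r mulrN.
case: c => a b /=; rewrite /GRing.scale /=; simpc.
by congr (_ +i* _); ring.
Qed.

Lemma cone_state_herm x : adjW x = x -> cone_state x = (cone_fun x)%:C.
Proof.
move=> hx; rewrite /cone_state.
have -> : g x = cone_fun x by rewrite /g /re hx halfZ_double.
have -> : g ('i%C *: x) = 0.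
  rewrite /g /re adjWZ hx (_ : 'i%C^*%C = - 'i%C); last by rewrite /= -[RHS]/(_ +i* _) oppr0.
  by rewrite scaleNr subrr scaler0 fun0.
by rewrite oppr0.
Qed.
End MaximalCone.

(** By the Archimedean property even [r e + w] is outside [P] for some [r > 0]. A maximal cone
    containing [P] and [- (r e + w)] gives [F w <= - r], hence a strict inequality. *)
Lemma separating_state w : adjW w = w -> ~ P w -> exists F : {linear W -> R[i]^o},
  [/\ forall x, P x -> 0 <= (F x : R[i]), F e = 1 & (F w : R[i]) < 0].
Proof.
move=> hw nPw.
have [r r0 hr] : exists2 r : R, 0 < r & ~ P (r%:C *: e + w).
  apply: contrapT => hn; apply: nPw; apply: P_arch => // r r0.
  by apply: contrapT => hP; apply: hn; exists r.
pose w' := - (r%:C *: e + w).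
have hw' : adjW w' = w' by rewrite adjWN adjWD adjWZr adjWe hw.
pose C0 : set W := [set y | exists p (t : R), [/\ P p, 0 <= t & y = p + t%:C *: w']].
have hC0 : proper_cone C0.
  split.
  - by move=> _ [p [t [Pp t0 ->]]]; rewrite adjWD adjWZr hw' P_herm.
  - move=> _ _ [c [t [Cc t0 ->]]] [d [s [Cd s0 ->]]]; exists (c + d), (t + s).
    split; [exact: PD | exact: addr_ge0 |].
    by rewrite addrACA -scalerDl -realCD.
  - move=> t _ t0 [c [s [Cc s0 ->]]]; exists (t%:C *: c), (t * s).
    split; [exact: PZ | exact: mulr_ge0 |].
    by rewrite scalerDr scalerA -realCM.
  - by move=> y Cy; exists y, 0; split => //; rewrite scale0r addr0.
  - move=> [p [t [Pp t0 hE]]]; apply: hr.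
    have [t00|tn0] := eqVneq t 0.
      have PNe : P (- e) by rewrite hE t00 scale0r addr0.
      have hx : adjW (r%:C *: e + w) = r%:C *: e + w by rewrite adjWD adjWZr adjWe hw.
      have [s s0 hs] := P_order hx.
      have := PD hs (PZ (ltW s0) PNe).
      by rewrite scalerN addrAC subrr add0r.
        have : P (t%:C *: (r%:C *: e + w)).
      have -> : t%:C *: (r%:C *: e + w) = p + e.
        by rewrite -[e in RHS]opprK hE opprD addrA subrr add0r /w' scalerN opprK.
      exact: PD.
    have ti : 0 <= t^-1 by rewrite invr_ge0.
    by move/(PZ ti); rewrite realZKV.
have [C [hC C0C maxC]] := maximal_cone hC0.
pose F : {linear W -> R[i]^o} := HB.pack (cone_state C)
  (GRing.isLinear.Build R[i] W R[i]^o _ (cone_state C) (cone_state_linear hC maxC)).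
exists F; split.
- move=> x Px; rewrite /= cone_state_herm //; last exact: P_herm.
  by rewrite lecR cone_fun_ge0 //; exact: (proper_cone_sub hC).
- by rewrite /= cone_state_herm // cone_fun_unit.
- rewrite /= cone_state_herm // ltcR.
  have Cw' : C w' by apply: C0C; exists 0, 1; split => //; rewrite scale1r add0r.
  have := cone_fun_ge0 hC Cw'.
  have -> : w' = (- r)%:C *: e + (-1)%:C *: w.
    by rewrite /w' opprD !realCN !scaleNr scale1r.
  rewrite cone_funD ?adjWZr ?adjWe ?hw // !cone_funZ // cone_fun_unit //.
  lra.
Qed.
End States.

(** * Positive functionals on matrices and completely positive maps into scalar matrices *)

Section MatrixFunctional.
Context {R : realType} {V : opSystemType R} {n : nat}.
Local Notation C := (ccomplex R).
Local Notation W := (entry_mx V n.+1 n.+1).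
Variable G : {linear W -> R[i]^o}.
Hypothesis G_pos : forall Y : 'M[V]_n.+1, mxpos Y -> 0 <= (G Y : R[i]).

Lemma ccomplex_pos (z : C) : pos z <-> 0 <= (z : R[i]).
Proof.
split=> [/pos_factor [b ->]|z0].
  have -> : (star b * b : R[i]) = `|b : R[i]| ^+ 2 by rewrite sqr_normc mulrC.
  by rewrite exprn_ge0.
apply/pos_factor; exists ((Num.sqrt (complex.Re (z : R[i])))%:C : R[i]).
have {1}-> : z = (complex.Re (z : R[i]))%:C :> R[i].
  by move: z0; case: (z : R[i]) => a b; rewrite lecE /= => /andP[/eqP -> _].
have r0 : 0 <= complex.Re (z : R[i]) by move: z0; rewrite lecE => /andP[].
by rewrite [star _]conjC_real -[RHS]realCM -expr2 sqr_sqrtr.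
Qed.

Definition single_mx (k l : 'I_n.+1) (x : V) : W :=
  \matrix_(i, j) (if (i == k) && (j == l) then x else 0).

Lemma single_mx_linear k l : linear (single_mx k l).
Proof.
move=> c x y; apply/matrixP => i j; rewrite !mxE.
by case: ifP => _ //; rewrite scaler0 addr0.
Qed.
HB.instance Definition _ k l :=
  GRing.isLinear.Build R[i] V W _ (single_mx k l) (single_mx_linear k l).

Lemma single_mx_sum (Z : W) : Z = \sum_k \sum_l single_mx k l (Z k l).
Proof.
apply/matrixP => i j; rewrite summxE (bigD1 i) //= summxE (bigD1 j) //= mxE !eqxx /=.
rewrite big1 ?addr0 => [|l lj]; last by rewrite mxE eq_sym (negbTE lj) andbF.
rewrite big1 ?addr0 // => k ki; rewrite summxE big1 // => l _.
by rewrite mxE eq_sym (negbTE ki).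
Qed.

(** The map from V to scalar matrices that corresponds to the functional [G] on matrices over V. *)
Definition fun_mx (x : V) : cmx C n := \matrix_(k, l) (G (single_mx k l x) : C).

Lemma fun_mx_linear : linear fun_mx.
Proof.
move=> c x y; apply/matrixP => i j; rewrite [LHS]mxE [RHS]mxE entry_mxZ !mxE.
by rewrite linearP linearP.
Qed.
HB.instance Definition _ := GRing.isLinear.Build R[i] V (cmx C n) _ fun_mx fun_mx_linear.

(** Testing [fun_mx] on vectors evaluates [G] at a scalar compression of [Y]. Both complete
    positivity and reflection of positivity reduce to this identity. *)
Lemma fun_mx_form m (Y : 'M[V]_m) (v : 'cV[cmx C n]_m) (u : 'cV[C]_n.+1) :
  ip u ((ip v (map_mx fun_mx Y *m v) : 'M[C]_n.+1) *m u) =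
  G (compress (\matrix_(p, k) (((v p 0 : 'M[C]_n.+1) *m u) k 0 : R[i])) Y).
Proof.
have ip_suml p q (F : 'I_p -> 'cV[C]_q) w : ip w (\sum_i F i) = \sum_i ip w (F i).
  by apply: (big_morph (ip w)); [exact: ipDr | rewrite /ip mulmx0 mxE].
have sum_mulmx p (F : 'I_p -> cmx C n) (w : 'cV[C]_n.+1) :
    ((\sum_i F i : cmx C n) : 'M[C]_n.+1) *m w = \sum_i (F i : 'M[C]_n.+1) *m w.
  apply: (big_morph (fun X : cmx C n => (X : 'M[C]_n.+1) *m w)) => [X X'|].
    exact: mulmxDl.
  exact: mul0mx.
rewrite [ip v _]ipE sum_mulmx ip_suml.
transitivity (\sum_p \sum_q ip ((v p 0 : 'M[C]_n.+1) *m u)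
   ((fun_mx (Y p q) : 'M[C]_n.+1) *m ((v q 0 : 'M[C]_n.+1) *m u))).
  apply: eq_bigr => p _; rewrite -[_ *m u]mulmxA -ip_madj mxE.
  rewrite sum_mulmx ip_suml; apply: eq_bigr => q _; rewrite mxE.
  by rewrite -[_ *m u]mulmxA.
rewrite [in RHS](single_mx_sum (compress _ _)) linear_sum.
transitivity (\sum_p \sum_q \sum_k \sum_l G (single_mx k l
   ((((((v p 0 : 'M[C]_n.+1) *m u) k 0 : R[i])^*%C) *
      (((v q 0 : 'M[C]_n.+1) *m u) l 0 : R[i])) *: Y p q))).
  apply: eq_bigr => p _; apply: eq_bigr => q _; rewrite ipE; apply: eq_bigr => k _.
  rewrite [X in _ * X]mxE mulr_sumr; apply: eq_bigr => l _.
  rewrite !linearZ [X in _ * (X * _)]mxE.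
  by rewrite mulrCA mulrC.
symmetry; transitivity (\sum_k \sum_l \sum_p \sum_q G (single_mx k l
   ((((((v p 0 : 'M[C]_n.+1) *m u) k 0 : R[i])^*%C) *
      (((v q 0 : 'M[C]_n.+1) *m u) l 0 : R[i])) *: Y p q))).
  apply: eq_bigr => k _; rewrite linear_sum; apply: eq_bigr => l _.
  rewrite mxE !linear_sum; apply: eq_bigr => p _; rewrite !linear_sum.
  by apply: eq_bigr => q _; rewrite [X in G (single_mx _ _ (X^*%C * _ *: _))]mxE [X in G (single_mx _ _ (_ * X *: _))]mxE.
under eq_bigr do rewrite exchange_big.
rewrite exchange_big; apply: eq_bigr => p _.
under eq_bigr do rewrite exchange_big.
by rewrite exchange_big.
Qed.

Definition adj_mx (Y : W) : W := (map_mx adj Y)^T.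

Lemma ge0_conj (z : R[i]) : 0 <= z -> z^*%C = z.
Proof. by case: z => a b; rewrite lecE /= => /andP[/eqP -> _]; rewrite oppr0. Qed.

Lemma adj_mxD (X Y : W) : adj_mx (X + Y) = adj_mx X + adj_mx Y.
Proof. by apply/matrixP => i j; rewrite !mxE adjD. Qed.
Lemma adj_mxZ (c : R[i]) (Y : W) : adj_mx (c *: Y) = c^*%C *: adj_mx Y.
Proof. by apply/matrixP => i j; rewrite entry_mxZ !mxE Defs.adjZ. Qed.
Lemma adj_mxK (Y : W) : adj_mx (adj_mx Y) = Y.
Proof. by apply/matrixP => i j; rewrite !mxE adjK. Qed.

Lemma unit_mxZ (r : R) : ((r%:C *: ounit)%:M : 'M[V]_n.+1) = r%:C *: (ounit%:M : W).
Proof. by apply/matrixP => i j; rewrite entry_mxZ !mxE scalerMnr. Qed.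

Lemma functional_adj (Y : W) : G (adj_mx Y) = (G Y : R[i])^*%C.
Proof.
apply: (@adj_compat R W R[i]^o adj_mx (@conjc R)).
- exact: adj_mxD.
- exact: adj_mxZ.
- exact: adj_mxK.
- exact: rmorphD.
- by move=> c x; exact: rmorphM.
- exact: conjcK.
move=> X hX; have [r r0 hr] := @ounit_order R V _ X hX.
have h1 := G_pos hr; have h2 := G_pos (@mxpos_unit R V n.+1 r (ltW r0)).
have e : G ((r%:C *: ounit)%:M + X) = G (r%:C *: ounit)%:M + G X by exact: linearD.
have cancel_real (a b : R[i]) : a^*%C = a -> (a + b)^*%C = a + b -> b^*%C = b.
  by case: a b => [a1 a2] [b1 b2] [e1] [e2]; rewrite /=; congr (_ +i* _); lra.
apply: (cancel_real _ _ (ge0_conj h2)).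
by have := ge0_conj h1; rewrite e.
Qed.

Lemma fun_mx_star x : fun_mx (adj x) = star (fun_mx x).
Proof.
apply/matrixP => k l; rewrite madjE !mxE.
transitivity (G (adj_mx (single_mx l k x)) : C); last exact: functional_adj.
congr (G _).
apply/matrixP => i j; rewrite !mxE andbC; case: ifP => // _.
by rewrite [RHS](@padj0 R V (os_preos V)).
Qed.

Lemma fun_mx_cp m (Y : 'M[V]_m) : mxpos Y -> cstar_mxpos (map_mx fun_mx Y).
Proof.
move=> hY; have sY : madj (map_mx fun_mx Y) = map_mx fun_mx Y.
  apply/matrixP => p q; rewrite madjE !mxE -fun_mx_star; congr fun_mx.
  by have /matrixP/(_ p q) := mxpos_adj _ _ hY; rewrite !mxE.
apply/cstar_mxposP; split => // v; apply/cmx_posP/cstar_mxposP; split.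
  by rewrite -[LHS]/(star (ip v (map_mx fun_mx Y *m v))) ip_star ip_madj sY.
move=> u; rewrite fun_mx_form; apply/ccomplex_pos; apply: G_pos.
exact: mxpos_compress.
Qed.

Lemma fun_mx_reflects (X : 'M[V]_n.+1) :
  cstar_mxpos (map_mx fun_mx X) -> 0 <= (G X : R[i]).
Proof.
move=> /cstar_mxposP [_ h].
(* With these matrix units and [u = e_0] the compression is the identity, so the form returns
   [G X]. *)
pose v : 'cV[cmx C n]_n.+1 := \col_p (delta_mx p 0 : 'M[C]_n.+1).
have /cmx_posP/cstar_mxposP [_ /(_ (delta_mx 0 0))] := h v.
rewrite fun_mx_form => /ccomplex_pos; rewrite (_ : \matrix_(p, k) _ = 1%:M) ?compress_id //.
apply/matrixP => p k; rewrite !mxE (bigD1 0) //= !mxE big1 => [|l l0].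
  by rewrite !eqxx !andbT addr0 mulr1 eq_sym.
by rewrite !mxE (negbTE l0) mulr0.
Qed.
End MatrixFunctional.

Lemma scalar_conj_mx (A : nzRingType) m (a b : A) (Y : 'M[A]_m) i j :
  (a%:M *m Y *m b%:M) i j = a * Y i j * b.
Proof.
rewrite mul_scalar_mx mxE (bigD1 j) //= big1 => [|k kj].
  by rewrite addr0 !mxE eqxx mulr1n.
by rewrite !mxE (negbTE kj) mulr0n mulr0.
Qed.

Lemma mxpos_diag {R : realType} {V : opSystemType R} n (Y : 'M[V]_n) k :
  mxpos Y -> mxpos ((Y k k)%:M : 'M_n).
Proof.
move=> hY; have -> : (Y k k)%:M = \sum_(j < n) compress (delta_mx k j) Y.
  apply/matrixP => i l; rewrite summxE mxE.
  rewrite (bigD1 l) //= compress_delta eqxx andbT big1 ?addr0 // => j jl.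
  by rewrite compress_delta [l == j]eq_sym (negbTE jl) andbF.
by apply: (@pcone_sum R V (os_preos V)) => j _; exact: mxpos_compress.
Qed.

Section Normalization.
Context {R : realType} {V : opSystemType R} {n : nat}.
Local Notation C := (ccomplex R).
Local Notation W := (entry_mx V n.+1 n.+1).

(** Definiteness gives invertibility; the inverse [Q = Q^* P Q] is positive, and [h] is its root. *)
Lemma pos_definite_inverse_sqrt (P : cmx C n) : pos P ->
  (forall u : 'cV[C]_n.+1, ip u ((P : 'M[C]_n.+1) *m u) = 0 -> u = 0) ->
  exists h : cmx C n, [/\ star h = h, h * P * h = 1 & h * P = P * h].
Proof.
move=> pP Pdef; pose P' : 'M[R[i]]_n.+1 := P.
have uP : P' \in unitmx.
  rewrite -row_free_unit -kermx_eq0; apply/rowV0P => w /sub_kermxP wP.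
  have : madj (w : 'M[C]_(1, n.+1)) = 0.
    apply: Pdef; rewrite /ip madjK mulmxA.
    by rewrite [X in (X *m _) _ _]wP mul0mx mxE.
  move=> /matrixP h; apply/matrixP => i j; have := h j i; rewrite madjE !mxE => e.
  exact: etrans (esym (@starK R C (w i j))) (etrans (congr1 star e) star0).
pose Q : cmx C n := invmx P'.
have QP : Q * P = 1 by exact: mulVmx.
have PQ : P * Q = 1 by exact: mulmxV.
have sQ : star Q = Q.
  rewrite -[LHS]mulr1 -PQ mulrA -{1}(pos_sa pP) -starM PQ star1.
  by rewrite mul1r.
have pQ : pos Q.
  by have := pos_conj Q pP; rewrite sQ QP mul1r.
have [h [sh hh _ ch]] := pos_sqrt pQ.
have hP : P * h = h * P by apply: ch; rewrite PQ QP.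
by exists h; split => //; rewrite -hP -mulrA hh PQ.
Qed.

(** A separating state [F] gives a completely positive map whose value at the unit may be singular.
    A small multiple of [tr] is added to make this value definite; then the map is normalized by the
    inverse root. *)
Lemma separating_ucp (X : 'M[V]_n.+1) : (map_mx adj X)^T = X -> ~ mxpos X ->
  exists psi : {linear V -> cmx C n},
  [/\ completely_positive (@mxpos R V) (@cstar_mxpos R (cmx C n)) psi,
      psi ounit = 1 & ~ cstar_mxpos (map_mx psi X)].
Proof.
move=> hX nX.
have posZ (r : R) (x : W) : 0 <= r -> @mxpos R V n.+1 x -> @mxpos R V n.+1 (r%:C *: x : W).
  exact: (@pconeZ R V (os_preos V) n.+1).
have pos_unit : @mxpos R V n.+1 ounit%:M.
  by have := @mxpos_unit R V n.+1 1 ler01; rewrite scale1r.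
have order (x : W) : adj_mx x = x -> exists2 r : R, 0 < r &
    @mxpos R V n.+1 (r%:C *: (ounit%:M : W) + x).
  move=> /(@ounit_order R V n.+1) [r r0 h]; exists r => //.
  by rewrite -unit_mxZ.
have arch (x : W) : adj_mx x = x ->
    (forall r : R, 0 < r -> @mxpos R V n.+1 (r%:C *: (ounit%:M : W) + x)) ->
    @mxpos R V n.+1 x.
  move=> hx h; apply: ounit_archimedean => // r /h.
  by rewrite -unit_mxZ.
have [F [F_pos F1 FX]] := @separating_state R W (@adj_mx R V n) (@mxpos R V n.+1)
  (ounit%:M : W) (@adj_mxD R V n) (@adj_mxZ R V n) (@adj_mxK R V n)
  (@mxpos_adj R V n.+1) (@mxposD R V n.+1) posZ pos_unit order arch X hX nX.
pose tr (Y : W) : R[i] := \sum_k F ((Y k k)%:M : W).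
have tr_lin c (Y Z : W) : tr (c *: Y + Z) = c * tr Y + tr Z.
  rewrite /tr mulr_sumr -big_split; apply: eq_bigr => k _ /=.
  have e : (((c *: Y + Z) k k)%:M : W) = c *: ((Y k k)%:M : W) + ((Z k k)%:M : W).
    by apply/(@matrixP V n.+1 n.+1) => i j; rewrite !mxE mulrnDl scalerMnr.
  by rewrite e; exact: linearP.
have tr_pos (Y : 'M[V]_n.+1) : mxpos Y -> 0 <= tr Y.
  by move=> hY; apply: sumr_ge0 => k _; exact/F_pos/mxpos_diag.
pose g := complex.Re (F X : R[i]); pose t := complex.Re (tr X).
have g0 : g < 0 by move: FX; rewrite ltcE => /andP[].
(* Small enough that [d |t| < - g], so that the perturbed functional stays negative at [X]. *)
pose d : R := - g / (2 * (`|t| + 1)).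
have d0 : 0 < d by rewrite divr_gt0 ?oppr_gt0 // mulr_gt0 // ltr_wpDl.
have dt : g + d * t < 0.
  have h1 : d * (2 * (`|t| + 1)) = - g by rewrite divfK // lt0r_neq0 // mulr_gt0 // ltr_wpDl.
  have h2 : d * t <= d * `|t| by rewrite ler_pM2l // ler_norm.
    by lra.
have G_lin : linear (fun Y : W => F Y + d%:C * tr Y : R[i]^o).
  move=> c Y Z; rewrite tr_lin linearP scalerDr addrACA; congr (_ + _).
  by rewrite mulrDr mulrCA.
pose G : {linear W -> R[i]^o} := HB.pack (fun Y : W => F Y + d%:C * tr Y : R[i]^o)
  (GRing.isLinear.Build R[i] W R[i]^o _ (fun Y : W => F Y + d%:C * tr Y : R[i]^o) G_lin).
have dC : 0 < d%:C :> R[i] by rewrite ltcR.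
have G_pos (Y : 'M[V]_n.+1) : mxpos Y -> 0 <= (G Y : R[i]).
  move=> hY; apply: addr_ge0; first exact: F_pos.
  by apply: mulr_ge0; [exact: ltW | exact: tr_pos].
have GX : ~ 0 <= (G X : R[i]).
  rewrite lecE => /andP[_ h].
  have e : complex.Re (G X : R[i]) = g + d * t.
    rewrite /G /= /g /t; case: (F X : R[i]) => a b; case: (tr X) => a' b' /=.
    by rewrite mul0r subr0.
  by move: h; rewrite e leNgt dt.
pose phi : {linear V -> cmx C n} := fun_mx G.
pose P := phi ounit.
have pP : pos P.
  apply/cstar_mxpos11; have h1 : mxpos (ounit%:M : 'M[V]_1).
    by have := @mxpos_unit R V 1 1 ler01; rewrite scale1r.
  have := fun_mx_cp G_pos h1; congr cstar_mxpos.
  by apply/matrixP => i j; rewrite !mxE linearMn.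
(* Both summands of [G] are nonnegative at the compressed unit, so [tr] vanishes there; its k-th
   term is the squared modulus of [u k 0]. *)
have Pdef (u : 'cV[C]_n.+1) : ip u ((P : 'M[C]_n.+1) *m u) = 0 -> u = 0.
  have := @fun_mx_form R V n G 1 (ounit%:M) 1%:M u.
  have -> : ip 1%:M (map_mx (fun_mx G) ounit%:M *m 1%:M) = P.
    by rewrite /ip mulmx1 madj_scalar star1 mul1mx !mxE eqxx !mulr1n.
  rewrite (_ : \matrix_(p, k) _ = \matrix_(p, k) (u k 0 : R[i])); last first.
    apply/matrixP => p k; rewrite [LHS]mxE [RHS]mxE ord1 [X in (X *m _) _ _]mxE eqxx.
    exact: (congr1 (fun N : 'cV[C]_n.+1 => N k 0) (mul1mx u)).
  move=> -> GZ.
  set Z := compress _ _ in GZ.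
  have hZ : mxpos Z.
    apply: mxpos_compress; have := @mxpos_unit R V 1 1 ler01.
    by rewrite scale1r.
  have /eqP : (F Z : R[i]) + d%:C * tr Z = 0 := GZ.
  rewrite paddr_eq0; [|exact: F_pos|by apply: mulr_ge0; [exact: ltW | exact: tr_pos]].
  case/andP => _; rewrite mulf_eq0 (gt_eqF dC) /= psumr_eq0 => [/allP trZ|k _]; last first.
    exact/F_pos/mxpos_diag.
  apply/matrixP => k z; rewrite ord1 [RHS]mxE.
  have := trZ k (mem_index_enum k); rewrite /=.
  have -> : ((Z k k)%:M : W) = ((u k 0 : R[i])^*%C * (u k 0 : R[i])) *: (ounit%:M : W).
    apply/(@matrixP V n.+1 n.+1) => i j; rewrite !mxE !big_ord1 !mxE eqxx mulr1n.
    by rewrite scalerMnr.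
  have FZ c (Y : W) : (F (c *: Y) : R[i]) = c * (F Y : R[i]) by exact: linearZ.
  by rewrite FZ F1 mulr1 mulf_eq0 conjc_eq0 orbb => /eqP.
have [h [sh hPh hP]] := pos_definite_inverse_sqrt pP Pdef.
have psi_lin : linear (fun x : V => h * phi x * h : cmx C n).
  move=> c x y; rewrite linearP mulrDr mulrDl; congr (_ + _).
  by rewrite -scalerAr -scalerAl.
pose psi : {linear V -> cmx C n} := HB.pack (fun x : V => h * phi x * h : cmx C n)
  (GRing.isLinear.Build R[i] V (cmx C n) _ (fun x : V => h * phi x * h : cmx C n) psi_lin).
have psiE m (Y : 'M[V]_m) : map_mx psi Y = madj (h%:M) *m map_mx phi Y *m h%:M.
  by apply/matrixP => i j; rewrite madj_scalar sh scalar_conj_mx !mxE.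
exists psi; split.
- by move=> m Y /(fun_mx_cp G_pos) hY; rewrite psiE; exact: cstar_mxpos_conj.
- exact: hPh.
(* [P * h] is the inverse of [h], so this conjugation undoes the normalization and returns to
   [phi]. *)
- move=> /(cstar_mxpos_conj (P * h)%:M) hX'; apply: GX; apply: (@fun_mx_reflects R V n G X).
  move: hX'; congr cstar_mxpos.
  apply/matrixP => i j; rewrite madj_scalar starM sh (pos_sa pP) scalar_conj_mx !mxE.
  have e1 : P * h * h = 1 by rewrite -hP hPh.
  rewrite hP.
  have -> : P * h * (h * phi (X i j) * h) * (P * h) = (P * h * h) * phi (X i j) * (h * P * h).
    by rewrite !mulrA.
  by rewrite e1 hPh mul1r mulr1.
Qed.
End Normalization.

(** * Embedding an operator system in a C*-algebra *)

Section Embedding.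
Context {R : realType}.

Lemma cnorm_le_of_pos {A : cstarAlgType R} (a : A) (t : R) : 0 <= t ->
  pos (rscal t + a) -> pos (rscal t - a) -> cnorm a <= t + t + t.
Proof.
move=> t0 h1 h2; have h3 : cnorm (rscal t + a) <= t + t.
  apply: pos_norm_le => //; first exact: addr_ge0.
  by rewrite rscalD opprD addrA addrK.
have -> : a = (rscal t + a) - rscal t by rewrite addrAC subrr add0r.
rewrite (le_trans (cnormB _ _)) // cnorm_rscal ger0_norm //.
by rewrite lerD2r.
Qed.

(** The bound is uniform over all targets and maps, so that evaluation at [x] is a bounded family.
    For hermitian [x] it comes from the order unit, and in general from real and imaginary parts. *)
Lemma ucp_bounded (V : opSystemType R) (x : V) : exists M : R,
  forall (A : cstarAlgType R) (psi : {linear V -> A}),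
    completely_positive (@mxpos R V) (@cstar_mxpos R A) psi -> psi ounit = 1 ->
    cnorm (psi x) <= M.
Proof.
have adjN (y : V) : adj (- y) = - adj y by exact: (@padjN R V (os_preos V)).
have herm_case (y : V) : adj y = y -> exists M : R,
    forall (A : cstarAlgType R) (psi : {linear V -> A}),
    completely_positive (@mxpos R V) (@cstar_mxpos R A) psi -> psi ounit = 1 ->
    cnorm (psi y) <= M.
  move=> hy; have hNy : adj (- y) = - y by rewrite adjN hy.
  have [r r0 h1] := @ounit_order R V _ _ (@herm_scalar R V (os_preos V) y hy).
  have [s s0 h2] := @ounit_order R V _ _ (@herm_scalar R V (os_preos V) _ hNy).
  pose t := r + s; exists (t + t + t) => A psi hpsi psi1.
  have rt : r <= t by rewrite lerDl ltW.
  have st : s <= t by rewrite lerDr ltW.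
  have {}h1 := hpsi _ _ (@punit_order_ge R V (os_preos V) _ _ _ _ rt h1).
  have {}h2 := hpsi _ _ (@punit_order_ge R V (os_preos V) _ _ _ _ st h2).
  have e z : map_mx psi ((t%:C *: ounit)%:M + z%:M : 'M_1) = (rscal t + psi z)%:M.
    apply/matrixP => i k; rewrite !mxE !ord1 eqxx !mulr1n linearD linearZ /=.
    by rewrite psi1.
  move: h1; rewrite [map_mx _ _]e => /cstar_mxpos11 h1.
  move: h2; rewrite [map_mx _ _]e linearN => /cstar_mxpos11 h2.
  by apply: cnorm_le_of_pos => //; rewrite addr_ge0 // ltW.
have h1 : adj (x + adj x) = x + adj x by rewrite adjD adjK addrC.
have h2 : adj ('i%C *: (x - adj x)) = 'i%C *: (x - adj x).
  by rewrite Defs.adjZ conjC_i adjD adjN adjK -scalerN opprB.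
have [M hM] := herm_case _ h1; have [N hN] := herm_case _ h2.
exists (M + N) => A psi hpsi psi1.
have := hM _ psi hpsi psi1; have := hN _ psi hpsi psi1.
rewrite linearZ cnorm_i linearB linearD => e2 e1.
have e3 : (2 : R) * cnorm (psi x) <= M + N.
  rewrite -[X in X * _](@ger0_norm R) // -cnormZr.
  have -> : (2 : R)%:C *: psi x = (psi x + psi (adj x)) + (psi x - psi (adj x)).
    by rewrite addrACA subrr addr0 -mulr2n -scaler_nat rmorph_nat.
  by rewrite (le_trans (cnormD _ _)) // lerD.
have := cnorm_ge0 (psi x); lra.
Qed.

Section UcpFamily.
Variable V : opSystemType R.
Hypothesis V_neq0 : (ounit : V) <> 0.

Definition ucp_index := {n : nat & {psi : {linear V -> cmx (ccomplex R) n} |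
  completely_positive (@mxpos R V) (@cstar_mxpos R (cmx (ccomplex R) n)) psi /\
  psi ounit = 1}}.

Lemma not_mxpos_separated n (X : 'M[V]_n) : (map_mx adj X)^T = X -> ~ mxpos X ->
  exists k : ucp_index, ~ cstar_mxpos (map_mx (sval (projT2 k)) X).
Proof.
case: n X => [|n] X hX nX.
  by case: nX; rewrite [X]flatmx0; exact: mxpos0.
have [psi [h1 h2 h3]] := separating_ucp hX nX.
by exists (existT _ n (exist _ psi (conj h1 h2))).
Qed.

Lemma ucp_index_inhabited : exists k : ucp_index, True.
Proof.
have adjN (y : V) : adj (- y) = - adj y by exact: (@padjN R V (os_preos V)).
have hN : adj (- (ounit : V)) = - ounit by rewrite adjN ounit_adj.
have [|k _] := @not_mxpos_separated 1 (- ounit)%:M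
    (@herm_scalar R V (os_preos V) _ hN); last by exists k.
move=> h; apply: V_neq0.
have := @mxpos_unit R V 1 1 ler01; rewrite scale1r => h1.
rewrite raddfN /= in h; have := @mxpos_proper R V _ _ h1 h.
by move/matrixP/(_ 0 0); rewrite !mxE eqxx mulr1n.
Qed.

(** The product of all unital completely positive maps into scalar matrix algebras; by
    [separating_ucp] it detects every hermitian matrix that is not positive. *)
Theorem cstar_embedding_exists : exists (D : cstarAlgType R) (j : {linear V -> D}),
  cstar_embedding j.
Proof.
have [k0 _] := ucp_index_inhabited.
pose F := @CFamily R ucp_index k0 (fun k => cmx (ccomplex R) (projT1 k)).
have jb x : exists M : R, forall k : cindex F, cnorm (sval (projT2 k) x : F k) <= M.
  have [M hM] := ucp_bounded x; exists M => -[n [psi [h1 h2]]] /=.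
  exact: hM.
pose jf x : bounded_family F := BoundedFamily (jb x).
have j_lin : linear jf.
  by move=> c x y; apply: bfam_ext => -[n [psi h]] /=; exact: linearP.
pose j : {linear V -> bounded_family F} := HB.pack jf
  (GRing.isLinear.Build R[i] V (bounded_family F) _ jf j_lin).
have jk k n (X : 'M[V]_n) : map_mx (fun x : bounded_family F => x k) (map_mx j X) =
    map_mx (sval (projT2 k)) X.
  by apply/matrixP => p q; rewrite !mxE.
have j_cp : completely_positive (@mxpos R V) (@cstar_mxpos R (bounded_family F)) j.
  move=> n X hX; apply/bfam_mxpos => k; rewrite jk.
  by case: (svalP (projT2 k)) => h _; exact: h.
have j_refl n (X : 'M[V]_n) : (map_mx adj X)^T = X ->
    cstar_mxpos (map_mx j X) -> mxpos X.
  move=> hX h; apply: contrapT => nX.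
  have [k] := not_mxpos_separated hX nX; apply.
  by rewrite -jk; exact: (proj2 (bfam_mxpos _) h k).
have j_inj : injective j.
  exact: (@os_reflects_inj R V (cstar_os (bounded_family F)) j).
exists (bounded_family F), j; split; last first.
  by apply: bfam_ext => -[n [psi [h1 h2]]] /=.
split => // n X h; apply: j_refl => //; apply/matrixP => p q; apply: j_inj.
rewrite !mxE [LHS](@os_cp_adj R V (cstar_os (bounded_family F)) j) //.
by have /matrixP/(_ p q) := cstar_mxpos_sa h; rewrite madjE !mxE.
Qed.
End UcpFamily.
End Embedding.

Section UnitalCompletelyPositive.
Context {R : realType} {A B : cstarAlgType R} (f : {linear A -> B}).
Hypothesis f_cp : completely_positive (@cstar_mxpos R A) (@cstar_mxpos R B) f.

Lemma cp_star x : f (star x) = star (f x).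
Proof. exact: (@os_cp_adj R (cstar_os A) (cstar_os B) f). Qed.

Lemma cp_pos x : pos x -> pos (f x).
Proof.
move=> /cstar_mxpos11 /f_cp; rewrite (_ : map_mx f _ = (f x)%:M) => [/cstar_mxpos11 //|].
by apply/matrixP => i k; rewrite !mxE linearMn.
Qed.

Hypothesis f1 : f 1 = 1.

Lemma ucp_schwarz x : pos (f (star x * x) - star (f x) * f x).
Proof.
pose Y : 'M[A]_(1, 2) := \row_k (if k == 0 then 1 else x).
have /f_cp/cstar_mxposP [_ h] := cstar_mxpos_mul Y.
pose v : 'cV[B]_2 := \col_k (if k == 0 then - f x else 1).
have := h v; congr pos; rewrite ipE !big_ord_recl big_ord0 !mxE /=.
rewrite !big_ord_recl !big_ord0 !mxE /= !big_ord_recl !big_ord0 !madjE !mxE /=.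
rewrite !addr0 !star1 !mul1r !mulr1 f1 mul1r cp_star addNr mulr0 add0r.
by rewrite mulrN addrC.
Qed.

Lemma ucp_contractive x : cnorm (f x) <= cnorm x.
Proof.
rewrite -(@ler_pXn2r _ 2) ?nnegrE ?cnorm_ge0 // -!cnorm_cstar.
rewrite (le_trans (pos_le_norm (pos_star_mul _) (ucp_schwarz x))) //.
apply: pos_norm_le; first exact: cnorm_ge0.
  by apply: cp_pos; exact: pos_star_mul.
have -> : rscal (cnorm (star x * x)) - f (star x * x) =
    f (rscal (cnorm (star x * x)) - star x * x).
  by rewrite linearB linearZ /= f1.
apply: cp_pos; apply: pos_norm_sub => //.
by rewrite starM starK.
Qed.
End UnitalCompletelyPositive.

(** * The Choi-Effros product and the two envelopes *)

(** Divide by [t] and let [t] grow: [K / t] becomes smaller than any [r]. *)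
Lemma pos_of_affine {R : realType} {A : cstarAlgType R} (K H : A) :
  star K = K -> star H = H -> (forall t : R, 0 < t -> pos (K + t%:C *: H)) -> pos H.
Proof.
move=> sK sH h; apply: pos_archimedean => // r r0.
have k0 : 0 < cnorm K + 1 by rewrite ltr_wpDl ?cnorm_ge0.
pose t := (cnorm K + 1) / r; have t0 : 0 < t by rewrite divr_gt0.
have -> : rscal r + H = (rscal r - t^-1%:C *: K) + t^-1%:C *: (K + t%:C *: H).
  by rewrite scalerDr realZKV ?lt0r_neq0 // addrA subrK.
apply: posD; last by apply: posZ; [rewrite invr_ge0 ltW | exact: h].
apply: pos_norm_sub; first by rewrite starZr sK.
rewrite cnormZr gtr0_norm ?invr_gt0 // ler_pdivrMl // /t divfK ?lt0r_neq0 //.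
by rewrite lerDl.
Qed.

Lemma affine_pos_eq0 {R : realType} {A : cstarAlgType R} (K H : A) :
  (forall t : R, pos (K + t%:C *: H)) -> H = 0.
Proof.
move=> h; have sK : star K = K.
  by have := pos_sa (h 0); rewrite scale0r addr0.
have sH : star H = H.
  by have := pos_sa (h 1); rewrite scale1r starD sK => /addrI.
apply: pos_proper; first exact: (pos_of_affine sK).
apply: (pos_of_affine sK) => [|t t0]; first by rewrite starN sH.
by have := h (- t); rewrite realCN scaleNr scalerN.
Qed.

(** The product on I depends on the embedding and on the retraction; bundling them lets the type
    [choi_effros d] carry the resulting structures. *)
Record retract_data (R : realType) := RetractData {
  rt_os : opSystemType R;
  rt_alg : cstarAlgType R;
  rt_j : {linear rt_os -> rt_alg};
  rt_emb : cstar_embedding rt_j;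
  rt_p : {linear rt_alg -> rt_os};
  rt_p_cp : completely_positive (@cstar_mxpos R rt_alg) (@mxpos R rt_os) rt_p;
  rt_pK : forall x, rt_p (rt_j x) = x
}.

Definition choi_effros (R : realType) (d : retract_data R) : Type := rt_os d.

Section ChoiEffros.
Context {R : realType} (d : retract_data R).
Local Notation I := (rt_os d).
Local Notation D := (rt_alg d).
Local Notation j := (rt_j d).
Local Notation p := (rt_p d).
Local Notation E := (choi_effros d).

Let j_cp : completely_positive (@mxpos R I) (@cstar_mxpos R D) j.
Proof. by case: (rt_emb d) => -[]. Qed.
Let j1 : j ounit = 1. Proof. by case: (rt_emb d). Qed.
Let p1 : p 1 = ounit. Proof. by rewrite -j1 rt_pK. Qed.

Let jA x : j (adj x) = star (j x).
Proof. exact: (@os_cp_adj R I (cstar_os D) j). Qed.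
Let pA a : p (star a) = adj (p a).
Proof. exact: (@os_cp_adj R (cstar_os D) I p (@rt_p_cp R d)). Qed.

Definition rt_proj : {linear D -> D} := j \o p.
Local Notation P := rt_proj.

Let P_cp : completely_positive (@cstar_mxpos R D) (@cstar_mxpos R D) P.
Proof.
move=> n X /(@rt_p_cp R d) /j_cp; congr cstar_mxpos.
by apply/matrixP => i k; rewrite !mxE.
Qed.
Let P1 : P 1 = 1. Proof. by rewrite /= p1 j1. Qed.
Let Pj x : P (j x) = j x. Proof. by rewrite /= rt_pK. Qed.
Let PP a : P (P a) = P a. Proof. exact: Pj. Qed.
Let pP a : p (P a) = p a. Proof. by rewrite /= rt_pK. Qed.

(* Expanding the Schwarz inequality at [t y + a] and applying the projection once
   more removes the terms quadratic in [t]. *)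
Let proj_mul0 y a : P y = y -> P a = 0 -> P (star y * a) = 0.
Proof.
move=> Py Pa; pose H b := P (star y * b + star b * y).
have H0 b : P b = 0 -> H b = 0.
  move=> Pb; apply: (@affine_pos_eq0 _ _ (P (star b * b))) => t.
  have := cp_pos P_cp (ucp_schwarz P_cp P1 (t%:C *: y + b)).
  have -> : P (t%:C *: y + b) = t%:C *: y by rewrite linearD linearZ Pb addr0 Py.
  rewrite linearB PP -linearB; congr pos; rewrite /H -linearZ -linearD; congr (P _).
  rewrite starD starZr !mulrDl !mulrDr -!scalerAl -!scalerAr scalerDr.
  by ncring.
have h1 := H0 a Pa.
(* Replacing [a] by [i a] turns the sum [y^* a + a^* y] into a difference, so each term is killed
   separately. *)
have Pia : P ('i%C *: a) = 0 by rewrite linearZ Pa /= scaler0.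
have h2 := H0 _ Pia.
have {}h2 : P (star y * a) = P (star a * y).
  have e : star y * ('i%C *: a) + star ('i%C *: a) * y = 'i%C *: (star y * a - star a * y).
    by rewrite star_i mulNr -scalerAl -scalerAr scalerBr.
  move: h2; rewrite /H e linearZ -(scaler0 _ 'i%C) => /(scalerI i_neq0).
  by rewrite linearB => /subr0_eq.
move: h1; rewrite /H linearD -h2 => h1.
by apply: addxx_inj; rewrite h1 addr0.
Qed.

Let proj_mulr y a : P y = y -> P (star y * P a) = P (star y * a).
Proof.
move=> Py; apply/eqP; rewrite eq_sym -subr_eq0 -linearB -mulrBr; apply/eqP.
by apply: proj_mul0 => //; rewrite linearB PP subrr.
Qed.

Let PS a : P (star a) = star (P a). Proof. by rewrite /= pA jA. Qed.

Let p_mulr x a : p (j x * P a) = p (j x * a).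
Proof.
have e : j x = star (j (adj x)) by rewrite jA starK.
by rewrite -pP {1}e proj_mulr ?Pj // -e pP.
Qed.

Let p_mull x a : p (P a * j x) = p (a * j x).
Proof.
have := congr1 adj (p_mulr (adj x) (star a)).
by rewrite -!pA !starM jA PS !starK.
Qed.

HB.instance Definition _ := GRing.Lmodule.copy E I.

Let ce_mul (x y : E) : E := p (j x * j y).
Let ce_one : E := ounit.

Let ce_mulA : associative ce_mul.
Proof.
move=> x y z; rewrite /ce_mul -[j (p (j y * _))]/(P (j y * j z)).
by rewrite -[j (p (j x * _))]/(P (j x * j y)) p_mulr p_mull mulrA.
Qed.
Let ce_mul1 : left_id ce_one ce_mul.
Proof. by move=> x; rewrite /ce_mul j1 mul1r rt_pK. Qed.
Let ce_mulr1 : right_id ce_one ce_mul.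
Proof. by move=> x; rewrite /ce_mul j1 mulr1 rt_pK. Qed.
Let ce_mulDl : left_distributive ce_mul +%R.
Proof. by move=> x y z; rewrite /ce_mul !linearD mulrDl linearD. Qed.
Let ce_mulDr : right_distributive ce_mul +%R.
Proof. by move=> x y z; rewrite /ce_mul !linearD mulrDr linearD. Qed.
Let ce_one_neq0 : ce_one != 0.
Proof.
apply/eqP => h; have /eqP := j1; rewrite -[ounit]/(ce_one) h.
by rewrite [j 0]linear0 eq_sym oner_eq0.
Qed.
HB.instance Definition _ := GRing.Zmodule_isNzRing.Build E ce_mulA ce_mul1 ce_mulr1
  ce_mulDl ce_mulDr ce_one_neq0.
Let ce_scaleAl (c : R[i]) (x y : E) : c *: (x * y) = (c *: x) * y.
Proof. by rewrite [RHS]/(ce_mul _ _) /ce_mul linearZ -scalerAl linearZ. Qed.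
HB.instance Definition _ := GRing.Lmodule_isLalgebra.Build R[i] E ce_scaleAl.
Let ce_scaleAr (c : R[i]) (x y : E) : c *: (x * y) = x * (c *: y).
Proof. by rewrite [RHS]/(ce_mul _ _) /ce_mul linearZ -scalerAr linearZ. Qed.
HB.instance Definition _ := GRing.Lalgebra_isAlgebra.Build R[i] E ce_scaleAr.

Let ce_star (x : E) : E := adj (x : I).
Let ce_norm (x : E) : R := cnorm (j x).
Let ce_starD (x y : E) : ce_star (x + y) = ce_star x + ce_star y.
Proof. exact: adjD. Qed.
Let ce_starZ (c : R[i]) (x : E) : ce_star (c *: x) = c^*%C *: ce_star x.
Proof. exact: Defs.adjZ. Qed.
Let ce_starM (x y : E) : ce_star (x * y) = ce_star y * ce_star x.
Proof. by rewrite /ce_star [x * y]/(ce_mul _ _) /ce_mul -pA starM -!jA. Qed.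
Let ce_starK (x : E) : ce_star (ce_star x) = x.
Proof. exact: adjK. Qed.
Let ce_norm_eq0 (x : E) : ce_norm x = 0 -> x = 0.
Proof. by move=> /cnorm0_eq0 h; rewrite -[x](@rt_pK R d) h [p 0]linear0. Qed.
Let ce_normD (x y : E) : ce_norm (x + y) <= ce_norm x + ce_norm y.
Proof. by rewrite /ce_norm [j _]linearD cnormD. Qed.
Let ce_normZ (c : R[i]) (x : E) : (ce_norm (c *: x))%:C = `|c| * (ce_norm x)%:C.
Proof. by rewrite /ce_norm [j _]linearZ cnormZ. Qed.
Let ce_normM (x y : E) : ce_norm (x * y) <= ce_norm x * ce_norm y.
Proof.
rewrite /ce_norm -[j (x * y)]/(P (j x * j y)).
by rewrite (le_trans (ucp_contractive P_cp P1 _)) // cnormM.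
Qed.
Let ce_complete (u : nat -> E) :
  (forall e : R, 0 < e -> exists N, forall m n, (N <= m)%N -> (N <= n)%N ->
    ce_norm (u m - u n) < e) ->
  exists x, forall e : R, 0 < e -> exists N, forall n, (N <= n)%N ->
    ce_norm (u n - x) < e.
Proof.
move=> hu; have [|a ha] := @cnorm_complete R D (fun n => j (u n)).
  by move=> e /hu [N hN]; exists N => m n Nm Nn; rewrite -linearB; exact: hN.
exists (p a) => e /ha [N hN]; exists N => n /hN; apply: le_lt_trans.
rewrite /ce_norm [j _]linearB -[j (p a)]/(P a) -[j (u n)]Pj -linearB.
by rewrite (le_trans (ucp_contractive P_cp P1 _)) // Pj.
Qed.
Let ce_cstar (x : E) : ce_norm (ce_star x * x) = ce_norm x ^+ 2.
Proof.
rewrite /ce_norm -[j (_ * x)]/(P (j (adj x) * j x)) jA -cnorm_cstar.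
apply/eqP; rewrite eq_le (ucp_contractive P_cp P1) /=.
apply: pos_le_norm; first exact: pos_star_mul.
by have := ucp_schwarz P_cp P1 (j x); rewrite Pj.
Qed.
HB.instance Definition _ := isCStarAlgebra.Build R E ce_starD ce_starZ ce_starM
  ce_starK ce_norm_eq0 ce_normD ce_normZ ce_normM ce_complete ce_cstar.

Lemma ce_mulE (x y : E) : x * y = p (j x * j y). Proof. by []. Qed.

Lemma ce_pos (x : E) : pos (j x) -> pos x.
Proof.
move=> [sx [t t0 ht]]; split.
  by apply: (can_inj (@rt_pK R d)); rewrite -sx -jA.
exists t => //; rewrite -[cnorm _]/(cnorm (j (t%:C *: ounit - x))) linearB linearZ.
by rewrite j1.
Qed.

(** For positive [X], the embedding sends the form of the new product at [v] to the projection of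
    the form in D at [j v], which is positive. *)
Lemma ce_mxpos n (X : 'M[I]_n) : mxpos X <-> cstar_mxpos (X : 'M[E]_n).
Proof.
split=> [hX|[Y ->]]; last first.
  have hY := rt_p_cp (cstar_mxpos_mul (map_mx j (Y : 'M[I]_n))).
  move: hY; congr mxpos; apply/matrixP => i k; rewrite !mxE linear_sum.
  by apply: eq_bigr => l _; rewrite !mxE ce_mulE -jA.
apply/cstar_mxposP; split.
  by have := mxpos_adj _ _ hX.
move=> v; apply: ce_pos.
pose w : 'cV[D]_n := map_mx j (v : 'cV[I]_n); pose Y := map_mx j (X : 'M[I]_n).
have jXv i : j (((X : 'M[E]_n) *m v) i 0) = P ((Y *m w) i 0).
  rewrite /=; congr (j _); rewrite !mxE linear_sum; apply: eq_bigr => k _.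
  by rewrite ce_mulE !mxE.
have -> : j (ip v ((X : 'M[E]_n) *m v)) = P (ip w (Y *m w)).
  rewrite [RHS]/=; congr (j _); rewrite !ipE linear_sum; apply: eq_bigr => i _.
  by rewrite ce_mulE [star (v i 0)]/(adj (v i 0 : I)) jXv p_mulr jA [w i 0]mxE.
apply: (cp_pos P_cp).
have /cstar_mxposP [_ h] := j_cp hX.
exact: h.
Qed.
End ChoiEffros.

Record star_subalgebra (R : realType) := StarSubalgebra {
  ss_alg : cstarAlgType R;
  ss_set : set ss_alg;
  ss_closed : closed_star_subalgebra ss_set
}.

Definition ss_pred (R : realType) (d : star_subalgebra R) : {pred ss_alg d} :=
  fun x => `[< ss_set (s := d) x >].
Arguments ss_pred {R} d x.

Record ss_type (R : realType) (d : star_subalgebra R) := SSType {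
  ss_val : ss_alg d;
  ss_valP : ss_val \in ss_pred d
}.

Section StarSubalgebraCStar.
Context {R : realType} (d : star_subalgebra R).
Local Notation E := (ss_alg d).
Local Notation B := (ss_type d).

Let ss_subalg : subalg_closed (ss_pred d).
Proof.
have [_ h1 hlin hmul _] := ss_closed d.
split.
- exact/asboolP.
- by move=> c x y /asboolP hx /asboolP hy; apply/asboolP; exact: hlin.
- by move=> x y /asboolP hx /asboolP hy; apply/asboolP; exact: hmul.
Qed.
HB.instance Definition _ := GRing.isSubalgClosed.Build R[i] E (ss_pred d) ss_subalg.
HB.instance Definition _ := [isSub for @ss_val R d].
HB.instance Definition _ := [Choice of B by <:].
HB.instance Definition _ := [SubChoice_isSubAlgebra of B by <:].

Lemma ss_val_inj : injective (@ss_val R d). Proof. exact: val_inj. Qed.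
Lemma ss_valS (x : B) : ss_set (ss_val x). Proof. exact/asboolP/ss_valP. Qed.
Definition ss_of (x : E) (hx : ss_set (s := d) x) : B := SSType (asboolT hx).

Lemma ss_star_subproof (x : B) : ss_set (star (ss_val x)).
Proof. by have [_ _ _ _ hs] := ss_closed d; apply: hs; exact: ss_valS. Qed.
Let sstar (x : B) : B := ss_of (ss_star_subproof x).
Let snorm (x : B) : R := cnorm (ss_val x).

Let sstarD (x y : B) : sstar (x + y) = sstar x + sstar y.
Proof. by apply: ss_val_inj; exact: starD. Qed.
Let sstarZ (c : R[i]) (x : B) : sstar (c *: x) = c^*%C *: sstar x.
Proof. by apply: ss_val_inj; exact: starZ. Qed.
Let sstarM (x y : B) : sstar (x * y) = sstar y * sstar x.
Proof. by apply: ss_val_inj; exact: starM. Qed.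
Let sstarK (x : B) : sstar (sstar x) = x.
Proof. by apply: ss_val_inj; exact: starK. Qed.
Let snorm_eq0 (x : B) : snorm x = 0 -> x = 0.
Proof. by move=> /cnorm0_eq0 h; apply: ss_val_inj. Qed.
Let snormD (x y : B) : snorm (x + y) <= snorm x + snorm y. Proof. exact: cnormD. Qed.
Let snormZ (c : R[i]) (x : B) : (snorm (c *: x))%:C = `|c| * (snorm x)%:C.
Proof. exact: cnormZ. Qed.
Let snormM (x y : B) : snorm (x * y) <= snorm x * snorm y. Proof. exact: cnormM. Qed.
Let snorm_cstar (x : B) : snorm (sstar x * x) = snorm x ^+ 2.
Proof. exact: cnorm_cstar. Qed.
Let scomplete (u : nat -> B) :
  (forall e : R, 0 < e -> exists N, forall m n, (N <= m)%N -> (N <= n)%N ->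
    snorm (u m - u n) < e) ->
  exists x, forall e : R, 0 < e -> exists N, forall n, (N <= n)%N ->
    snorm (u n - x) < e.
Proof.
move=> hu; have [x hx] := @cnorm_complete R E (fun n => ss_val (u n)) hu.
have Bx : ss_set x.
  have [hcl _ _ _ _] := ss_closed d; apply: hcl => e /hx [N /(_ N (leqnn N)) h].
  by exists (ss_val (u N)); [exact: ss_valS | rewrite cnormBC].
by exists (ss_of Bx).
Qed.
HB.instance Definition _ := isCStarAlgebra.Build R B sstarD sstarZ sstarM sstarK
  snorm_eq0 snormD snormZ snormM scomplete snorm_cstar.

Lemma ss_val_linear : linear (@ss_val R d). Proof. by []. Qed.
HB.instance Definition _ := GRing.isLinear.Build R[i] B E _ (@ss_val R d) ss_val_linear.
End StarSubalgebraCStar.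

Section GeneratedSubalgebra.
Context {R : realType} {E : cstarAlgType R} (G : set E).

Definition generated : set E :=
  [set x | forall B : set E, closed_star_subalgebra B -> G `<=` B -> B x].

Lemma generated_closed : closed_star_subalgebra generated.
Proof.
split.
- move=> x hx B hB GB; have [hcl _ _ _ _] := hB; apply: hcl => e /hx [y hy xy].
  by exists y => //; exact: hy.
- by move=> B [].
- by move=> c x y hx hy B hB GB; have [_ _ h _ _] := hB; apply: h; [exact: hx|exact: hy].
- by move=> x y hx hy B hB GB; have [_ _ _ h _] := hB; apply: h; [exact: hx|exact: hy].
- by move=> x hx B hB GB; have [_ _ _ _ h] := hB; apply: h; exact: hx.
Qed.

Lemma sub_generated : G `<=` generated.
Proof. by move=> x Gx B _; exact. Qed.
End GeneratedSubalgebra.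

Section InjectiveIsCStar.
Context {R : realType}.

(** Extending the identity of I along an embedding into a C*-algebra gives the retraction. The maps
    [e] and [e'] are identities of the underlying space, so that the two structures are not
    confused. *)
Lemma injective_os_cstar (I : opSystemType R) : injective_os I -> (ounit : I) <> 0 ->
  exists (E : cstarAlgType R) (e : {linear I -> E}) (e' : {linear E -> I}),
  [/\ cancel e e', cancel e' e,
      forall n (X : 'M[I]_n), mxpos X <-> cstar_mxpos (map_mx e X) & e ounit = 1].
Proof.
move=> I_inj I_neq0; have [D [j hj]] := cstar_embedding_exists I_neq0.
have hj' : @os_embedding R I (cstar_os D) j by exact: hj.
have [p p_cp pK] := I_inj I (cstar_os D) j hj' idfun (@os_cp_id R I).
pose d := @RetractData R I D j hj p p_cp pK.
pose e : {linear I -> choi_effros d} := HB.pack (fun x : I => x : choi_effros d)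
  (GRing.isLinear.Build R[i] I (choi_effros d) _ (fun x : I => x : choi_effros d)
     (fun _ _ _ => erefl)).
pose e' : {linear choi_effros d -> I} := HB.pack (fun x : choi_effros d => x : I)
  (GRing.isLinear.Build R[i] (choi_effros d) I _ (fun x : choi_effros d => x : I)
     (fun _ _ _ => erefl)).
exists (choi_effros d), e, e'; split => // n X.
have -> : map_mx e X = X by apply/matrixP => i k; rewrite mxE.
exact: (@ce_mxpos R d n X).
Qed.
End InjectiveIsCStar.

Section EnvelopeComparison.
Context {R : realType} {S I : opSystemType R} (iota : {linear S -> I}).
Context {A : cstarAlgType R} (iota_e : {linear S -> A}).
Hypothesis hI : injective_envelope iota.
Hypothesis hA : cstar_envelope iota_e.

Let I_inj : injective_os I. Proof. by case: hI. Qed.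
Let iota_emb : os_embedding iota. Proof. by case: hI. Qed.
Let iota_cp : os_cp iota. Proof. by case: iota_emb => -[]. Qed.
Let I_min : forall (Q : opSystemType R) (j : {linear Q -> I}),
  os_embedding j -> range iota `<=` range j -> injective_os Q -> range j = setT.
Proof. by case: hI. Qed.
Let iota_e_emb : @os_embedding R S (cstar_os A) iota_e. Proof. by case: hA. Qed.

Let I_neq0 : (ounit : I) <> 0.
Proof.
have [[inj _ _] i1] := iota_emb; have [_ a1] := iota_e_emb.
rewrite -i1 -[X in _ <> X](linear0 iota) => /inj h.
have := a1; rewrite h [iota_e 0]linear0 => /esym/eqP.
by rewrite oner_eq0.
Qed.

(** Let B be the subalgebra of E generated by S, with [pi : B -> A] from the universal property and
    [psi : A -> I] an extension of [iota]. Rigidity forces [psi \o pi] to be the inclusion of B, so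
    [e \o psi] inverts [pi] and inherits multiplicativity from it. *)
Lemma envelope_comparison : exists (E : cstarAlgType R) (e : {linear I -> E})
    (e' : {linear E -> I}) (rho : {linear A -> E}),
  [/\ [/\ cancel e e', cancel e' e,
      forall n (X : 'M[I]_n), mxpos X <-> cstar_mxpos (map_mx e X) & e ounit = 1],
      [/\ forall x y, rho (x * y) = rho x * rho y,
          forall x, rho (star x) = star (rho x), rho 1 = 1 & injective rho] &
      forall x, rho (iota_e x) = e (iota x)].
Proof.
have [E [e [e' [eK e'K epos e1]]]] := injective_os_cstar I_inj I_neq0.
have e'pos n (X : 'M[E]_n) : cstar_mxpos X -> mxpos (map_mx e' X).
  move=> hX; apply/epos; move: hX; congr cstar_mxpos.
  by apply/matrixP => i k; rewrite !mxE e'K.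
have e'1 : e' 1 = ounit by rewrite -e1 eK.
pose G : set E := range (e \o iota).
pose d := StarSubalgebra (generated_closed G).
pose B : cstarAlgType R := ss_type d.
pose inc : {linear B -> E} := @ss_val R d.
have inc_inj : injective inc by exact: ss_val_inj.
have kG x : generated G (e (iota x)) by apply: sub_generated; exists x.
pose kf x : B := @ss_of R d (e (iota x)) (kG x).
have kf_lin : linear kf.
  by move=> c x y; apply: inc_inj; rewrite /= linearP linearP.
pose kappa : {linear S -> B} := HB.pack kf (GRing.isLinear.Build R[i] S B _ kf kf_lin).
have inck x : inc (kappa x) = e (iota x) by [].
have inckX n (X : 'M[S]_n) : map_mx inc (map_mx kappa X) = map_mx e (map_mx iota X).
  by apply/matrixP => i k; rewrite !mxE.
have incM x y : inc (x * y) = inc x * inc y by [].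
have incS x : inc (star x) = star (inc x) by [].
have [[iota_inj _ iota_refl] iota1] := iota_emb.
have kappa_emb : cstar_embedding kappa.
  split; last by apply: inc_inj; rewrite inck iota1 e1.
  split.
  - by move=> x y /(congr1 inc); rewrite !inck => /(can_inj eK) /iota_inj.
  - move=> n X /iota_cp /epos; rewrite -inckX.
    exact: (starhom_reflects incM incS inc_inj).
  - move=> n X /(starhom_cp incM incS); rewrite inckX => /epos.
    exact: iota_refl.
have kappa_gen : cstar_generates (range kappa).
  move=> B' hB' kB'; have [B'cl B'1 B'lin B'mul B'star] := hB'.
  pose C' : set E := [set inc b | b in B'].
  have C'gen : C' `<=` generated G by move=> _ [b _ <-]; exact: (ss_valS b).
  have hC' : closed_star_subalgebra C'.
    split.
    - move=> x hx; have gx : generated G x.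
        have [gcl _ _ _ _] := generated_closed G; apply: gcl => t /hx [y hy xy].
        by exists y => //; exact: C'gen.
      exists (@ss_of R d x gx) => //; apply: B'cl => t /hx [_ [b B'b <-] xb].
      by exists b.
    - by exists 1.
    - by move=> c _ _ [x hx <-] [y hy <-]; exists (c *: x + y) => //; exact: B'lin.
    - by move=> _ _ [x hx <-] [y hy <-]; exists (x * y) => //; exact: B'mul.
    - by move=> _ [x hx <-]; exists (star x) => //; exact: B'star.
  apply/seteqP; split => // b _.
  have : C' (inc b).
    apply: (ss_valS b) => // _ [x _ <-]; exists (kappa x); last exact: inck.
    by apply: kB'; exists x.
  by case=> b' hb' /inc_inj <-.
have [_ A_gen univ] := hA.
have [pi piS pik] := univ B kappa kappa_emb kappa_gen.
have [psi psi_cp psii] := I_inj iota_e_emb iota_cp.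
have pi_cp : completely_positive (@cstar_mxpos R B) (@cstar_mxpos R A) pi.
  by apply: starhom_cp => // x y; exact: rmorphM.
pose t : {linear cstar_os B -> I} := e' \o inc.
have t_emb : os_embedding t.
  have tX n (X : 'M[B]_n) : map_mx t X = map_mx e' (map_mx inc X).
    by apply/matrixP => i k; rewrite !mxE.
  split; last by rewrite /= e'1.
  split.
  - by move=> x y /(can_inj e'K) /inc_inj.
  - by move=> n X hX; rewrite tX; apply: e'pos; exact: starhom_cp.
  - move=> n X; rewrite tX => /epos hX.
    apply: (starhom_reflects incM incS inc_inj); move: hX; congr cstar_mxpos.
    by apply/matrixP => i k; rewrite !mxE e'K.
pose f : {linear cstar_os B -> I} := psi \o pi.
have f_cp : os_cp f.
  move=> n X /pi_cp /psi_cp; congr mxpos.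
  by apply/matrixP => i k; rewrite !mxE.
have [g g_cp gt] := I_inj t_emb f_cp.
(* [g] extends [psi \o pi] from B to I and fixes S. *)
have g_id : g =1 id.
  apply: (rigid iota_emb I_inj I_min g_cp) => x.
  have tk : t (kappa x) = iota x by rewrite -[LHS]/(e' (e (iota x))) eK.
  by have := gt (kappa x); rewrite tk => ->; rewrite -[LHS]/(psi (pi (kappa x))) pik psii.
have psipi b : psi (pi b) = e' (inc b).
  by rewrite -[LHS]/(f b) -gt g_id.
pose rho : {linear A -> E} := e \o psi.
have rhopi b : rho (pi b) = inc b by rewrite /= psipi e'K.
have rho_cp : completely_positive (@cstar_mxpos R A) (@cstar_mxpos R E) rho.
  move=> n X /psi_cp /epos; congr cstar_mxpos.
  by apply/matrixP => i k; rewrite !mxE.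
have pi1 : pi 1 = 1 by exact: rmorph1.
have rho1 : rho 1 = 1 by rewrite -pi1 rhopi.
(* Both [pi] and [rho] are contractive and their composite is the isometric inclusion. *)
have pi_norm b : cnorm (pi b) = cnorm b.
  apply/eqP; rewrite eq_le (ucp_contractive pi_cp pi1) /=.
  have := ucp_contractive rho_cp rho1 (pi b); rewrite rhopi; exact.
(* The range of an isometry is closed, and it contains the generators of A. *)
have pi_surj a : exists b, pi b = a.
  have hR : closed_star_subalgebra (range pi).
    split.
    - move=> x hx.
      have ex n : exists b, cnorm (x - pi b) < n.+1%:R^-1 :> R.
        have [|_ [b _ <-] hb] := hx n.+1%:R^-1; first by rewrite invr_gt0.
        by exists b.
      have [u hu] := choice ex.
      have small (r : R) : 0 < r -> exists N, forall n, (N <= n)%N ->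
          cnorm (x - pi (u n)) < r.
        move=> r0; exists (Num.truncn r^-1) => n Nn.
        rewrite (lt_trans (hu n)) // -[ltRHS]invrK ltf_pV2 ?posrE ?invr_gt0 //.
        by rewrite (lt_le_trans (truncnS_gt _)) // ler_nat.
      have [b hb] : exists b, converges u b.
        apply: cnorm_complete => r r0; have r2 : 0 < r / 2 by rewrite divr_gt0.
        have [N hN] := small _ r2; exists N => m n Nm Nn.
        rewrite -pi_norm linearB (le_lt_trans (cnorm_triangle x _ _)) //.
        by rewrite cnormBC [ltRHS]splitr ltrD ?hN.
      exists b => //; apply/eqP; rewrite -subr_eq0; apply/eqP; apply: cnorm_lt_eq0 => r r0.
      have r2 : 0 < r / 2 by rewrite divr_gt0.
      have [N hN] := small _ r2; have [M hM] := hb _ r2.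
      rewrite (le_lt_trans (cnorm_triangle (pi (u (maxn N M))) _ _)) //.
      rewrite [ltRHS]splitr ltrD //.
        by rewrite cnormBC -linearB pi_norm hM // leq_maxr.
      by rewrite cnormBC hN // leq_maxl.
    - by exists 1.
    - move=> c _ _ [x _ <-] [y _ <-]; exists (c *: x + y) => //.
      by rewrite linearP.
    - move=> _ _ [x _ <-] [y _ <-]; exists (x * y) => //.
      by rewrite rmorphM.
    - by move=> _ [x _ <-]; exists (star x) => //; exact: piS.
  have [] : range pi a; last by move=> b _ <-; exists b.
  rewrite (A_gen _ hR) // => _ [x _ <-]; exists (kappa x) => //.
exists E, e, e', rho; split => //.
- split => //.
  + move=> x y; have [a <-] := pi_surj x; have [b <-] := pi_surj y.
    by rewrite -rmorphM !rhopi.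
  + by move=> x; have [a <-] := pi_surj x; rewrite -piS !rhopi.
  + move=> x y; have [a <-] := pi_surj x; have [b <-] := pi_surj y.
    by rewrite !rhopi => /inc_inj ->.
- by move=> x; rewrite /= psii.
Qed.
End EnvelopeComparison.

(** * Ideals, central elements and purity *)

(* Both [f] and [k] kill the vector [(- x, 1)] of the positive matrix
   [[1, x], [x^*, x^* x]], because their sum does. *)
Lemma cp_le_id_mult {R : realType} {E : cstarAlgType R} (f k : {linear E -> E}) :
  completely_positive (@cstar_mxpos R E) (@cstar_mxpos R E) f ->
  completely_positive (@cstar_mxpos R E) (@cstar_mxpos R E) k ->
  (forall x, f x + k x = x) -> forall x, f x = f 1 * x.
Proof.
move=> f_cp k_cp fk x.
pose Y : 'M[E]_(1, 2) := \row_l (if l == 0 then 1 else x).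
pose v : 'cV[E]_2 := \col_l (if l == 0 then - x else 1).
have Yv : Y *m v = 0.
  apply/matrixP => i l; rewrite !mxE !big_ord_recl big_ord0 !mxE /=.
  by rewrite mul1r mulr1 addr0 addNr.
have hY := cstar_mxpos_mul Y; set M := madj Y *m Y in hY.
have hf := f_cp _ _ hY; have hk := k_cp _ _ hY.
have sum0 : ip v (map_mx f M *m v) + ip v (map_mx k M *m v) = 0.
  rewrite -ipDr -mulmxDl.
  have -> : map_mx f M + map_mx k M = M by apply/matrixP => i l; rewrite !mxE fk.
  by rewrite /M -mulmxA Yv mulmx0 /ip mulmx0 mxE.
have [h0 _] := pos_add_eq0 (proj2 (proj1 (cstar_mxposP _) hf) v)
  (proj2 (proj1 (cstar_mxposP _) hk) v) sum0.
have Mv : map_mx f M *m v = 0.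
  case: hf h0 => Z -> ; rewrite -/(madj Z) -mulmxA -ip_madj => /ip_eq0 ->.
  by rewrite mulmx0.
have := congr1 (fun N : 'cV[E]_2 => N 0 0) Mv.
rewrite !mxE !big_ord_recl big_ord0 !mxE !big_ord_recl !big_ord0 !madjE !mxE /=.
rewrite star1 !mul1r !addr0 mulr1 mulrN => /eqP.
by rewrite addrC subr_eq0 => /eqP.
Qed.

Lemma pos_rscal_ge0 {R : realType} {E : cstarAlgType R} (t : R) :
  pos (rscal t : E) -> 0 <= t.
Proof.
move=> pt; rewrite leNgt; apply/negP => t0.
have : (rscal t : E) = 0.
  apply: pos_proper => //; rewrite -rscalN; apply: pos_rscal.
  by rewrite oppr_ge0 ltW.
move/(congr1 cnorm); rewrite cnorm_rscal cnorm0 => /eqP.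
by rewrite normr_eq0 (lt_eqF t0).
Qed.

(** Otherwise [c >= s] or [c <= t] whenever s < t, and then [c] equals the supremum of its scalar
    lower bounds. *)
Lemma not_scalar_gap {R : realType} {E : cstarAlgType R} (c : E) :
  pos c -> pos (1 - c) -> (forall t : R, c <> rscal t) ->
  exists s t : R, [/\ s < t, ~ pos (c - rscal s) & ~ pos (rscal t - c)].
Proof.
move=> pc p1c nsc; apply: contrapT => hn.
have dich s t : s < t -> pos (c - rscal s) \/ pos (rscal t - c).
  move=> st; have [h|h] := pselect (pos (c - rscal s)); first by left.
  right; apply: contrapT => h'; apply: hn; by exists s, t.
pose L := [set s : R | pos (c - rscal s)].
have hs : has_sup L.
  split; first by exists 0; rewrite /L /= rscal0 subr0.
  exists 1 => s ps; rewrite -subr_ge0; apply: (@pos_rscal_ge0 R E).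
  have := posD p1c ps; rewrite addrA subrK.
  by rewrite rscalD rscalN rscal1.
have sc : star c = c := pos_sa pc.
pose al := sup L; apply: (nsc al); apply/eqP; rewrite -subr_eq0; apply/eqP.
apply: pos_proper; apply: pos_archimedean => [|r r0].
- by rewrite starB star_rscal sc.
- have [s Ls sr] := sup_adherent r0 hs.
  have -> : rscal r + (c - rscal al) = (c - rscal s) + rscal (s - (al - r)).
    by rewrite !rscalD !rscalN rscalD rscalN; ncring.
  by apply: posD => //; apply: pos_rscal; rewrite subr_ge0 ltW.
- by rewrite starN starB star_rscal sc.
(* The first alternative would give a lower bound above the supremum. *)
- have lt : al + r / 2 < al + r by lra.
  have [h|h] := dich _ _ lt.
    have : al + r / 2 <= al by apply: sup_upper_bound.
    by lra.
  by rewrite opprB addrA [rscal r + _]addrC -rscalD.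
Qed.

Section IdealCone.
Context {R : realType} {A : cstarAlgType R} (J : set A).
Hypothesis hJ : closed_ideal J.

(* The [X] whose images in A/Ann(J) are positive. *)
Definition ideal_cone n (X : 'M[A]_n) :=
  forall v : 'cV[A]_n, (forall i, J (v i 0)) -> pos (ip v (X *m v)).

Lemma ideal_sum n (F : 'I_n -> A) : (forall i, J (F i)) -> J (\sum_i F i).
Proof. by have [_ J0 JD _ _] := hJ => h; elim/big_ind: _. Qed.

Lemma ideal_mulmx m n (X : 'M[A]_(m, n)) (v : 'cV[A]_n) :
  (forall i, J (v i 0)) -> forall i, J ((X *m v) i 0).
Proof.
have [_ _ _ Jl _] := hJ => h i; rewrite mxE; apply: ideal_sum => k.
exact: Jl.
Qed.

Lemma ideal_cone_pos n (X : 'M[A]_n) : cstar_mxpos X -> ideal_cone X.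
Proof. by move=> /cstar_mxposP [_ h] v _; exact: h. Qed.

Lemma ideal_coneD n (X Y : 'M[A]_n) : ideal_cone X -> ideal_cone Y ->
  ideal_cone (X + Y).
Proof. by move=> h1 h2 v hv; rewrite mulmxDl ipDr; apply: posD; [exact: h1 | exact: h2]. Qed.

Lemma ideal_cone_conj m n (X : 'M[A]_m) (Y : 'M[A]_(m, n)) : ideal_cone X ->
  ideal_cone (madj Y *m X *m Y).
Proof.
move=> h v hv; rewrite -!mulmxA -ip_madj; apply: h; exact: ideal_mulmx.
Qed.

Lemma ideal_cone_arch n (X : 'M[A]_n) : madj X = X ->
  (forall r : R, 0 < r -> ideal_cone ((r%:C *: 1)%:M + X)) -> ideal_cone X.
Proof.
move=> sX h v hv; apply: (@pos_of_affine _ _ (ip v v)).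
- exact: ip_star.
- by rewrite ip_star ip_madj sX.
move=> t t0; have ti : 0 < t^-1 by rewrite invr_gt0.
have := posZ (ltW t0) (h _ ti v hv).
rewrite mulmxDl ipDr scalerDr; congr (pos (_ + _)).
have -> : (t^-1%:C *: 1)%:M *m v = v *m (rscal t^-1)%:M.
  apply/matrixP => i k; rewrite ord1 mul_cV_scalar mul_scalar_mx mxE.
  by rewrite -[_ *: 1]/(rscal _) rscalC.
by rewrite ipZr rscalC rscalE realZVK ?lt0r_neq0.
Qed.

(** Tested on the vector with the single entry [a] at [k], the form of [- V^* V] is positive, so [V]
    kills this vector. *)
Lemma ideal_cone_neg_sqr n (Y W V : 'M[A]_n) : ideal_cone Y ->
  madj W *m Y *m W = - (madj V *m V) -> forall i k a, J a -> V i k * a = 0.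
Proof.
move=> hY e i k a Ja.
pose v : 'cV[A]_n := \col_l (if l == k then a else 0).
have hv l : J (v l 0) by rewrite mxE; case: ifP => // _; have [_ J0 _ _ _] := hJ.
have h := ideal_cone_conj W hY hv.
rewrite e mulNmx ipNr -mulmxA -ip_madj in h.
have /ip_eq0 Vv : ip (V *m v) (V *m v) = 0 by apply: pos_proper => //; exact: ip_pos.
have := congr1 (fun N : 'cV[A]_n => N i 0) Vv; rewrite !mxE (bigD1 k) //= big1.
  by rewrite mxE eqxx addr0.
by move=> l lk; rewrite mxE (negbTE lk) mulr0.
Qed.

Definition right_annihilator : set A := [set a | forall x, J x -> x * a = 0].
Local Notation L := right_annihilator.

Lemma annihilator_ideal : closed_ideal L.
Proof.
have [_ J0 JD Jl Jr] := hJ; split.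
- move=> a ha x Jx; apply: cnorm_lt_eq0 => e e0.
  have k0 : 0 < cnorm x + 1 by rewrite ltr_wpDl ?cnorm_ge0.
  have [|b Lb ab] := ha (e / (cnorm x + 1)); first by rewrite divr_gt0.
  have -> : x * a = x * (a - b) by rewrite mulrBr (Lb x Jx) subr0.
  rewrite (le_lt_trans (cnormM _ _)) //.
  move: ab; rewrite ltr_pdivlMr // mulrC; apply: le_lt_trans.
  by rewrite ler_wpM2r ?cnorm_ge0 // lerDl.
- by move=> x _; rewrite mulr0.
- by move=> a b ha hb x Jx; rewrite mulrDr ha // hb // addr0.
- by move=> a b hb x Jx; rewrite mulrA hb //; exact: Jr.
- by move=> a b hb x Jx; rewrite mulrA hb // mul0r.
Qed.

Lemma ideal_sqr_eq0 x : J x -> (forall y, J y -> y * x = 0) -> x = 0.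
Proof.
have [_ _ _ _ Jr] := hJ => Jx h; apply: star_mul_eq0; apply: sqr_eq0.
  by rewrite starM starK.
by rewrite -mulrA [x * _]mulrA h ?mulr0 //; exact: Jr.
Qed.

(** The annihilator is two-sided: [a x] lies in J and is killed by J from the left. *)
Lemma annihilator_mul a x : L a -> J x -> a * x = 0.
Proof.
have [_ _ _ Jl _] := hJ => La Jx; apply: ideal_sqr_eq0; first exact: Jl.
by move=> y Jy; rewrite mulrA La // mul0r.
Qed.

(** Killing J from the left puts [a] in the annihilator, so [a^* a] lies there as well and
    [a (a^* a) = 0]. *)
Lemma annihilator_essential a : (forall x, J x -> a * x = 0) ->
  (forall x, L x -> a * x = 0) -> a = 0.
Proof.
have [_ _ _ Jl Jr] := hJ => aJ aL.
have La : L a.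
  move=> x Jx; apply: star_mul_eq0; apply: sqr_eq0; first by rewrite starM starK.
  rewrite -mulrA -[x * a * _]mulrA aJ ?mulr0 //; apply: Jl.
  exact: Jr.
apply: star_mul_eq0; apply: sqr_eq0; first by rewrite starM starK.
have [_ _ _ Ll _] := annihilator_ideal.
by rewrite -mulrA aL ?mulr0 //; exact: Ll.
Qed.
End IdealCone.

Section SplitByIdeals.
Context {R : realType} {A : cstarAlgType R} (J L : set A).
Hypotheses (hJ : closed_ideal J) (hL : closed_ideal L).
Local Notation V := (A * A)%type.

Let fst_lin : linear (fun x : V => x.1). Proof. by []. Qed.
Let snd_lin : linear (fun x : V => x.2). Proof. by []. Qed.
Definition fstl : {linear V -> A} := HB.pack (fun x : V => x.1)
  (GRing.isLinear.Build R[i] V A _ (fun x : V => x.1) fst_lin).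
Definition sndl : {linear V -> A} := HB.pack (fun x : V => x.2)
  (GRing.isLinear.Build R[i] V A _ (fun x : V => x.2) snd_lin).

Let inl_lin : linear (fun a : A => (a, 0) : V).
Proof.
move=> c x y.
by rewrite -[RHS]/(c *: _ + _, c *: _ + _) ?scaler0 ?addr0.
Qed.
Let inr_lin : linear (fun a : A => (0, a) : V).
Proof.
move=> c x y.
by rewrite -[RHS]/(c *: _ + _, c *: _ + _) ?scaler0 ?addr0.
Qed.
Definition inll : {linear A -> V} := HB.pack (fun a : A => (a, 0) : V)
  (GRing.isLinear.Build R[i] A V _ (fun a : A => (a, 0) : V) inl_lin).
Definition inrl : {linear A -> V} := HB.pack (fun a : A => (0, a) : V)
  (GRing.isLinear.Build R[i] A V _ (fun a : A => (0, a) : V) inr_lin).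

Definition split_adj (x : V) : V := (star x.1, star x.2).

Definition split_cone n (X : 'M[V]_n) : Prop :=
  [/\ (map_mx split_adj X)^T = X, ideal_cone J (map_mx fstl X) &
      ideal_cone L (map_mx sndl X)].

Let split_herm n (X : 'M[V]_n) : (map_mx split_adj X)^T = X <->
  madj (map_mx fstl X) = map_mx fstl X /\ madj (map_mx sndl X) = map_mx sndl X.
Proof.
split=> [/matrixP h|[/matrixP h1 /matrixP h2]].
  by split; apply/matrixP => i k; have := h i k; rewrite madjE !mxE => <-.
apply/matrixP => i k; have := h1 i k; have := h2 i k; rewrite !madjE !mxE /= => e2 e1.
by rewrite /split_adj e1 e2; case: (X i k).
Qed.

Let split_adjD x y : split_adj (x + y) = split_adj x + split_adj y.
Proof. by rewrite /split_adj /= !starD. Qed.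
Let split_adjZ (c : R[i]) x : split_adj (c *: x) = c^*%C *: split_adj x.
Proof. by rewrite /split_adj /= !starZ. Qed.
Let split_adjK x : split_adj (split_adj x) = x.
Proof. by case: x => a b; rewrite /split_adj /= !starK. Qed.
Let split_cone_adj n (X : 'M[V]_n) : split_cone X -> (map_mx split_adj X)^T = X.
Proof. by case. Qed.
Let split_cone0 n : split_cone (0 : 'M[V]_n).
Proof.
have e (f : {linear V -> A}) : map_mx f (0 : 'M[V]_n) = 0.
  by apply/matrixP => i k; rewrite !mxE linear0.
split.
- apply/split_herm; rewrite !e; split; apply/matrixP => i k; by rewrite madjE !mxE star0.
- by rewrite e; apply: ideal_cone_pos; exact: cstar_mxpos0.
- by rewrite e; apply: ideal_cone_pos; exact: cstar_mxpos0.
Qed.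
Let mapD (f : {linear V -> A}) n (X Y : 'M[V]_n) :
  map_mx f (X + Y) = map_mx f X + map_mx f Y.
Proof. by apply/matrixP => i k; rewrite !mxE linearD. Qed.
Let split_coneD n (X Y : 'M[V]_n) : split_cone X -> split_cone Y -> split_cone (X + Y).
Proof.
move=> [/split_herm [a1 a2] b1 c1] [/split_herm [a3 a4] b2 c2]; split.
- by apply/split_herm; rewrite !mapD !madjD a1 a2 a3 a4.
- by rewrite mapD; exact: ideal_coneD.
- by rewrite mapD; exact: ideal_coneD.
Qed.
Let split_cone_compress n m (a : 'M[R[i]]_(n, m)) (X : 'M[V]_n) :
  split_cone X -> split_cone (compress a X).
Proof.
move=> [/split_herm [a1 a2] b1 c1]; split.
- apply/split_herm; rewrite !compress_map !compressE.
  by split; rewrite !madjM madjK ?a1 ?a2 mulmxA.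
- by rewrite compress_map compressE; exact: ideal_cone_conj.
- by rewrite compress_map compressE; exact: ideal_cone_conj.
Qed.
Let split_unit_adj : split_adj (1, 1) = (1, 1).
Proof. by rewrite /split_adj /= star1. Qed.
Let map_unit (f : {linear V -> A}) n (r : R) (X : 'M[V]_n) : f (1, 1) = 1 ->
  map_mx f ((r%:C *: (1, 1))%:M + X) = (r%:C *: 1)%:M + map_mx f X.
Proof. by move=> f1; apply/matrixP => i k; rewrite !mxE linearD linearMn linearZ /= f1. Qed.
Let unit_herm n (r : R) : madj ((r%:C *: 1)%:M : 'M[A]_n) = (r%:C *: 1)%:M.
Proof. by rewrite madj_scalar starZr star1. Qed.
Let split_order n (X : 'M[V]_n) : (map_mx split_adj X)^T = X ->
  exists2 r : R, 0 < r & split_cone ((r%:C *: (1, 1))%:M + X).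
Proof.
move=> /split_herm [h1 h2].
have [r r0 hr] := cstar_order_unit h1; have [s s0 hs] := cstar_order_unit h2.
have ge (t u : R) (Y : 'M[A]_n) : t <= u -> cstar_mxpos ((t%:C *: 1)%:M + Y) ->
    cstar_mxpos ((u%:C *: 1)%:M + Y).
  exact: (@punit_order_ge R A (os_preos (cstar_os A))).
exists (r + s); first exact: addr_gt0.
split.
- by apply/split_herm; rewrite !map_unit // !madjD !unit_herm h1 h2.
- rewrite map_unit //; apply: ideal_cone_pos; apply: ge hr.
  by rewrite lerDl ltW.
- rewrite map_unit //; apply: ideal_cone_pos; apply: ge hs.
  by rewrite lerDr ltW.
Qed.
Let split_arch n (X : 'M[V]_n) : (map_mx split_adj X)^T = X ->
  (forall r : R, 0 < r -> split_cone ((r%:C *: (1, 1))%:M + X)) -> split_cone X.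
Proof.
move=> hX h; have /split_herm [h1 h2] := hX; split => //.
- apply: ideal_cone_arch => // r r0; have [_ hr _] := h r r0.
  by rewrite -map_unit.
- apply: ideal_cone_arch => // r r0; have [_ _ hr] := h r r0.
  by rewrite -map_unit.
Qed.

(* The operator system A/Ann(J) + A/Ann(L). *)
Definition split_preos : preos V := Preos split_adjD split_adjZ split_adjK
  split_cone_adj split_cone0 split_coneD split_cone_compress split_unit_adj
  split_order split_arch.

Let map_id (f : {linear A -> V}) (g : {linear V -> A}) (fg : forall a, g (f a) = a) n
  (X : 'M[A]_n) : map_mx g (map_mx f X) = X.
Proof. by apply/matrixP => i k; rewrite !mxE. Qed.
Let map_0 (f : {linear A -> V}) (g : {linear V -> A}) (fg : forall a, g (f a) = 0) n
  (X : 'M[A]_n) : map_mx g (map_mx f X) = 0.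
Proof. by apply/matrixP => i k; rewrite !mxE. Qed.

Lemma split_cone_inl n (X : 'M[A]_n) : cstar_mxpos X -> split_cone (map_mx inll X).
Proof.
move=> hX; have m0 : madj (0 : 'M[A]_n) = 0 by apply/matrixP => i k; rewrite madjE !mxE star0.
have e1 := map_id (f := inll) (g := fstl) (fun=> erefl) X.
have e2 := map_0 (f := inll) (g := sndl) (fun=> erefl) X.
split; first by apply/split_herm; rewrite e1 e2 m0 cstar_mxpos_sa.
- by rewrite e1; exact: ideal_cone_pos.
- by rewrite e2; apply: ideal_cone_pos; exact: cstar_mxpos0.
Qed.

Lemma split_cone_inr n (X : 'M[A]_n) : cstar_mxpos X -> split_cone (map_mx inrl X).
Proof.
move=> hX; have m0 : madj (0 : 'M[A]_n) = 0 by apply/matrixP => i k; rewrite madjE !mxE star0.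
have e1 := map_id (f := inrl) (g := sndl) (fun=> erefl) X.
have e2 := map_0 (f := inrl) (g := fstl) (fun=> erefl) X.
split; first by apply/split_herm; rewrite e1 e2 m0 cstar_mxpos_sa.
- by rewrite e2; apply: ideal_cone_pos; exact: cstar_mxpos0.
- by rewrite e1; exact: ideal_cone_pos.
Qed.

Lemma split_null1 a : (forall x, J x -> a * x = 0) -> null split_preos (a, 0).
Proof.
move=> aJ; split; first exact: (@herm_offdiag R V split_preos).
- move=> v hv; have -> : ip v (map_mx fstl (offdiag split_preos (a, 0)) *m v) = 0.
    rewrite ipE !big_ord_recl big_ord0 !mxE !big_ord_recl !big_ord0 !mxE /=.
    rewrite !mul0r !addr0 !add0r (_ : lift ord0 ord0 = 1); last exact/val_inj.
    rewrite aJ // mulr0 add0r mulrA -starM aJ // star0 mul0r.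
    by [].
  exact: pos0.
- have -> : map_mx sndl (offdiag split_preos (a, 0)) = 0.
    by apply/matrixP => i k; rewrite !mxE; case: ifP => _; case: ifP => _ //=; rewrite star0.
  by apply: ideal_cone_pos; exact: cstar_mxpos0.
Qed.

Lemma split_null2 a : (forall x, L x -> a * x = 0) -> null split_preos (0, a).
Proof.
move=> aL; split; first exact: (@herm_offdiag R V split_preos).
- have -> : map_mx fstl (offdiag split_preos (0, a)) = 0.
    by apply/matrixP => i k; rewrite !mxE; case: ifP => _; case: ifP => _ //=; rewrite star0.
  by apply: ideal_cone_pos; exact: cstar_mxpos0.
- move=> v hv; have -> : ip v (map_mx sndl (offdiag split_preos (0, a)) *m v) = 0.
    rewrite ipE !big_ord_recl big_ord0 !mxE !big_ord_recl !big_ord0 !mxE /=.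
    rewrite !mul0r !addr0 !add0r (_ : lift ord0 ord0 = 1); last exact/val_inj.
    rewrite aL // mulr0 add0r mulrA -starM aL // star0 mul0r.
    by [].
  exact: pos0.
Qed.
End SplitByIdeals.

Section Purity.
Context {R : realType} {S I : opSystemType R} (iota : {linear S -> I}).
Context {A : cstarAlgType R} (iota_e : {linear S -> A}).
Hypothesis hI : injective_envelope iota.
Hypothesis hA : cstar_envelope iota_e.

Let I_inj : injective_os I. Proof. by case: hI. Qed.
Let iota_emb : os_embedding iota. Proof. by case: hI. Qed.
Let iota_cp : os_cp iota. Proof. by case: iota_emb => -[]. Qed.
Let I_min : forall (Q : opSystemType R) (j : {linear Q -> I}),
  os_embedding j -> range iota `<=` range j -> injective_os Q -> range j = setT.
Proof. by case: hI. Qed.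
Let iota_e_emb : @os_embedding R S (cstar_os A) iota_e. Proof. by case: hA. Qed.

Variables (E : cstarAlgType R) (e : {linear I -> E}) (e' : {linear E -> I}).
Variable rho : {linear A -> E}.
Hypotheses (eK : cancel e e') (e'K : cancel e' e).
Hypothesis epos : forall n (X : 'M[I]_n), mxpos X <-> cstar_mxpos (map_mx e X).
Hypothesis e1 : e ounit = 1.
Hypothesis rhoM : forall x y, rho (x * y) = rho x * rho y.
Hypothesis rhoS : forall x, rho (star x) = star (rho x).
Hypothesis rho1 : rho 1 = 1.
Hypothesis rho_inj : injective rho.
Hypothesis rho_iota : forall x, rho (iota_e x) = e (iota x).

Let e'pos n (X : 'M[E]_n) : cstar_mxpos X -> mxpos (map_mx e' X).
Proof.
move=> hX; apply/epos; move: hX; congr cstar_mxpos.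
by apply/matrixP => i k; rewrite !mxE e'K.
Qed.
Let e'1 : e' 1 = ounit. Proof. by rewrite -e1 eK. Qed.
Let eS x : e (adj x) = star (e x).
Proof.
apply: (@os_cp_adj R I (cstar_os E) e) => n X hX; exact/epos.
Qed.

(** Extend [f] along the inclusion of A in I to a map on I. It fixes S, so it is the identity by
    rigidity. *)
Lemma cp_extension_unique (f : {linear A -> I}) :
  completely_positive (@cstar_mxpos R A) (@mxpos R I) f ->
  (forall x, f (iota_e x) = iota x) -> forall a, f a = e' (rho a).
Proof.
move=> f_cp fi.
pose t : {linear cstar_os A -> I} := e' \o rho.
have tX n (X : 'M[A]_n) : map_mx t X = map_mx e' (map_mx rho X).
  by apply/matrixP => i k; rewrite !mxE.
have t_emb : os_embedding t.
  split; last by rewrite /= rho1 e'1.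
  split.
  - by move=> x y /(can_inj e'K) /rho_inj.
  - by move=> n X hX; rewrite tX; apply: e'pos; exact: starhom_cp.
  - move=> n X; rewrite tX => /epos hX.
    apply: (starhom_reflects rhoM rhoS rho_inj); move: hX; congr cstar_mxpos.
    by apply/matrixP => i k; rewrite !mxE e'K.
have [g g_cp gt] := I_inj t_emb f_cp.
have g_id : g =1 id.
  apply: (rigid iota_emb I_inj I_min g_cp) => x.
  have tk : t (iota_e x) = iota x by rewrite -[LHS]/(e' (rho (iota_e x))) rho_iota eK.
  by have := gt (iota_e x); rewrite tk => ->; rewrite fi.
by move=> a; rewrite -gt g_id.
Qed.

Lemma pure_prime : os_pure iota -> prime_cstar A.
Proof.
move=> [_ pure_iota] J K hJ hK JK.
apply: contrapT => /not_orP [J0 K0].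
have nonzero (B : set A) : closed_ideal B -> B <> [set 0] -> exists2 x, B x & x <> 0.
  move=> [_ B0 _ _ _] hB; apply: contrapT => hn; apply: hB.
  apply/seteqP; split => x /=; last by move=> ->.
  by move=> Bx; apply: contrapT => x0; apply: hn; exists x.
have [j0 Jj0 j0n] := nonzero J hJ J0; have [l0 Kl0 l0n] := nonzero K hK K0.
pose L := right_annihilator J; have hL : closed_ideal L by exact: annihilator_ideal.
(* From here on K is replaced by the annihilator of J, which contains [l0] and makes [J + L]
   essential. *)
have Ll0 : L l0 by move=> x Jx; exact: JK.
have [T [q [qsurj q1 qpos qrefl]]] := preos_quotient (split_preos hJ hL).
pose diagf (x : S) : (A * A)%type := (iota_e x, iota_e x).
have diag_lin : linear diagf.
  by move=> c x y; rewrite /diagf !linearP.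
pose diag : {linear S -> (A * A)%type} := HB.pack diagf
  (GRing.isLinear.Build R[i] S (A * A)%type _ diagf diag_lin).
have map1 n (X : 'M[S]_n) : map_mx (@fstl R A) (map_mx diag X) = map_mx iota_e X.
  by apply/matrixP => i k; rewrite !mxE.
have map2 n (X : 'M[S]_n) : map_mx (@sndl R A) (map_mx diag X) = map_mx iota_e X.
  by apply/matrixP => i k; rewrite !mxE.
have [[ie_inj ie_cp ie_refl] ie1] := iota_e_emb.
have ieS x : iota_e (adj x) = star (iota_e x).
  exact: (@os_cp_adj R S (cstar_os A) iota_e ie_cp).
have diag_herm n (X : 'M[S]_n) : (map_mx adj X)^T = X ->
    (map_mx (@split_adj R A) (map_mx diag X))^T = map_mx diag X.
  move=> /matrixP hX; apply/matrixP => i k; have := hX i k; rewrite !mxE => <-.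
  by rewrite /split_adj /= -ieS.
have t_emb : os_embedding (q \o diag).
  apply: os_embedding_herm.
  - move=> n X hX; have := ie_cp _ _ hX => hY.
    have : pcone (split_preos hJ hL) (map_mx diag X).
      split; first by apply: diag_herm; exact: mxpos_adj.
        by rewrite map1; exact: ideal_cone_pos.
      by rewrite map2; exact: ideal_cone_pos.
    move/qpos; congr mxpos; by apply/matrixP => i k; rewrite !mxE.
  - move=> n X hX hm; have hd := diag_herm _ _ hX.
    have [_ c1 c2] : split_cone J L (map_mx diag X).
      apply: qrefl => //; move: hm; congr mxpos.
      by apply/matrixP => i k; rewrite !mxE.
    apply: ie_refl; rewrite map1 in c1; rewrite map2 in c2.
    set Y := map_mx iota_e X in c1 c2 *.
    have sY : madj Y = Y.
      apply/matrixP => i k; rewrite madjE !mxE -ieS.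
      by have /matrixP/(_ i k) := hX; rewrite !mxE => ->.
    case: n X Y sY c1 c2 {hX hm hd} => [|n] X Y sY c1 c2; first exact: cstar_mxpos0n.
    have [W [U [sW sU WYW Ypos _]]] := @negative_witness R (cmx A n) Y sY.
    (* The entries of [U] kill both J and L, hence vanish by [annihilator_essential]. *)
    apply/cmx_posP/Ypos; rewrite WYW (_ : U = 0) ?mul0r ?oppr0 //.
    have eW : madj W *m Y *m W = - (madj U *m U).
      by rewrite [madj W]sW [madj U]sU; exact: WYW.
    apply/(@matrixP A n.+1 n.+1) => i k; rewrite mxE.
    apply: (annihilator_essential hJ) => x hx.
      exact: (ideal_cone_neg_sqr hJ c1 eW).
    exact: (ideal_cone_neg_sqr hL c2 eW).
  - by rewrite /= /diagf ie1 -q1.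
have [theta theta_cp thetai] := I_inj t_emb iota_cp.
pose G : {linear A -> I} := theta \o q \o @inll R A.
pose H : {linear A -> I} := theta \o q \o @inrl R A.
have G_cp : completely_positive (@cstar_mxpos R A) (@mxpos R I) G.
  move=> n X hX; have := theta_cp _ _ (qpos _ _ (split_cone_inl _ _ hX)).
  by congr mxpos; apply/matrixP => i k; rewrite !mxE.
have H_cp : completely_positive (@cstar_mxpos R A) (@mxpos R I) H.
  move=> n X hX; have := theta_cp _ _ (qpos _ _ (split_cone_inr _ _ hX)).
  by congr mxpos; apply/matrixP => i k; rewrite !mxE.
have Gl0 : G l0 = 0.
  have z : q (l0, 0) = 0.
    apply: (quotient_null qpos); apply: split_null1 => x Jx.
    exact: (annihilator_mul hJ).
  by rewrite -[LHS]/(theta (q (l0, 0))) z linear0.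
have Hj0 : H j0 = 0.
  have z : q (0, j0) = 0 by apply: (quotient_null qpos); apply: split_null2 => x; exact.
  by rewrite -[LHS]/(theta (q (0, j0))) z linear0.
have g_cp : os_cp (G \o iota_e).
  move=> n X hX; have := G_cp _ _ (ie_cp _ _ hX).
  by congr mxpos; apply/matrixP => i k; rewrite !mxE.
have h_cp : os_cp (H \o iota_e).
  move=> n X hX; have := H_cp _ _ (ie_cp _ _ hX).
  by congr mxpos; apply/matrixP => i k; rewrite !mxE.
have gh x : (G \o iota_e) x + (H \o iota_e) x = iota x.
  rewrite -thetai -[LHS]/(theta (q (iota_e x, 0)) + theta (q (0, iota_e x))) -!linearD.
  by congr (theta (q _)); congr pair; rewrite /= ?addr0 ?add0r.
have [s [/andP[s0 s1] gs hs]] := pure_iota _ _ g_cp h_cp gh.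
have e'rho0 x : e' (rho x) = 0 -> x = 0.
  by move=> hx; apply: rho_inj; apply: (can_inj e'K); rewrite hx !linear0.
(* If [s = 0], then [H] extends [iota] and must be the inclusion of A, yet it kills [j0]. *)
have [sz|sn] := eqVneq s 0.
  apply: j0n; apply: e'rho0; rewrite -(cp_extension_unique H_cp) // => x.
  by have := hs x; rewrite sz subr0 scale1r.
(* Otherwise [G / s] extends [iota] and kills [l0]. *)
pose Gs : {linear A -> I} := s^-1%:C \*: G.
apply: l0n; apply: e'rho0; rewrite -(@cp_extension_unique Gs).
- by rewrite /= -[LHS]/(s^-1%:C *: G l0) Gl0 scaler0.
- move=> n X hX; have si : 0 <= s^-1 by rewrite invr_ge0.
  have := @pconeZ R I (os_preos I) n s^-1 (map_mx G X) si (G_cp _ _ hX).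
  by congr mxpos; apply/matrixP => i k; rewrite !mxE.
- move=> x; rewrite -[LHS]/(s^-1%:C *: G (iota_e x)) -[G _]/((G \o iota_e) x) gs scalerA.
  by rewrite -rmorphM mulVf // scale1r.
Qed.

(* Multiplication by [f] makes the ordering of I coarser without changing that of S. *)
Lemma central_essential (f g : E) : pos f -> (forall x, x * f = f * x) ->
  (forall a, f * rho a = 0 -> a = 0) -> star g = g -> f * g = 0 -> g = 0.
Proof.
move=> pf fc f_ess sg fg.
have sf := pos_sa pf.
have [r [sr rr pr cr]] := pos_sqrt pf.
have rc x : x * r = r * x by apply: cr.
have m_lin : linear (fun x : I => f * e x).
  by move=> c x y; rewrite linearP mulrDr scalerAr.
pose m : {linear I -> E} := HB.pack (fun x : I => f * e x)
  (GRing.isLinear.Build R[i] I E _ (fun x : I => f * e x) m_lin).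
(* Multiplication by [f] is conjugation by its central root [r], hence preserves matrix
   positivity. *)
have mE n (X : 'M[I]_n) : map_mx m X = r%:M *m map_mx e X *m r%:M.
  by apply/matrixP => i k; rewrite scalar_conj_mx !mxE -mulrA rc mulrA rr.
have rcM p q (Z : 'M[E]_(p, q)) : Z *m r%:M = r%:M *m Z.
  apply/matrixP => i k; rewrite mul_scalar_mx [RHS]mxE -rc [LHS]mxE (bigD1 k) //=.
  by rewrite big1 => [|l lk]; rewrite mxE ?eqxx ?(negbTE lk) ?mulr0 // addr0 mulr1n.
have hermE n (X : 'M[I]_n) : (map_mx adj X)^T = X -> madj (map_mx e X) = map_mx e X.
  by move=> /matrixP hX; apply/matrixP => i k; have := hX i k; rewrite !mxE -eS => ->.
have sMr n : madj (r%:M : 'M[E]_n) = r%:M by rewrite madj_scalar sr.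
pose Q n (X : 'M[I]_n) := (map_mx adj X)^T = X /\ cstar_mxpos (map_mx m X).
have hQ : coarser_order iota Q.
  split.
  - move=> n X hX; split; first exact: mxpos_adj.
    by rewrite mE -{1}sMr; apply: cstar_mxpos_conj; exact/epos.
  - by move=> n X [].
  - move=> n X Y [h1 h2] [h3 h4]; split; first exact: (@hermD R I (os_preos I)).
    have -> : map_mx m (X + Y) = map_mx m X + map_mx m Y.
      by apply/matrixP => i j; rewrite !mxE linearD.
    exact: cstar_mxposD.
  - move=> n k a X [h1 h2]; split; first exact: (@herm_compress R I (os_preos I)).
    by rewrite compress_map; exact: cstar_mxpos_compress.
  - move=> n X hX h; split => //; apply: cstar_archimedean => [|t t0].
      by rewrite mE !madjM !sMr hermE // mulmxA.
    have K0 : 0 < cnorm f + 1 by rewrite ltr_wpDl ?cnorm_ge0.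
    (* Chosen so that [t' f <= t], which lets an error in the unit of I be absorbed after
       multiplication by [f]. *)
    pose t' := t / (cnorm f + 1); have t'0 : 0 < t' by exact: divr_gt0.
    have [_ ht] := h _ t'0.
    have -> : (t%:C *: 1)%:M + map_mx m X =
        (rscal t - t'%:C *: f)%:M + map_mx m ((t'%:C *: ounit)%:M + X).
      have mo : m (t'%:C *: ounit) = t'%:C *: f.
        by rewrite -[LHS]/(f * e (_ *: _)) [e _]linearZ -[RHS]mulr1 -scalerAr -scalerAl e1.
      apply/matrixP => i k.
      rewrite !mxE linearD linearMn.
      rewrite mo addrA.
      by rewrite -mulrnDl subrK.
    apply: cstar_mxposD => //; apply: cstar_mxpos_scalar; apply: pos_norm_sub.
      by rewrite starZr sf.
    rewrite cnormZr gtr0_norm // /t' mulrAC -mulrA ler_piMr ?ltW //.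
    by rewrite ltr_pdivrMr // mul1r ltrDl.
  - move=> n X [hX hm]; have [[ie_inj ie_cp ie_refl] ie1] := iota_e_emb.
    apply: ie_refl; set Y := map_mx iota_e X.
    have rY : map_mx rho Y = map_mx e (map_mx iota X).
      by apply/matrixP => i k; rewrite !mxE rho_iota.
    have sY : madj Y = Y.
      have sr' : madj (map_mx rho Y) = map_mx rho Y by rewrite rY hermE.
      apply/matrixP => i k; apply: rho_inj; move/matrixP/(_ i k): sr'.
      by rewrite !madjE !mxE rhoS.
    rewrite mE -rY in hm; move: Y sY hm {rY hX} => Y; clear X.
    case: n Y => [|n] Y sY hm; first exact: cstar_mxpos0n.
    have [W [U [sW sU WYW Ypos _]]] := @negative_witness R (cmx A n) Y sY.
    apply/cmx_posP/Ypos; rewrite WYW (_ : U = 0) ?mul0r ?oppr0 //.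
    have eW : madj W *m Y *m W = - (madj U *m U).
      by rewrite [madj W]sW [madj U]sU; exact: WYW.
    have hc := cstar_mxpos_conj (map_mx rho W) hm.
    (* Conjugating the positive [r rho(Y) r] by [rho(W)] gives [- (rho(U) r)^* (rho(U) r)]. So
       [rho(U) r = 0], then [f rho(U) = 0], and [f_ess] gives [U = 0]. *)
    have z : madj (map_mx rho U *m r%:M) *m (map_mx rho U *m r%:M) = 0.
      apply: cstar_mxpos_proper; first exact: cstar_mxpos_mul.
      move: hc; congr cstar_mxpos.
      have eR : madj (map_mx rho W) *m map_mx rho Y *m map_mx rho W =
          - (madj (map_mx rho U) *m map_mx rho U).
        rewrite -!(map_madj rhoS) -!(map_mxM_hom rhoM) -map_mxN; congr (map_mx _ _).
        exact: eW.
      rewrite !mulmxA [madj _ *m r%:M]rcM -[_ *m r%:M *m _]mulmxA.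
      rewrite -[r%:M *m map_mx rho W]rcM madjM sMr -!mulmxA.
      rewrite [madj (map_mx rho W) *m _]mulmxA [_ *m (map_mx rho W *m _)]mulmxA eR.
      by rewrite mulNmx mulmxN !mulmxA.
    apply/(@matrixP A n.+1 n.+1) => i k; rewrite [RHS]mxE; apply: f_ess.
    have z' : map_mx rho U *m r%:M = 0 by apply: madj_mul_eq0 => l; rewrite z mxE.
    move/matrixP/(_ i k): z'; rewrite rcM mul_scalar_mx !mxE => z''.
    by rewrite -rr -mulrA z'' mulr0.
(* The contradiction element is [- g^2]: it becomes 0 after multiplication by [f], hence is positive
   in the coarser ordering. *)
have hX : (map_mx adj ((e' (- (g * g)))%:M : 'M_1))^T = (e' (- (g * g)))%:M.
  apply/matrixP => i k; rewrite !ord1 !mxE eqxx !mulr1n; apply: (can_inj eK).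
  by rewrite eS !e'K starN starM sg.
have /epos : mxpos ((e' (- (g * g)))%:M : 'M_1).
  apply: (coarser_order_trivial iota_emb I_inj I_min hQ); split => //.
  rewrite (_ : map_mx m _ = 0); first exact: cstar_mxpos0.
  apply/matrixP => i k; rewrite !ord1 !mxE eqxx !mulr1n /= e'K.
  by rewrite mulrN mulrA fg mul0r oppr0.
rewrite (_ : map_mx e _ = (- (g * g))%:M).
  by move=> /cstar_mxpos11 h; apply: sqr_eq0 => //; apply: pos_proper h; exact: pos_sqr.
by apply/matrixP => i k; rewrite !ord1 !mxE eqxx !mulr1n e'K.
Qed.

Lemma kernel_ideal (f : E) : (forall x, x * f = f * x) ->
  closed_ideal [set a | f * rho a = 0].
Proof.
move=> fc; split => /=.
- move=> a ha; apply: cnorm_lt_eq0 => eps eps0.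
  have k0 : 0 < cnorm f + 1 by rewrite ltr_wpDl ?cnorm_ge0.
  have [|b /= fb ab] := ha (eps / (cnorm f + 1)); first by rewrite divr_gt0.
  have -> : f * rho a = f * rho (a - b) by rewrite linearB mulrBr fb subr0.
  rewrite (le_lt_trans (cnormM _ _)) //; move: ab; rewrite ltr_pdivlMr // mulrC.
  apply: le_lt_trans; apply: ler_pM; rewrite ?cnorm_ge0 ?lerDl //.
  exact: (ucp_contractive (starhom_cp rhoM rhoS)).
- by rewrite linear0 mulr0.
- by move=> x y hx hy; rewrite linearD mulrDr hx hy addr0.
- by move=> a x hx; rewrite rhoM mulrA -fc -mulrA hx mulr0.
- by move=> a x hx; rewrite rhoM mulrA hx mul0r.
Qed.

Lemma prime_central_scalar (c : E) : prime_cstar A ->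
  pos c -> pos (1 - c) -> (forall x, x * c = c * x) -> exists t, c = rscal t.
Proof.
move=> A_prime pc p1c cc; have sc := pos_sa pc.
apply: contrapT => hn; have [|s [t [st ns nt]]] := not_scalar_gap pc p1c.
  by move=> t ct; apply: hn; exists t.
have [f1 [g1 [pf1 pg1 gf1 d1 cf1]]] : exists f g, [/\ pos f, pos g, g * f = 0,
    (c - rscal s) + (c - rscal s) = f - g & forall x, x * f = f * x /\ x * g = g * x].
  have [|f [g [pf pg gf d cf]]] := @pos_parts R E (c - rscal s).
    by rewrite starB sc star_rscal.
  exists f, g; split=> // x; apply: cf.
  by rewrite mulrBl mulrBr cc rscalC.
have [f2 [g2 [pf2 pg2 gf2 d2 cf2]]] : exists f g, [/\ pos f, pos g, g * f = 0,
    (rscal t - c) + (rscal t - c) = f - g & forall x, x * f = f * x /\ x * g = g * x].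
  have [|f [g [pf pg gf d cf]]] := @pos_parts R E (rscal t - c).
    by rewrite starB sc star_rscal.
  exists f, g; split=> // x; apply: cf.
  by rewrite mulrBl mulrBr cc rscalC.
have half (x : E) : pos (x + x) -> pos x.
  by move=> px; rewrite -(halfZ_double x); apply: posZ; rewrite ?invr_ge0.
(* [f1 + f2] dominates the positive scalar [2 (t - s)]; this stands in for its invertibility. *)
have fsum : f1 + f2 = rscal (t - s + (t - s)) + (g1 + g2).
  have -> : f1 + f2 = (f1 - g1) + (f2 - g2) + (g1 + g2) by ncring.
  by rewrite -d1 -d2 !rscalD !rscalN; ncring.
(* [b = rho (x y)] is killed by [f1] and [f2], so [b^* (f1 + f2) b = 0], and the scalar part of
   [f1 + f2] forces [b = 0]. *)
have JJ x y : f1 * rho x = 0 -> f2 * rho y = 0 -> x * y = 0.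
  move=> hx hy; apply: rho_inj; rewrite linear0; set b := rho (x * y).
  have b1 : f1 * b = 0 by rewrite /b rhoM mulrA hx mul0r.
  have b2 : f2 * b = 0 by rewrite /b rhoM mulrA -(proj1 (cf2 _)) -mulrA hy mulr0.
  have ts : 0 < t - s + (t - s) by rewrite addr_gt0 // subr_gt0.
  have p1 := pos_conj b (@pos_rscal R E _ (ltW ts)).
  have p2 := pos_conj b (posD pg1 pg2).
  have [|h _] := pos_add_eq0 p1 p2.
    by rewrite -mulrDl -mulrDr -fsum -mulrA mulrDl b1 b2 addr0 mulr0.
  apply: star_mul_eq0; move: h; rewrite rscalC -mulrA rscalE => h.
  by rewrite -[LHS](realZKV _ (lt0r_neq0 ts)) h scaler0.
(* If the negative part vanished, [c - s] would be positive. *)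
have g10 : g1 <> 0.
  by move=> g0; apply: ns; apply: half; rewrite d1 g0 subr0.
have g20 : g2 <> 0.
  by move=> g0; apply: nt; apply: half; rewrite d2 g0 subr0.
have ess (f g : E) : pos f -> pos g -> g * f = 0 ->
    (forall x, x * f = f * x /\ x * g = g * x) ->
    [set a | f * rho a = 0] = [set 0] -> g = 0.
  move=> pf pg gf cfg h.
  apply: (central_essential pf); rewrite ?(pos_sa pg) -?(proj1 (cfg g)) //.
  - by move=> x; case: (cfg x).
  - by move=> a ha; have : [set a | f * rho a = 0] a := ha; rewrite h.
have [|] := A_prime _ _ (@kernel_ideal f1 (fun x => proj1 (cf1 x)))
  (@kernel_ideal f2 (fun x => proj1 (cf2 x))) JJ.
- by move/(ess _ _ pf1 pg1 gf1 cf1).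
- by move/(ess _ _ pf2 pg2 gf2 cf2).
Qed.

Lemma prime_pure : prime_cstar A -> os_pure iota.
Proof.
move=> A_prime; split=> [//|g h g_cp h_cp gh].
have [G G_cp Gi] := I_inj iota_emb g_cp; have [H H_cp Hi] := I_inj iota_emb h_cp.
pose GH : {linear I -> I} := G \+ H.
have GHE x : G x + H x = x.
  (* The extensions were chosen independently, but their sum fixes S. *)
  apply: (@rigid R S I iota iota_emb I_inj I_min GH) => [n X hX|y].
    have -> : map_mx GH X = map_mx G X + map_mx H X by apply/matrixP => i k; rewrite !mxE.
    exact: (@mxposD R I _ _ _ (G_cp _ _ hX) (H_cp _ _ hX)).
  by rewrite -[LHS]/(G _ + H _) Gi Hi.
pose G' : {linear E -> E} := e \o G \o e'; pose H' : {linear E -> E} := e \o H \o e'.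
have conj_cp (F : {linear I -> I}) : os_cp F ->
    completely_positive (@cstar_mxpos R E) (@cstar_mxpos R E) (e \o F \o e').
  move=> F_cp n X hX; have /epos := F_cp _ _ (e'pos hX).
  by congr cstar_mxpos; apply/matrixP => i k; rewrite !mxE.
have G'_cp := conj_cp _ G_cp; have H'_cp := conj_cp _ H_cp.
have GH' x : G' x + H' x = x.
  by rewrite -[LHS]/(e (G (e' x)) + e (H (e' x))) -linearD GHE e'K.
have G'l := cp_le_id_mult G'_cp H'_cp GH'.
have G'S := cp_star G'_cp.
set c := G' 1 in G'l.
have pc : pos c by apply: (cp_pos G'_cp); exact: pos1.
have p1c : pos (1 - c).
  have -> : 1 - c = H' 1 by rewrite -[X in X - _](GH' 1) addrC addKr.
  by apply: (cp_pos H'_cp); exact: pos1.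
(* [G'] is left multiplication by [c] and preserves adjoints, so it is right multiplication by [c]
   as well. *)
have cc x : x * c = c * x.
  by rewrite -G'l -[x in RHS]starK G'S G'l starM starK (pos_sa pc).
have [t ct] := prime_central_scalar A_prime pc p1c cc.
have gE x : g x = t%:C *: iota x.
  rewrite -Gi; apply: (can_inj eK); rewrite linearZ /= -rscalE -ct -G'l.
  by rewrite -[RHS]/(e (G (e' (e (iota x))))) eK.
exists t; split=> // [|x].
  rewrite (@pos_rscal_ge0 R E) -?ct //= -subr_ge0 (@pos_rscal_ge0 R E) //.
  by rewrite rscalD rscalN rscal1 -ct.
by rewrite realCB scalerBl scale1r -gE -gh addrC addKr.
Qed.
End Purity.

Theorem theorem3p2 (R : realType) (S : opSystemType R)
  (I : opSystemType R) (iota_ie : {linear S -> I})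
  (A : cstarAlgType R) (iota_e : {linear S -> A}) :
  injective_envelope iota_ie -> cstar_envelope iota_e ->
  (os_pure iota_ie <-> prime_cstar A).
Proof.
move=> hI hA.
have [E [e [e' [rho [[eK e'K epos e1] [rhoM rhoS rho1 rho_inj] rho_iota]]]]] :=
  envelope_comparison hI hA.
split; first exact: (pure_prime hI hA eK e'K epos e1 rhoM rhoS rho1 rho_inj rho_iota).
exact: (prime_pure hI hA eK e'K epos e1 rhoM rhoS rho1 rho_inj rho_iota).
Qed.
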